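(* Assume $p_1=\dots=p_L=N$ with $N\in\mathbb{Z}^+$ possibly depending on $n$, that $T\to\infty$ as $n\to\infty$, and that the activation $\sigma$ is $1$-Lipschitz continuous. Assume also that $\max\{s^*\log(p\sqrt{n/s^*}),\,(L+1)s^*\log N\}=o(n)$ and $r_n^*\asymp\xi_n^*$. Let the prior slab variance $\sigma_0^2$ be a constant and let the prior inclusion probability $\lambda$ be given by $$-\log\lambda=\log(T)+\kappa\bigl[(L+1)\log N+\log(\sqrt{n}\,p)\bigr]$$ for any constant $\kappa>0$. Let $\delta>1$ be arbitrary and $\varepsilon_n^*=\sqrt{r_n^*}\,\log^{\delta}(n)$. Then, with probability tending to one, $$\int_{\Theta} d^2(P_\theta,P_0)\,\widehat q(\theta)\,d\theta\;\le\; C\varepsilon_n^{*2}+C'(r_n^*+\xi_n^* ),$$ where $C$ is some positive constant and $C'$ is any diverging sequence.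
   Context: **Data.** $D=(D_1,\dots,D_n)$, $D_i=(X_i,Y_i)$ i.i.d. with $Y_i=f_0(X_i)+\epsilon_i$, $X_i\sim\mathcal U([-1,1]^p)$, $\epsilon_i\sim\mathcal N(0,\sigma_\epsilon^2)$ i.i.d. and independent of the $X_i$, $\sigma_\epsilon>0$ known, $f_0:[-1,1]^p\to\mathbb R$ the true function. $P_0$ (density $p_0$) is the true law of the data. Probability statements are under $P_0$. All statements are asymptotic as $n\to\infty$; the quantities $p,L,N,T$ may depend on $n$. **Network model.** An $L$-hidden-layer network with widths $\boldsymbol p=(p_1,\dots,p_L)$ (with $p_0=p$, $p_{L+1}=1$), weights $W_i\in\mathbb R^{p_i\times p_{i-1}}$, biases $b_i\in\mathbb R^{p_i}$, $i=1,\dots,L+1$, and activation $\sigma:\mathbb R\to\mathbb R$. For $b\in\mathbb R^r$, $\sigma_b:\mathbb R^r\to\mathbb R^r$ acts coordinatewise by $y_j\mapsto\sigma(y_j-b_j)$. With $\theta=\{W_1,b_1,\dots,W_{L+1},b_{L+1}\}$, $$f_\theta(X)=W_{L+1}\sigma_{b_L}(W_L\sigma_{b_{L-1}}\cdots\sigma_{b_1}(W_1X))+b_{L+1}.$$ $\theta$ is identified with a vector in $\Theta=\mathbb R^T$, $T=\sum_{l=1}^{L-1}p_{l+1}(p_l+1)+p_1(p+1)+(p_L+1)$. $P_\theta$ (density $p_\theta$) is the law of the data when $f_0$ is replaced by $f_\theta$. **Prior and variational family.** Prior $\pi(\theta)=\pi(\theta|\lambda)$: independently for $i=1,\dots,T$,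 $\gamma_i\sim\mathrm{Bern}(\lambda)$ and $\theta_i|\gamma_i\sim\gamma_i\mathcal N(0,\sigma_0^2)+(1-\gamma_i)\delta_0$ ($\delta_0$ = Dirac mass at $0$). Variational family $\mathcal Q$: all laws under which, independently over $i$, $\gamma_i\sim\mathrm{Bern}(\phi_i)$ and $\theta_i|\gamma_i\sim\gamma_i\mathcal N(\mu_i,\sigma_i^2)+(1-\gamma_i)\delta_0$, with $\mu_i\in\mathbb R$, $\sigma_i>0$, $0\le\phi_i\le1$. $\pi(\theta|D)\propto\pi(\theta)p_\theta(D)$ is the posterior and $\widehat q=\operatorname{argmin}_{q\in\mathcal Q}\mathrm{KL}(q(\theta)\|\pi(\theta|D))$ is the variational posterior. Expressions $\int(\cdot)\,q(\theta)\,d\theta$ denote integration against the law $q$. **Distance.** $d^2(P_\theta,P_0)=\mathbb E_X\bigl(1-\exp\{-[f_\theta(X)-f_0(X)]^2/(8\sigma_\epsilon^2)\}\bigr)$ with $X\sim\mathcal U([-1,1]^p)$. **Rates.** $\Theta(L,\boldsymbol p,s)=\{\theta:\|\theta\|_0\le s\}$. Fix a constant $B>0$. For a sparsity level $s\in\{1,\dots,T\}$, $$r_n(L,N,s)=\frac{(L+1)s}{n}\log N+\frac sn\log\bigl(p\sqrt{n/s}\bigr),\qquad \xi_n(L,N,s)=\inf_{\theta\in\Theta(L,\boldsymbol p,s),\,\|\theta\|_\infty\le B}\|f_\theta-f_0\|_\infty^2,$$ $s^*=\operatorname{argmin}_s\{r_n(L,N,s)+\xi_n(L,N,s)\}$,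 $r_n^*=r_n(L,N,s^* )$, $\xi_n^*=\xi_n(L,N,s^* )$. Function norms $\|\cdot\|_\infty$ are suprema over $[-1,1]^p$. $a_n\asymp b_n$ means the ratio is bounded above and below by positive constants; a ''diverging sequence'' is a positive sequence tending to $\infty$.
   Formalization: The formal theorem assumes in addition that the depth L stays bounded along those n with width N = 1; without this the claim fails (e.g. p = N = 1, identity activation, L about n/2, f_0(x) = x + |x|/√n). *)

(* Defs.v *)
From HB Require Import structures.
From mathcomp Require Import all_boot all_order all_algebra.
From mathcomp Require Import all_classical all_reals all_analysis.
From mathcomp Require Import measurable_realfun.

Set Implicit Arguments.
Unset Strict Implicit.
Unset Printing Implicit Defensive.

Import Order.TTheory GRing.Theory Num.Theory.
Import numFieldNormedType.Exports.
Local Open Scope classical_set_scope.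
Local Open Scope ring_scope.

Section product_probability.
Context d (T : measurableType d) (R : realType).

Definition tuple_cons n (z : T * n.-tuple T) : n.+1.-tuple T :=
  [tuple of z.1 :: z.2].

Lemma measurable_tuple_cons n : measurable_fun setT (@tuple_cons n).
Proof. by apply: measurable_cons. Qed.

HB.instance Definition _ n :=
  isMeasurableFun.Build _ _ _ _ (@tuple_cons n) (@measurable_tuple_cons n).

(* The law of a vector with independent coordinates of laws [mu 0, ..., mu n-1],
   on the product sigma-algebra of [n.-tuple T]. *)
Fixpoint product_law n : ('I_n -> probability T R) ->
    probability (n.-tuple T) R :=
  if n is m.+1 then fun mu =>
    distribution (mu ord0 \x product_law (fun i => mu (lift ord0 i)))%E
                 (@tuple_cons m)
  else fun=> \d_[tuple].

Lemma product_lawE n (mu : 'I_n -> probability T R) (A : 'I_n -> set T) :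
  (forall i, measurable (A i)) ->
  product_law mu [set t | forall i, A i (tnth t i)] =
  (\prod_(i < n) mu i (A i))%E.
Proof.
elim: n mu A => [|n IHn] mu A mA.
  by rewrite big_ord0 /= diracE mem_set// => -[].
rewrite big_ord_recl -(IHn _ (fun i => A (lift ord0 i)))// -product_measure1E//.
  rewrite /= /distribution /pushforward; congr (_ _).
  apply/seteqP; split=> [[x t] /= xtA|[x t] /= [xA tA] i].
    split=> [|i]; first by have := xtA ord0; rewrite tnth0.
    by have := xtA (lift ord0 i); rewrite tnthS.
  have [j ->|->] := unliftP ord0 i; last by rewrite tnth0.
  by rewrite tnthS.
rewrite (_ : mkset _ = \bigcap_(i in [set: 'I_n]) ((@tnth n T)^~ i @^-1` A (lift ord0 i))).
  apply: fin_bigcap_measurable => // i _.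
  by rewrite -[X in measurable X]setTI; apply: measurable_tnth.
by apply/seteqP; split=> [t tA i _|t tA i]; [exact: tA | exact: (tA i)].
Qed.

End product_probability.

Section density.
Context d (T : measurableType d) (R : realType).
Variables (mu : {measure set T -> \bar R}) (g : T -> R).
Hypotheses (mg : measurable_fun setT g) (g0 : forall x, 0 <= g x).

Definition with_density of measurable_fun setT g & (forall x, 0 <= g x) :=
  fun A : set T => (\int[mu]_(x in A) (g x)%:E)%E.

Local Notation nu := (with_density mg g0).

Let nu0 : nu set0 = 0%E.
Proof. by rewrite /with_density integral_set0. Qed.

Let nu_ge0 A : (0 <= nu A)%E.
Proof. by apply: integral_ge0 => x _; rewrite lee_fin. Qed.

Let nu_sigma_additive : semi_sigma_additive nu.
Proof.
move=> F mF tF mUF; rewrite /with_density; apply: cvg_toP.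
  apply: ereal_nondecreasing_is_cvgn => m n mn.
  apply: lee_sum_nneg_natr => // k _ _.
  by apply: integral_ge0 => x _; rewrite lee_fin.
rewrite ge0_integral_bigcup//=.
  by apply/measurable_EFinP; exact: measurable_funTS.
by move=> x _; rewrite lee_fin.
Qed.

HB.instance Definition _ :=
  isMeasure.Build _ _ _ nu nu0 nu_ge0 nu_sigma_additive.

End density.

(* The library puts its distributions on [measurableTypeR R], while the
   sigma-algebra inferred for [R] has the same measurable sets but another
   display; this changes the display and nothing else. *)
Section real_law.
Context (R : realType) (mu : probability (measurableTypeR R) R).

Definition real_law : set R -> \bar R := mu.

Let real_law0 : real_law set0 = 0%E. Proof. exact: (measure0 mu). Qed.

Let real_law_ge0 A : (0 <= real_law A)%E. Proof. exact: (measure_ge0 mu). Qed.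

Let real_law_sigma_additive : semi_sigma_additive real_law.
Proof. exact: (@measure_semi_sigma_additive _ _ _ mu). Qed.

HB.instance Definition _ := isMeasure.Build _ _ _ real_law
  real_law0 real_law_ge0 real_law_sigma_additive.

Let real_law_setT : real_law setT = 1%E. Proof. exact: (probability_setT mu). Qed.

HB.instance Definition _ :=
  Measure_isProbability.Build _ _ _ real_law real_law_setT.

End real_law.

Section spike_and_slab.
Context (R : realType).
Variables (p m s : R).

Definition spike_or_slab (b : bool) : probability (measurableTypeR R) R :=
  if b then normal_prob m s : probability _ _
  else \d_(0 : measurableTypeR R) : probability _ _.

(* The marginal law of [theta] when [gamma ~ Bern(p)] and, given [gamma],
   [theta ~ N(m, s^2)] if [gamma] holds and [theta = 0] otherwise. *)
Definition spike_slab : set (measurableTypeR R) -> \bar R :=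
  fun A => (\int[bernoulli_prob p]_b spike_or_slab b A)%E.

Let spike_slab0 : spike_slab set0 = 0%E.
Proof. by rewrite /spike_slab; under eq_integral do rewrite measure0; rewrite integral0. Qed.

Let spike_slab_ge0 A : (0 <= spike_slab A)%E.
Proof. exact: integral_ge0. Qed.

Let spike_slab_sigma_additive : semi_sigma_additive spike_slab.
Proof.
move=> F mF tF mUF; rewrite /spike_slab.
have -> : (\int[bernoulli_prob p]_b spike_or_slab b (\bigcup_n F n) =
    \int[bernoulli_prob p]_b (\sum_(0 <= k <oo) spike_or_slab b (F k)))%E.
  by apply: eq_integral => b _; rewrite measure_bigcup//; apply: eq_eseriesl => k; rewrite in_setT.
rewrite integral_nneseries//.
by apply: is_cvg_ereal_nneg_natsum => k _; exact: integral_ge0.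
Qed.

HB.instance Definition _ := isMeasure.Build _ _ _ spike_slab
  spike_slab0 spike_slab_ge0 spike_slab_sigma_additive.

Let spike_slab_setT : spike_slab setT = 1%E.
Proof.
transitivity (\int[bernoulli_prob p]_b (1 : \bar R))%E.
  by apply: eq_integral => b _; exact: probability_setT.
rewrite integral_cst// mul1e; exact: (@probability_setT _ _ _ (bernoulli_prob p)).
Qed.

HB.instance Definition _ :=
  Measure_isProbability.Build _ _ _ spike_slab spike_slab_setT.

End spike_and_slab.

(* Kullback-Leibler divergence, [q] being the first argument: the integral
   of [ln (dq/dnu)] against [q]. *)
Section kullback_leibler.
Context d (T : measurableType d) (R : realType).
Variables q nu : probability T R.

Definition KL : \bar R :=
  if pselect (q `<< nu) then
    (\int[q]_x lne (Radon_Nikodym (charge_of_finite_measure q) nu x))%E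
  else +oo%E.

End kullback_leibler.

Section network.
Context {R : realType}.
Variables (sigma : R -> R) (w : nat -> nat) (L : nat).

(* [w 0] is the input dimension and [w 1, ..., w L] are the hidden widths; the
   output has dimension 1. The parameter vector lists, layer after layer and
   neuron after neuron, the incoming weights of a neuron followed by its bias.
   Layers are counted from 0, so that [weight theta l] and [bias theta l] are
   the usual $W_{l+1}$ and $b_{l+1}$. *)
Definition layer_offset (l : nat) : nat := (\sum_(k < l) w k.+1 * (w k).+1)%N.

Definition nparams : nat := (layer_offset L + (w L).+1)%N.

Implicit Types theta : nparams.-tuple R.

Definition weight theta l : 'M[R]_(w l.+1, w l) :=
  \matrix_(i, j) nth 0 theta (layer_offset l + i * (w l).+1 + j)%N.

Definition bias theta l : 'cV[R]_(w l.+1) :=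
  \col_i nth 0 theta (layer_offset l + i * (w l).+1 + w l)%N.

Definition out_weight theta : 'rV[R]_(w L) :=
  \row_j nth 0 theta (layer_offset L + j)%N.

Definition out_bias theta : R := nth 0 theta (layer_offset L + w L)%N.

Fixpoint hidden theta (x : (w 0).-tuple R) l : 'cV[R]_(w l) :=
  if l is k.+1 then
    map_mx sigma (weight theta k *m hidden theta x k - bias theta k)
  else \col_i tnth x i.

Definition net theta (x : (w 0).-tuple R) : R :=
  (out_weight theta *m hidden theta x L) 0 0 + out_bias theta.

Lemma measurable_param k :
  measurable_fun setT (fun theta : nparams.-tuple R => nth 0 theta k).
Proof.
have [kT|kT] := ltnP k nparams.
  rewrite (_ : (fun _ => _) = (@tnth _ R)^~ (Ordinal kT)).
    exact: measurable_tnth.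
  by apply/funext => theta; rewrite (tnth_nth 0).
rewrite (_ : (fun _ => _) = cst 0); first exact: measurable_cst.
by apply/funext => theta; rewrite nth_default// size_tuple.
Qed.

Lemma measurable_hidden x l i : measurable_fun setT sigma ->
  measurable_fun setT (fun theta : nparams.-tuple R => hidden theta x l i 0).
Proof.
move=> msigma; elim: l i => [|l IHl] i.
  rewrite (_ : (fun _ => _) = cst (tnth x i)); first exact: measurable_cst.
  by apply/funext => theta; rewrite /= mxE.
rewrite (_ : (fun _ => _) = sigma \o (fun theta : nparams.-tuple R =>
    \sum_(j < w l) nth 0 theta (layer_offset l + i * (w l).+1 + j)%N * hidden theta x l j 0
    - nth 0 theta (layer_offset l + i * (w l).+1 + w l)%N)); last first.
  apply/funext => theta /=; rewrite !mxE; congr (sigma (_ - _)).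
  by apply: eq_bigr => j _; rewrite !mxE.
apply: measurableT_comp => //; apply: measurable_funB; last exact: measurable_param.
by apply: measurable_sum => j; apply: measurable_funM => //; exact: measurable_param.
Qed.

Lemma measurable_net x : measurable_fun setT sigma ->
  measurable_fun setT (net^~ x).
Proof.
move=> msigma.
rewrite (_ : net^~ x = fun theta : nparams.-tuple R =>
    \sum_(j < w L) nth 0 theta (layer_offset L + j)%N * hidden theta x L j 0
    + nth 0 theta (layer_offset L + w L)%N); last first.
  apply/funext => theta /=; rewrite /net !mxE; congr (_ + _).
  by apply: eq_bigr => j _; rewrite !mxE.
apply: measurable_funD; last exact: measurable_param.
apply: measurable_sum => j; apply: measurable_funM; first exact: measurable_param.
exact: measurable_hidden.
Qed.

End network.

Definition const_widths (p N : nat) : nat -> nat :=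
  fun l => if l is 0 then p else N.

Definition norm0 (R : realType) n (theta : n.-tuple R) : nat :=
  count (fun a => a != 0) theta.

Lemma lipschitz_measurable (R : realType) (f : R -> R) :
  1.-lipschitz f -> measurable_fun setT f.
Proof.
move=> lf; apply: continuous_measurable_fun => x.
apply/cvgrPdist_le => e e0; near=> y.
have /= := lf (x, y) (conj Logic.I Logic.I); rewrite mul1r => /le_trans; apply.
near: y; exact: cvgr_dist_le.
Unshelve. all: by end_near. Qed.

Section posterior.
Context {R : realType}.
Variables (sigma : R -> R) (w : nat -> nat) (L : nat) (s_eps : R).
Variables (n : nat) (x : 'I_n -> (w 0).-tuple R) (y : 'I_n -> R).

(* The density of the data under $P_\theta$ with respect to the product of the
   law of the design and of the Lebesgue measure; since the law of the design
   does not depend on $\theta$, this choice of reference measure is immaterial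
   in the posterior. *)
Definition likelihood (theta : (nparams w L).-tuple R) : R :=
  \prod_(i < n) normal_pdf (net sigma theta (x i)) s_eps (y i).

Lemma likelihood_ge0 theta : 0 <= likelihood theta.
Proof. by apply: prodr_ge0 => i _; exact: normal_pdf_ge0. Qed.

Lemma measurable_likelihood : 1.-lipschitz sigma ->
  measurable_fun setT likelihood.
Proof.
move=> /lipschitz_measurable msigma; apply: measurable_prod => i _.
rewrite /normal_pdf; case: eqVneq => _; first exact: measurable_cst.
apply: measurable_funM => //; rewrite /normal_fun.
apply: measurableT_comp => //; apply: measurable_funM => //.
apply: measurableT_comp => //; apply: measurable_funX.
by apply: measurable_funB => //; exact: measurable_net.
Qed.

(* The evidence is positive and finite when [s_eps != 0], so that the default
   law given to [mnormalize] plays no role. *)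
Definition posterior (lip : 1.-lipschitz sigma)
    (prior : probability ((nparams w L).-tuple R) R) :
    probability ((nparams w L).-tuple R) R :=
  mnormalize
    (with_density prior (measurable_likelihood lip) likelihood_ge0) prior.

End posterior.

Section variational.
Context {R : realType} (T : nat).

Definition spike_slab_prior (lambda s0 : R) : probability (T.-tuple R) R :=
  product_law (fun=> real_law (spike_slab lambda 0 s0)).

Definition variational_family : set (probability (T.-tuple R) R) :=
  [set q | exists (phi mu s : 'I_T -> R),
    [/\ forall i, 0 <= phi i <= 1, forall i, 0 < s i &
      q = product_law (fun i => real_law (spike_slab (phi i) (mu i) (s i)))]].

Definition is_variational_posterior (post q : probability (T.-tuple R) R) :=
  variational_family q /\
  forall q', variational_family q' -> (KL q post <= KL q' post)%E.

End variational.

Section regression.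
Context {R : realType} (p : nat).

Definition cube : set (p.-tuple R) := [set x | forall i, -1 <= tnth x i <= 1].

Lemma ltN11 : (-1 : R) < 1. Proof. exact: lt_trans (ltrN10 R) ltr01. Qed.

Definition cube_uniform : probability (p.-tuple R) R :=
  product_law (fun=> real_law (uniform_prob ltN11)).

Definition sup_norm (g : p.-tuple R -> R) : \bar R :=
  ereal_sup [set `|g x|%:E | x in cube].

Definition d2 (s_eps : R) (f f0 : p.-tuple R -> R) : \bar R :=
  (\int[cube_uniform]_(x in cube)
    (1 - expR (- (f x - f0 x) ^+ 2 / (8 * s_eps ^+ 2)))%:E)%E.

End regression.
Arguments cube {R} p.
Arguments cube_uniform {R} p.

Section sampling.
Context d (Omega : measurableType d) (R : realType) (P : probability Omega R).
Variables (n p : nat) (s_eps : R).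
Variables (X : 'I_n -> {RV P >-> p.-tuple R}) (eps : 'I_n -> {RV P >-> R}).

Definition mutually_independent :=
  forall (A : 'I_n -> set (p.-tuple R)) (B : 'I_n -> set R),
    (forall i, measurable (A i)) -> (forall i, measurable (B i)) ->
    P [set om | forall i, A i (X i om) /\ B i (eps i om)] =
    ((\prod_(i < n) P (X i @^-1` A i)) * \prod_(i < n) P (eps i @^-1` B i))%E.

Definition sampling_model :=
  [/\ forall i (A : set (p.-tuple R)), measurable A ->
        distribution P (X i) A = cube_uniform p A,
      forall i (B : set R), measurable B ->
        distribution P (eps i) B = normal_prob 0 s_eps B
    & mutually_independent].

End sampling.

Section rates.
Context {R : realType}.

Definition rate (n p L N s : nat) : R :=
  L.+1%:R * s%:R / n%:R * ln N%:R
  + s%:R / n%:R * ln (p%:R * Num.sqrt (n%:R / s%:R)).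

Definition approx_error (sigma : R -> R) (w : nat -> nat) (L : nat) (B : R)
    (f0 : (w 0).-tuple R -> R) (s : nat) : \bar R :=
  ereal_inf [set ((sup_norm (fun x => net sigma theta x - f0 x)%R) ^+ 2)%E
            | theta in [set theta : (nparams w L).-tuple R |
                (norm0 theta <= s)%N /\ forall i, `|tnth theta i| <= B]].

Definition is_optimal_sparsity (T : nat) (r : nat -> R) (xi : nat -> \bar R)
    (s : nat) :=
  (1 <= s <= T)%N /\
  forall s', (1 <= s' <= T)%N -> ((r s)%:E + xi s <= (r s')%:E + xi s')%E.

(* As [x / 0 = 0], the lower bound forces [b n] to be nonzero eventually. *)
Definition asymp (a b : nat -> R) :=
  exists c C : R, 0 < c /\ \forall n \near \oo, c <= a n / b n <= C.

Definition diverging (a : nat -> R) :=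
  (forall n, 0 < a n) /\ a n @[n --> \oo] --> +oo.

End rates.

(* The inner probability of [E n] tends to one; this is the usual notion when
   the [E n] are measurable. *)
Definition with_probability_tending_to_one (R : realType)
    (d : nat -> measure_display) (Omega : forall n, measurableType (d n))
    (P : forall n, probability (Omega n) R) (E : forall n, set (Omega n)) :=
  exists A : forall n, set (Omega n),
    (forall n, measurable (A n) /\ A n `<=` E n) /\
    P n (A n) @[n --> \oo] --> (1%:E : \bar R).

(* Main.v *)
(* Write W(theta) for the likelihood ratio of P_theta to P_0. Since the
   variational posterior minimises KL(. | posterior) over the family, comparing
   it with one member q' whose prior density is at most exp(c + G) W, and then
   applying the Donsker-Varadhan inequality, gives for every h >= 0
       int h dqhat <= c + int G dq' + ln int exp(h) W dprior.
   The comparison law q' has the support of a near-optimal sparse theta_star, is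
   centred at theta_star, and has a standard deviation of order 1/(n T) times the
   inverse of the Lipschitz constant of the network at theta_star; its cost c is of
   order n r_star.

   The bound is used twice. With h = kappa H |theta|_0 + |theta|^2 / (4 s0^2),
   H = (L + 1) log N + log(sqrt(n) p), whose prior exponential moment is bounded by
   the choice of lambda, it bounds the mean of |theta|_0 under qhat by O(s_star)
   and that of |theta|^2 by O(n r_star); as |theta|_0 is under qhat a sum of independent Bernoulli variables, qhat
   charges the complement of the sieve {|theta|_0 <= s_star log n, |theta|_2 <= n}
   by only O(r_star). With h = 2 n d^2 on the sieve and 0 elsewhere, the last term is
   controlled by a finite net of the sieve: under P_0 the expectation of
   sqrt(W) exp(n d^2) is at most 1 at each point of the net, d^2 being one minus
   the Hellinger affinity. This yields int d^2 dqhat = O(r_star log(n)^2). *)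
From HB Require Import structures.
Require Import Defs.
From mathcomp Require Import all_boot all_order all_algebra.
From mathcomp Require Import all_classical all_reals all_analysis.
From mathcomp Require Import measurable_realfun ring lra zify.

Set Implicit Arguments.
Unset Strict Implicit.
Unset Printing Implicit Defensive.

Import Order.TTheory GRing.Theory Num.Theory.
Import numFieldNormedType.Exports.
Local Open Scope classical_set_scope.
Local Open Scope ring_scope.

(** * Densities and relative entropy *)

(** Apart from its membership in the family, [qhat] is known only through a minimality property, so
    every estimate is an integral against [qhat] of a function chosen by hand. Two obstacles shape
    the argument. The comparison law is Gaussian around theta_star, hence unbounded, while the
    Lipschitz constant of a network grows like the power L + 1 of the size of its parameters; the
    comparison is therefore made pointwise on densities, with a slack G that is exponential in the
    rescaled deviations and has bounded mean. And a mean of |theta|_0 of order s_star gives, by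
    Markov's inequality, a mass of order 1/log n to {|theta|_0 > s_star log n}; independence gives a
    Chernoff bound instead, and a mass O(1/n), at most of order r_star. The logarithms of n lost to
    exceptional events are harmless because log n <= 2 H and s_star H is of order n r_star. This
    equivalence is not automatic, since the rate contains log(p sqrt(n/s)) and H contains
    log(sqrt(n) p): it rests on the smallness of s_star / n, and N = 1 needs separate care, because
    log N = 0 then hides the depth. *)

Section densities.
Context d (T : measurableType d) (R : realType).
Local Open Scope ereal_scope.

Lemma density_dominates (nu : {finite_measure set T -> \bar R})
    (mu : {sigma_finite_measure set T -> \bar R}) (g : T -> R) :
  measurable_fun setT g ->
  (forall A, measurable A -> nu A = \int[mu]_(x in A) (g x)%:E) -> nu `<< mu.
Proof.
move=> mg nuE; apply/null_content_dominatesP => A mA muA0.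
rewrite nuE//; apply: null_set_integral => //.
by apply/measurable_EFinP; exact: measurable_funTS.
Qed.

Lemma density_ae_eq (nu : {finite_measure set T -> \bar R})
    (mu : {sigma_finite_measure set T -> \bar R}) (g : T -> R) :
  measurable_fun setT g ->
  (forall A, measurable A -> nu A = \int[mu]_(x in A) (g x)%:E) ->
  ae_eq mu setT (Radon_Nikodym_SigmaFinite.f nu mu) (EFin \o g).
Proof.
move=> mg nuE; have numu := density_dominates mg nuE.
apply: integral_ae_eq => //; first exact: Radon_Nikodym_SigmaFinite.f_integrable.
  exact/measurable_EFinP.
by move=> A _ mA; rewrite -Radon_Nikodym_SigmaFinite.f_integral// nuE.
Qed.

Lemma ge0_integral_density (nu : {finite_measure set T -> \bar R})
    (mu : {sigma_finite_measure set T -> \bar R}) (g : T -> R)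
    (D : set T) (f : T -> \bar R) :
  measurable_fun setT g ->
  (forall A, measurable A -> nu A = \int[mu]_(x in A) (g x)%:E) ->
  measurable D -> measurable_fun D f -> (forall x, 0 <= f x) ->
  \int[nu]_(x in D) f x = \int[mu]_(x in D) (f x * (g x)%:E).
Proof.
move=> mg nuE mD mf f0; have numu := density_dominates mg nuE.
rewrite -(Radon_Nikodym_SigmaFinite.change_of_variables numu)//.
apply: ae_eq_integral => //.
- apply: emeasurable_funM => //; apply: measurable_funTS.
  exact: measurable_int (Radon_Nikodym_SigmaFinite.f_integrable _).
- apply: emeasurable_funM => //; apply/measurable_EFinP.
  exact: measurable_funTS.
- apply: ae_eqe_mul2l; apply: (ae_eq_subset (subsetT D)).
  exact: density_ae_eq.
Qed.

Lemma measurable_lne_EFin (g : T -> R) : measurable_fun setT g ->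
  measurable_fun setT (fun x => lne (g x)%:E).
Proof.
move=> mg; apply: measurable_fun_ifT => //.
  exact: measurable_fun_ler.
by apply/measurable_EFinP; exact: measurableT_comp.
Qed.

Variables q nu : probability T R.

(** Densities with respect to [nu] agree almost everywhere for [nu], hence also for [q], which is
    dominated by [nu]; so any real version may replace the derivative chosen in [KL]. *)
Lemma KL_density (g : T -> R) : measurable_fun setT g ->
  (forall A, measurable A -> q A = \int[nu]_(x in A) (g x)%:E) ->
  KL q nu = \int[q]_x lne (g x)%:E.
Proof.
move=> mg qE; have qnu := density_dominates mg qE.
rewrite /KL; case: pselect => // ?; apply: ae_eq_integral => //.
- set f := Radon_Nikodym _ _.
  have mf : measurable_fun setT f.
    by apply: (@measurable_int _ _ _ nu); exact: Radon_Nikodym_integrable.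
  have -> : (fun x => lne (f x)) = fun x => lne (fine (f x))%:E.
    apply/funext => x; rewrite fineK//.
    exact: Radon_Nikodym_fin_num.
  by apply: measurable_lne_EFin; exact: measurableT_comp.
- exact: measurable_lne_EFin.
- apply: (null_dominates_ae_eq measurableT qnu).
  apply: (ae_eq_comp (@lne R)).
  apply: (@ae_eq_trans _ _ _ _ _ _ _ (Radon_Nikodym_SigmaFinite.f q nu)).
    by apply: ae_eq_sym; exact: ae_eq_Radon_Nikodym_SigmaFinite.
  exact: density_ae_eq.
Qed.

Lemma dominates_density : q `<< nu -> exists g : T -> R,
  [/\ measurable_fun setT g, forall x, (0 <= g x)%R &
      forall A, measurable A -> q A = \int[nu]_(x in A) (g x)%:E].
Proof.
move=> qnu; pose f := Radon_Nikodym_SigmaFinite.f q nu.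
have ffin x : f x \is a fin_num by exact: Radon_Nikodym_SigmaFinite.f_fin_num.
have mf : measurable_fun setT f.
  exact: measurable_int (Radon_Nikodym_SigmaFinite.f_integrable _).
exists (fine \o f); split.
- exact: measurableT_comp.
- by move=> x /=; apply: fine_ge0; exact: Radon_Nikodym_SigmaFinite.f_ge0.
- move=> A mA; rewrite (Radon_Nikodym_SigmaFinite.f_integral qnu)//.
  by apply: eq_integral => x _ /=; rewrite fineK.
Qed.

End densities.

Lemma ln_le_subr1 (R : realType) (x : R) : 0 < x -> ln x <= x - 1.
Proof. by move=> x0; have := expR_ge1Dx (ln x); rewrite lnK//; lra. Qed.

Section kullback_leibler_bounds.
Context d (T : measurableType d) (R : realType).
Local Open Scope ereal_scope.
Variables q nu : probability T R.

(** The logarithm of [g] may fail to be integrable, so monotonicity is applied to positive and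
    negative parts separately; an infinite mean of [G] makes the bound trivial. *)
Lemma KL_density_le (g : T -> R) (c : R) (G : T -> R) :
  measurable_fun setT g -> measurable_fun setT G ->
  (forall x, 0 <= G x)%R -> (forall x, g x <= expR (c + G x))%R ->
  (forall A, measurable A -> q A = \int[nu]_(x in A) (g x)%:E) ->
  KL q nu <= c%:E + \int[q]_x (G x)%:E.
Proof.
move=> mg mG G0 gG qE; rewrite (KL_density mg qE).
have [->|Goo] := eqVneq (\int[q]_x (G x)%:E) +oo; first by rewrite addeC leey.
have iG : q.-integrable setT (fun x => (G x)%:E).
  apply/integrableP; split; first exact/measurable_EFinP.
  under eq_integral do rewrite gee0_abs ?lee_fin//.
  by rewrite ltey.
have ic : q.-integrable setT (fun=> c%:E).
  exact: (finite_measure_integrable_cst q c measurableT).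
have le_g x : lne (g x)%:E <= c%:E + (G x)%:E.
  rewrite -EFinD; have [g0|g0] := leP (g x) 0%R; first by rewrite le0_lneNy// leNye.
  by rewrite lne_EFin// lee_fin -ler_expR lnK.
have mh : measurable_fun setT (fun x => c%:E + (G x)%:E).
  by apply: emeasurable_funD => //; exact/measurable_EFinP.
have -> : c%:E + \int[q]_x (G x)%:E = \int[q]_x (c%:E + (G x)%:E).
  rewrite integralD// integral_cst// [X in c%:E * X](_ : _ = 1) ?mule1//.
  exact: (@probability_setT _ _ _ q).
have ml : measurable_fun setT (fun x => lne (g x)%:E) by exact: measurable_lne_EFin.
rewrite integralE [leRHS]integralE; apply: leeB; apply: ge0_le_integral => //.
- exact: measurable_funepos.
- exact: measurable_funepos.
- by move=> x _; rewrite !funeposE ge_max !le_max lexx orbT andbT le_g.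
- exact: measurable_funeneg.
- exact: measurable_funeneg.
- move=> x _; rewrite !funenegE.
  by rewrite ge_max !le_max lexx orbT andbT leeN2 le_g.
Qed.

(** [lne] is -oo at 0 where [ln] is 0; the two differ only on the set where [g] vanishes, which [q]
    does not charge. *)
Lemma KL_ln_density (g : T -> R) : measurable_fun setT g ->
  (forall x, 0 <= g x)%R ->
  (forall A, measurable A -> q A = \int[nu]_(x in A) (g x)%:E) ->
  KL q nu = \int[q]_x (ln (g x))%:E.
Proof.
move=> mg g0 qE; rewrite (KL_density mg qE); apply: ae_eq_integral => //.
- exact: measurable_lne_EFin.
- by apply/measurable_EFinP; exact: measurableT_comp.
- have mN : measurable [set x | g x = 0%R].
    by rewrite -[X in measurable X]setTI; exact: (mg measurableT _ (measurable_set1 0%R)).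
  exists [set x | g x = 0%R]; split => //.
  + apply: etrans (qE _ mN) _.
    by apply: integral0_eq => x /= gx; rewrite gx.
  + move=> x H; apply: contrapT => gx; apply: H => _.
    by rewrite lne_EFin// lt_def g0 andbT; exact/eqP.
Qed.

(** The pointwise inequality ln u <= u - 1 at u = exp(h) / (M g), multiplied by [g] and integrated
    against [nu]. To stay with nonnegative integrands, ln g is split into [vp - vn] and each term is
    moved to the side where it is nonnegative. *)
Lemma donsker_varadhan (h : T -> R) (M : R) :
  measurable_fun setT h -> (forall x, 0 <= h x)%R ->
  \int[nu]_x (expR (h x))%:E <= M%:E ->
  \int[q]_x (h x)%:E <= KL q nu + (ln M)%:E.
Proof.
move=> mh h0 hM.
have [qnu|Nqnu] := pselect (q `<< nu); last first.
  by rewrite /KL; case: pselect => // ?; rewrite addye// leey.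
have [g [mg g0 qE]] := dominates_density qnu.
have M1 : (1 <= M)%R.
  rewrite -lee_fin (le_trans _ hM)// -[leLHS](@probability_setT _ _ _ nu).
  rewrite -[leLHS]mul1e -integral_cst//; apply: ge0_le_integral => //.
  - by apply/measurable_EFinP; exact: measurableT_comp.
  - by move=> x _; rewrite lee_fin -expR0 ler_expR.
have M0 : (0 < M)%R by exact: lt_le_trans M1.
pose v x := ln (g x); pose vp x := Order.max (v x) 0%R.
pose vn x := Order.max (- v x)%R 0%R.
have mv : measurable_fun setT v by exact: measurableT_comp.
have mvp : measurable_fun setT vp by exact: measurable_maxr.
have mvn : measurable_fun setT vn.
  by apply: measurable_maxr => //; exact: measurableT_comp.
have vp0 x : (0 <= vp x)%R by rewrite le_max lexx orbT.
have vn0 x : (0 <= vn x)%R by rewrite le_max lexx orbT.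
have iE (F : T -> R) : measurable_fun setT F -> (forall x, 0 <= F x)%R ->
    \int[q]_x (F x)%:E = \int[nu]_x (F x * g x)%:E.
  move=> mF F0; rewrite (ge0_integral_density mg qE measurableT)//.
  exact/measurable_EFinP.
have nuT : nu setT = 1 by exact: probability_setT.
have qT : q setT = 1 by exact: probability_setT.
(* This bound rests on - g ln g <= 1 - g <= 1; it makes the integral of [vn] finite, so that it can
   be subtracted at the end. *)
have vn_le1 : \int[q]_x (vn x)%:E <= 1.
  rewrite iE// -nuT -[leRHS]mul1e -integral_cst//; apply: ge0_le_integral => //.
  - by move=> x _; rewrite lee_fin mulr_ge0.
  - by apply/measurable_EFinP; exact: measurable_funM.
  - move=> x _; rewrite lee_fin /vn /v.
    have [->|gx] := eqVneq (g x) 0%R; first by rewrite mulr0.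
    have gp : (0 < g x)%R by rewrite lt_def gx g0.
    have [g1|g1] := leP (- ln (g x))%R 0%R; first by rewrite mul0r.
    have : (ln (g x)^-1 <= (g x)^-1 - 1)%R.
      by apply: ln_le_subr1; rewrite invr_gt0.
    rewrite lnV// => H.
    rewrite -[leRHS](mulVf gx) ler_wpM2r//; apply: le_trans H _.
    by rewrite gerBl.
have main : \int[q]_x (h x)%:E + 1 + \int[q]_x (vn x)%:E <=
            \int[q]_x (vp x)%:E + (ln M)%:E + 1.
  have -> : \int[q]_x (h x)%:E + 1 + \int[q]_x (vn x)%:E =
            \int[nu]_x ((h x + 1 + vn x) * g x)%:E.
    have i1 : (1 : \bar R) = \int[q]_x (cst 1 x).
      by rewrite integral_cst// [X in _ * X]qT mule1.
    rewrite [X in _ + X + _]i1 -ge0_integralD//=; last 2 first.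
      by move=> x _; rewrite lee_fin.
      exact/measurable_EFinP.
    rewrite -ge0_integralD//=; last 4 first.
      by move=> x _; rewrite adde_ge0// lee_fin.
      by apply: emeasurable_funD => //; exact/measurable_EFinP.
      by move=> x _; rewrite lee_fin.
      exact/measurable_EFinP.
    rewrite -iE.
    + by apply: eq_integral => x _.
    + by do 2 apply: measurable_funD => //.
    + by move=> x; rewrite !addr_ge0.
  have lnM0 : (0 <= ln M)%R by exact: ln_ge0.
  have -> : \int[q]_x (vp x)%:E + (ln M)%:E = \int[nu]_x ((vp x + ln M) * g x)%:E.
    have i1 : (ln M)%:E = \int[q]_x (cst (ln M)%:E x).
      by rewrite integral_cst// [X in _ * X]qT mule1.
    rewrite [X in _ + X]i1 -ge0_integralD//=; last 2 first.
      by move=> x _; rewrite lee_fin.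
      exact/measurable_EFinP.
    rewrite -iE.
    + by apply: eq_integral => x _.
    + exact: measurable_funD.
    + by move=> x; rewrite addr_ge0.
  have eM : \int[nu]_x (M^-1 * expR (h x))%:E <= 1.
    under eq_integral do rewrite EFinM.
    rewrite ge0_integralZl//; last 2 first.
    - by apply/measurable_EFinP; exact: measurableT_comp.
    - by rewrite lee_fin invr_ge0 ltW.
    by rewrite lee_pdivrMl// mule1.
  apply: le_trans; last exact: leeD2l eM.
  rewrite -ge0_integralD//; last 4 first.
  - by move=> x _; rewrite lee_fin mulr_ge0// addr_ge0.
  - by apply/measurable_EFinP; apply: measurable_funM => //; exact: measurable_funD.
  - by move=> x _; rewrite lee_fin mulr_ge0 ?expR_ge0 ?invr_ge0// ltW.
  - by apply/measurable_EFinP; apply: measurable_funM => //; exact: measurableT_comp.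
  apply: ge0_le_integral => //.
  - by move=> x _; rewrite lee_fin mulr_ge0// !addr_ge0.
  - apply/measurable_EFinP; apply: measurable_funM => //.
    by do 2 apply: measurable_funD => //.
  - apply: emeasurable_funD; apply/measurable_EFinP.
      by apply: measurable_funM => //; exact: measurable_funD.
    by apply: measurable_funM => //; exact: measurableT_comp.
  - move=> x _; rewrite -EFinD lee_fin.
    have [->|gx] := eqVneq (g x) 0%R.
      by rewrite !mulr0 add0r mulr_ge0 ?expR_ge0 ?invr_ge0// ltW.
    have gp : (0 < g x)%R by rewrite lt_def gx g0.
    pose u := (expR (h x) / (M * g x))%R.
    have u0 : (0 < u)%R by rewrite divr_gt0 ?expR_gt0 ?mulr_gt0.
    have : (ln u <= u - 1)%R.
      exact: ln_le_subr1.
    rewrite /u ln_div ?posrE ?expR_gt0 ?mulr_gt0// expRK lnM// => H.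
    have vE : (v x = vp x - vn x)%R.
      by rewrite /vp /vn; case: (leP (v x) 0%R); case: (leP (- v x)%R 0%R); lra.
    rewrite -/u -/(v x) vE in H.
    have -> : (M^-1 * expR (h x) = u * g x)%R.
      by rewrite /u; field; rewrite ?gt_eqF.
    rewrite -mulrDl ler_pM2r//; lra.
rewrite (KL_ln_density mg g0 qE).
have -> : \int[q]_x (ln (g x))%:E = \int[q]_x (vp x)%:E - \int[q]_x (vn x)%:E.
  rewrite integralE; congr (_ - _); apply: eq_integral => x _.
    by rewrite funeposE -EFin_max.
  by rewrite funenegE -EFin_max.
have vnfin : \int[q]_x (vn x)%:E \is a fin_num.
  rewrite ge0_fin_numE ?(le_lt_trans vn_le1) ?ltry//.
  by apply: integral_ge0 => x _; rewrite lee_fin.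
have := main; rewrite -addeA [1 + _]addeC addeA leeD2rE// -leeBrDr//.
by rewrite -addeA [X in _ <= _ + X]addeC addeA.
Qed.

End kullback_leibler_bounds.

Section variational_bound.
Context d (T : measurableType d) (R : realType).
Local Open Scope ereal_scope.
Variables (prior : probability T R) (lik : T -> R).
Hypotheses (mlik : measurable_fun setT lik) (lik_ge0 : forall x, (0 <= lik x)%R).
Hypothesis lik_gt0 : forall x, (0 < lik x)%R.
Variable K : R.
Hypothesis lik_leK : forall x, (lik x <= K)%R.

Let post : probability T R := mnormalize (with_density prior mlik lik_ge0) prior.
Let evidence := fine (\int[prior]_x (lik x)%:E).

Let priorT : prior setT = 1. Proof. exact: probability_setT. Qed.

Let evidenceE : \int[prior]_x (lik x)%:E = evidence%:E.
Proof.
rewrite fineK// ge0_fin_numE; last by apply: integral_ge0 => x _; rewrite lee_fin.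
apply: (@le_lt_trans _ _ (\int[prior]_x (cst K%:E x))).
  apply: ge0_le_integral => //; last by move=> x _; rewrite lee_fin.
    by move=> x _; rewrite lee_fin.
  exact/measurable_EFinP.
by rewrite integral_cst// [X in _ * X]priorT mule1 ltry.
Qed.

(** A zero integral would make [lik] vanish almost everywhere; as [lik] is positive everywhere, the
    whole space would be a null set. *)
Let evidence_gt0 : (0 < evidence)%R.
Proof.
rewrite -lte_fin -evidenceE lt_neqAle integral_ge0 ?andbT; last first.
  by move=> x _; rewrite lee_fin.
apply/negP => /eqP/esym E0.
have : ae_eq prior setT (EFin \o lik) (cst 0).
  apply/ae_eq_integral_abs => //; first exact/measurable_EFinP.
  rewrite -[RHS]E0; apply: eq_integral => x _ /=.
  by rewrite ger0_norm.
move=> [N [mN N0 sN]].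
have NT : N = setT.
  rewrite -subTset => x _; apply: sN => /= /(_ Logic.I) [] lx.
  by have := lik_gt0 x; rewrite lx ltxx.
have : prior setT = 0 by rewrite -NT; exact: N0.
by rewrite priorT => /eqP; rewrite onee_eq0.
Qed.

Let postE A : measurable A ->
  post A = \int[prior]_(x in A) (evidence^-1 * lik x)%:E.
Proof.
move=> mA; rewrite /post /= /mnormalize /= /with_density evidenceE.
(* [mnormalize] returns its default law when the total mass is 0 or +oo; here the mass is the real
   number [evidence], which is positive. *)
rewrite eqe gt_eqF//=.
under [RHS]eq_integral do rewrite EFinM.
rewrite ge0_integralZl//.
- by rewrite muleC.
- by apply/measurable_EFinP; exact: measurable_funTS.
- by move=> x _; rewrite lee_fin.
- by rewrite lee_fin invr_ge0 ltW.
Qed.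

Let mpd : measurable_fun setT (fun x => evidence^-1 * lik x)%R.
Proof. exact: measurable_funM. Qed.

(* [q'] has density at most [exp (c + G) lik] with respect to the prior, so that
   [KL q' post <= c + int G dq' + ln evidence]; the Donsker-Varadhan inequality
   for [h] under the posterior gives the other half, and the evidence cancels. *)
Lemma variational_posterior_bound (q' qhat : probability T R)
    (rho : T -> R) (c : R) (G h : T -> R) (M : R) :
  measurable_fun setT rho -> measurable_fun setT G -> measurable_fun setT h ->
  (forall x, 0 <= rho x)%R -> (forall x, 0 <= G x)%R -> (forall x, 0 <= h x)%R ->
  (forall A, measurable A -> q' A = \int[prior]_(x in A) (rho x)%:E) ->
  (forall x, rho x <= expR (c + G x) * lik x)%R ->
  KL qhat post <= KL q' post ->
  \int[prior]_x (expR (h x) * lik x)%:E <= M%:E ->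
  \int[qhat]_x (h x)%:E <= c%:E + \int[q']_x (G x)%:E + (ln M)%:E.
Proof.
move=> mrho mG mh rho0 G0 h0 q'E rho_le KLle hM.
pose g x := (evidence * rho x / lik x)%R.
have mg : measurable_fun setT g.
  rewrite (_ : g = fun x => evidence * rho x * expR (- ln (lik x)))%R.
    apply: measurable_funM; first exact: measurable_funM.
    by apply: measurableT_comp => //; do 2 apply: measurableT_comp => //.
  by apply/funext => x; rewrite /g expRN lnK ?posrE.
have q'post A : measurable A -> q' A = \int[post]_(x in A) (g x)%:E.
  move=> mA; rewrite (ge0_integral_density mpd postE)//; last 2 first.
    by apply/measurable_EFinP; exact: measurable_funTS.
    by move=> x; rewrite lee_fin divr_ge0// mulr_ge0// ltW.
  rewrite q'E//; apply: eq_integral => x _; rewrite -EFinM; congr (_%:E).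
  by rewrite /g; field; rewrite !gt_eqF.
have KLq' : KL q' post <= (ln evidence + c)%:E + \int[q']_x (G x)%:E.
  apply: (KL_density_le mg) => // x.
  rewrite /g -addrA expRD lnK ?posrE// -mulrA ler_pM2l//.
  by rewrite ler_pdivrMr.
have M0 : (0 < M)%R.
  rewrite -lte_fin; apply: lt_le_trans hM.
  apply: (@lt_le_trans _ _ evidence%:E); first by rewrite lte_fin.
  rewrite -evidenceE; apply: ge0_le_integral => //.
  - by move=> x _; rewrite lee_fin.
  - exact/measurable_EFinP.
  - by apply/measurable_EFinP; apply: measurable_funM => //; exact: measurableT_comp.
  - by move=> x _; rewrite lee_fin ler_peMl// -expR0 ler_expR.
have hM' : \int[post]_x (expR (h x))%:E <= (evidence^-1 * M)%:E.
  rewrite (ge0_integral_density mpd postE)//; last first.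
    by apply/measurable_EFinP; exact: measurableT_comp.
  under eq_integral do rewrite -EFinM mulrCA EFinM.
  rewrite ge0_integralZl//; first last.
  all: try by rewrite lee_fin invr_ge0 ltW.
  all: try by move=> x _; rewrite lee_fin mulr_ge0 ?expR_ge0.
  all: try by apply/measurable_EFinP; apply: measurable_funM => //; exact: measurableT_comp.
  by rewrite EFinM lee_wpmul2l// lee_fin invr_ge0 ltW.
apply: le_trans (donsker_varadhan qhat mh h0 hM') _.
apply: le_trans (leeD2r _ (le_trans KLle KLq')) _.
rewrite addeAC [leRHS]addeAC leeD2r// -!EFinD lee_fin.
rewrite lnM ?posrE ?invr_gt0// lnV ?posrE//; lra.
Qed.

End variational_bound.

(** * Product laws and spike-and-slab laws *)

Section product_law_integral.
Context d (T : measurableType d) (R : realType).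
Local Open Scope ereal_scope.

Lemma ge0_integral_product_law0 (mu : 'I_0 -> probability T R)
    (f : 0.-tuple T -> \bar R) : measurable_fun setT f ->
  \int[product_law mu]_t f t = f [tuple].
Proof. by move=> mf; rewrite /= integral_dirac// diracT mul1e. Qed.

Lemma ge0_integral_product_lawS n (mu : 'I_n.+1 -> probability T R)
    (f : n.+1.-tuple T -> \bar R) : measurable_fun setT f -> (forall t, 0 <= f t) ->
  \int[product_law mu]_t f t =
  \int[mu ord0]_x \int[product_law (fun i => mu (lift ord0 i))]_t f (tuple_cons (x, t)).
Proof.
move=> mf f0; have mc : measurable_fun setT (@tuple_cons _ T n).
  exact: measurable_tuple_cons.
rewrite /= ge0_integral_pushforward//=.
by rewrite preimage_setT fubini_tonelli1//=; exact: measurableT_comp.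
Qed.

Lemma measurable_tuple_cons2 n x : measurable_fun setT (fun t => @tuple_cons _ T n (x, t)).
Proof. exact: (@measurable_cons _ _ _ _ (fun=> x) n id). Qed.

Lemma ge0_integral_product_law_prod n (mu : 'I_n -> probability T R)
    (F : 'I_n -> T -> R) : (forall i, measurable_fun setT (F i)) ->
  (forall i x, (0 <= F i x)%R) ->
  \int[product_law mu]_t (\prod_(i < n) F i (tnth t i))%:E =
  \prod_(i < n) \int[mu i]_x (F i x)%:E.
Proof.
elim: n mu F => [|n IHn] mu F mF F0.
  rewrite big_ord0 ge0_integral_product_law0 ?big_ord0//.
  by under eq_fun do rewrite big_ord0; exact: measurable_cst.
have mP m (G : 'I_m -> T -> R) : (forall i, measurable_fun setT (G i)) ->
    measurable_fun setT (fun t : m.-tuple T => (\prod_(i < m) G i (tnth t i))%:E).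
  move=> mG; apply/measurable_EFinP; apply: measurable_prod => i _.
  by apply: measurableT_comp => //; exact: measurable_tnth.
rewrite ge0_integral_product_lawS//; last 2 first.
- exact: mP.
- by move=> t; rewrite lee_fin prodr_ge0.
rewrite big_ord_recl -(IHn _ (fun i => F (lift ord0 i)))//.
set I := \int[product_law _]_t _.
have I0 : 0 <= I by apply: integral_ge0 => t _; rewrite lee_fin prodr_ge0.
rewrite -ge0_integralZr//; last 2 first.
- exact/measurable_EFinP.
- by move=> x _; rewrite lee_fin.
apply: eq_integral => x _; rewrite /I -ge0_integralZl//; last 3 first.
- exact: (mP _ (fun i => F (lift ord0 i))).
- by move=> t _; rewrite lee_fin prodr_ge0.
- by rewrite lee_fin.
apply: eq_integral => t _; rewrite big_ord_recl EFinM tnth0; congr (_ * (_)%:E).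
by apply: eq_bigr => i _; rewrite tnthS.
Qed.

(** Stated for integrals of functions and not for measures of sets, so that the induction can peel
    off one coordinate by Tonelli's theorem and apply the hypothesis to the inner integral. *)
Lemma ge0_integral_product_law_density n (mu nu : 'I_n -> probability T R)
    (g : 'I_n -> T -> R) : (forall i, measurable_fun setT (g i)) ->
  (forall i x, (0 <= g i x)%R) ->
  (forall i A, measurable A -> nu i A = \int[mu i]_(x in A) (g i x)%:E) ->
  forall f, measurable_fun setT f -> (forall t, 0 <= f t) ->
  \int[product_law nu]_t f t =
  \int[product_law mu]_t (f t * (\prod_(i < n) g i (tnth t i))%:E).
Proof.
elim: n mu nu g => [|n IHn] mu nu g mg g0 nuE f mf f0.
  rewrite !ge0_integral_product_law0//; last by under eq_fun do rewrite big_ord0 mule1.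
  by rewrite big_ord0 mule1.
have mP m (G : 'I_m -> T -> R) : (forall i, measurable_fun setT (G i)) ->
    measurable_fun setT (fun t : m.-tuple T => (\prod_(i < m) G i (tnth t i))%:E).
  move=> mG; apply/measurable_EFinP; apply: measurable_prod => i _.
  by apply: measurableT_comp => //; exact: measurable_tnth.
rewrite ge0_integral_product_lawS// [RHS]ge0_integral_product_lawS//; last 2 first.
- by apply: emeasurable_funM => //; exact: mP.
- by move=> t; rewrite mule_ge0// lee_fin prodr_ge0.
have mc : measurable_fun setT (@tuple_cons _ T n) by exact: measurable_tuple_cons.
have mI (la : 'I_n -> probability T R) :
    measurable_fun setT (fun x => \int[product_law la]_t f (tuple_cons (x, t))).
  apply: (measurable_fun_fubini_tonelli_F (m2 := product_law la) (f \o @tuple_cons _ T n)).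
    exact: measurableT_comp.
  by move=> x; exact: f0.
rewrite (ge0_integral_density (mg ord0) (nuE ord0))//; last first.
  by move=> x; apply: integral_ge0.
apply: eq_integral => x _.
rewrite (IHn (fun i => mu (lift ord0 i)) _ (fun i => g (lift ord0 i)))//; last 2 first.
- by move=> i A mA; exact: nuE.
- by apply: measurableT_comp => //; exact: measurable_tuple_cons2.
rewrite -ge0_integralZr//; last 3 first.
- apply: emeasurable_funM; last exact: (mP _ (fun i => g (lift ord0 i))).
  by apply: measurableT_comp => //; exact: measurable_tuple_cons2.
- by move=> t _; rewrite mule_ge0// lee_fin prodr_ge0.
- by rewrite lee_fin.
apply: eq_integral => t _; rewrite big_ord_recl EFinM tnth0 -muleA; congr (_ * _).
by rewrite muleC; congr (_ * (_)%:E); apply: eq_bigr => i _; rewrite tnthS.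
Qed.

Lemma product_law_density n (mu nu : 'I_n -> probability T R)
    (g : 'I_n -> T -> R) : (forall i, measurable_fun setT (g i)) ->
  (forall i x, (0 <= g i x)%R) ->
  (forall i A, measurable A -> nu i A = \int[mu i]_(x in A) (g i x)%:E) ->
  forall A, measurable A -> product_law nu A =
    \int[product_law mu]_(t in A) (\prod_(i < n) g i (tnth t i))%:E.
Proof.
move=> mg g0 nuE A mA.
transitivity (\int[product_law nu]_t (\1_A t)%:E); first by rewrite integral_indic// setIT.
rewrite (ge0_integral_product_law_density mg g0 nuE)//.
- rewrite [RHS]integral_mkcond; apply: eq_integral => t _.
  by rewrite patchE indicE; case: ifPn; rewrite ?mul1e ?mul0e.
- by apply/measurable_EFinP; exact: measurable_indic.
Qed.

(** Rectangles with sides in [G] form a system stable under intersection that generates the product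
    sigma-algebra. This serves to identify the law of a sample, with [G] the rectangles of a single
    observation. *)
Lemma product_law_unique (G : set (set T)) n (mu : 'I_n -> probability T R)
    (m' : probability (n.-tuple T) R) :
  measurable = <<s G >> -> setI_closed G -> G setT ->
  (forall A : 'I_n -> set T, (forall i, G (A i)) ->
    m' [set t | forall i, A i (tnth t i)] = \prod_(i < n) mu i (A i)) ->
  forall A, measurable A -> m' A = product_law mu A.
Proof.
move=> GE GI GT m'E.
have mG A : G A -> measurable A by rewrite GE; exact: sub_sigma_algebra.
pose rect := [set B | exists2 A : 'I_n -> set T, forall i, G (A i) &
  B = [set t : n.-tuple T | forall i, A i (tnth t i)]].
have mrect : rect `<=` measurable.
  move=> _ [A GA ->].
  rewrite (_ : mkset _ = \bigcap_(i in [set: 'I_n]) ((@tnth n T)^~ i @^-1` A i)).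
    apply: fin_bigcap_measurable => // i _.
    rewrite -[X in measurable X]setTI; apply: measurable_tnth => //; exact: mG.
  by apply/seteqP; split=> [t tA i _|t tA i]; [exact: tA | exact: (tA i)].
move=> A mA.
apply: (measure_unique rect (fun=> setT)) => //.
- rewrite eqEsubset; split; last first.
    by apply: smallest_sub => //; exact: sigma_algebra_measurable.
  apply: smallest_sub; first exact: smallest_sigma_algebra.
  rewrite -bigcup_seq; apply: bigcup_sub => i _ /=.
  rewrite GE -g_sigma_preimageE; apply: smallest_sub.
    exact: smallest_sigma_algebra.
  move=> _ [C GC <-]; apply: sub_sigma_algebra.
  (* The preimage of [C] under one coordinate is itself a rectangle, with full sides elsewhere;
     hence the condition [G setT]. *)
  exists (fun j => if j == i then C else setT) => [j|]; first by case: ifP.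
  rewrite setTI; apply/seteqP; split=> [t tC j /=|t /(_ i)]; last by rewrite eqxx.
  by case: eqVneq => // ->.
- move=> _ _ [A1 GA1 ->] [A2 GA2 ->]; exists (fun i => A1 i `&` A2 i).
    by move=> i; exact: GI.
  apply/seteqP; split=> [t /= [t1 t2] i|t /= t12]; first by split.
  by split=> i; have [] := t12 i.
- by move=> _; exists (fun=> setT) => //; apply/seteqP; split.
- by rewrite bigcup_const//; exists 0%N.
- by move=> _ [A' GA' ->]; apply: etrans (m'E _ GA') _;
    apply/esym/product_lawE => i; exact: mG.
- by move=> _; rewrite (le_lt_trans (probability_le1 _ _))// ltry.
Qed.

End product_law_integral.

(** * Gaussian and spike-and-slab laws on the real line *)

Section real_laws.
Context (R : realType).
Local Open Scope ereal_scope.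
Local Notation mu := (@lebesgue_measure R).

Lemma ge0_integral_real_law (P : probability (measurableTypeR R) R) (f : R -> \bar R) :
  measurable_fun setT f -> (forall x, 0 <= f x) ->
  \int[real_law P]_x f x = \int[P]_x f x.
Proof.
move=> mf f0.
have mid : measurable_fun setT (id : measurableTypeR R -> R) by [].
by rewrite -[RHS](ge0_integral_pushforward mid P measurableT mf).
Qed.

Lemma ge0_integral_normal_prob (m s : R) (f : R -> \bar R) :
  measurable_fun setT f -> (forall x, 0 <= f x) ->
  \int[normal_prob m s]_x f x = \int[mu]_x (f x * (normal_pdf m s x)%:E).
Proof.
move=> mf f0; apply: (@ge0_integral_density _ _ _ (normal_prob m s) mu) => //.
exact: measurable_normal_pdf.
Qed.

Lemma ge0_integral_spike_slab (p m s : R) (f : R -> \bar R) :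
  (0 <= p <= 1)%R -> measurable_fun setT f -> (forall x, 0 <= f x) ->
  \int[real_law (spike_slab p m s)]_x f x =
  p%:E * \int[normal_prob m s]_x f x + (1 - p)%:E * f 0%R.
Proof.
move=> /[dup] p01 /andP[p0 p1] mf f0; rewrite ge0_integral_real_law//.
have q0 : (0 <= 1 - p)%R by rewrite subr_ge0.
pose nu := measure_add (mscale (NngNum p0) (normal_prob m s))
  (mscale (NngNum q0) (\d_(0%R : measurableTypeR R))).
rewrite (eq_measure_integral nu)//.
  rewrite ge0_integral_measure_add//= !ge0_integral_mscale//= integral_dirac//.
  by rewrite diracT mul1e.
move=> A mA _; rewrite /= /spike_slab integral_bernoulli_prob//.
by rewrite /msum 2!big_ord_recl big_ord0 adde0.
Qed.

Lemma normal_prob_set1 (m s x : R) : normal_prob m s [set x] = 0.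
Proof.
have /null_content_dominatesP := @normal_prob_dominates R m s; apply => //.
exact: lebesgue_measure_set1.
Qed.

Lemma normal_pdf_tilt (m s t x : R) : s != 0%R ->
  (expR (t * ((x - m) / s)) * normal_pdf m s x =
   expR (t ^+ 2 / 2) * normal_pdf (m + t * s) s x)%R.
Proof.
move=> s0; rewrite /normal_pdf (negbTE s0) /normal_fun.
rewrite mulrCA [RHS]mulrCA -!expRD; congr (_ * expR _)%R.
by field; rewrite s0.
Qed.

Lemma normal_prob_mgf (m s t : R) : s != 0%R ->
  \int[normal_prob m s]_x (expR (t * ((x - m) / s)))%:E = (expR (t ^+ 2 / 2))%:E.
Proof.
move=> s0; rewrite ge0_integral_normal_prob//; last first.
- apply/measurable_EFinP; apply: measurableT_comp => //; apply: measurable_funM => //.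
  by apply: measurable_funM => //; exact: measurable_funB.
under eq_integral do rewrite -EFinM normal_pdf_tilt// EFinM.
rewrite ge0_integralZl//; last 2 first.
- by apply/measurable_EFinP; exact: measurable_normal_pdf.
- by move=> x _; rewrite lee_fin normal_pdf_ge0.
by rewrite integral_normal_pdf mule1.
Qed.

(** The factor exp(x^2 / (4 s^2)) cancels half of the Gaussian exponent, which doubles the variance;
    sqrt 2 is the ratio of the two peaks. The same factor is the quadratic part of the sparsity
    penalty. *)
Lemma normal_pdf_widen (s x : R) : s != 0%R ->
  (expR (x ^+ 2 / (4 * s ^+ 2)) * normal_pdf 0 s x =
   Num.sqrt 2 * normal_pdf 0 (Num.sqrt 2 * s) x)%R.
Proof.
move=> s0; have r0 : (Num.sqrt 2 != 0 :> R)%R by rewrite gt_eqF// sqrtr_gt0.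
have r2 : (Num.sqrt 2 ^+ 2 = 2 :> R)%R by rewrite sqr_sqrtr.
rewrite /normal_pdf (negbTE s0) (negbTE (mulf_neq0 r0 s0)) /normal_fun /normal_peak.
have -> : ((Num.sqrt 2 * s) ^+ 2 * pi *+ 2 = 2 * (s ^+ 2 * pi *+ 2) :> R)%R.
  by rewrite exprMn r2; ring.
rewrite sqrtrM//; set P := Num.sqrt (s ^+ 2 * _ *+ 2).
have -> : ((Num.sqrt 2 * P)^-1 = (Num.sqrt 2)^-1 * P^-1)%R by rewrite invfM.
rewrite [RHS]mulrA [X in _ = (X * _)%R]mulrA mulfV// mul1r mulrCA.
congr (_ * _)%R; rewrite -expRD exprMn r2; congr expR; by field.
Qed.

Lemma normal_prob_expR_sqr (s : R) : s != 0%R ->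
  \int[normal_prob 0 s]_x (expR (x ^+ 2 / (4 * s ^+ 2)))%:E = (Num.sqrt 2)%:E.
Proof.
move=> s0; rewrite ge0_integral_normal_prob//; last first.
- apply/measurable_EFinP; apply: measurableT_comp => //; apply: measurable_funM => //.
under eq_integral do rewrite -EFinM normal_pdf_widen// EFinM.
rewrite ge0_integralZl//; last 2 first.
- by apply/measurable_EFinP; exact: measurable_normal_pdf.
- by move=> x _; rewrite lee_fin normal_pdf_ge0.
by rewrite integral_normal_pdf mule1.
Qed.

Lemma normal_prob_expR_norm_le (m s t : R) : s != 0%R ->
  \int[normal_prob m s]_x (expR (t * `|(x - m) / s|))%:E <= (2 * expR (t ^+ 2 / 2))%:E.
Proof.
move=> s0; have mz : measurable_fun setT (fun x : R => (x - m) / s)%R.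
  by apply: measurable_funM => //; exact: measurable_funB.
have mE u : measurable_fun setT (fun x : R => (expR (u * ((x - m) / s)))%:E).
  by apply/measurable_EFinP; apply: measurableT_comp => //; exact: measurable_funM.
apply: (@le_trans _ _ (\int[normal_prob m s]_x ((expR (t * ((x - m) / s)))%:E +
   (expR (- t * ((x - m) / s)))%:E))).
  apply: ge0_le_integral => //.
  - apply/measurable_EFinP; apply: measurableT_comp => //; apply: measurable_funM => //.
    exact: (measurableT_comp (@normr_measurable R setT) mz).
  - by apply: emeasurable_funD; exact: mE.
  - move=> x _; rewrite -EFinD lee_fin; case: ger0P => _.
      by rewrite lerDl expR_ge0.
    by rewrite mulrN -mulNr lerDr expR_ge0.
rewrite ge0_integralD//; last 2 first.
- exact: mE.
- exact: mE.
by rewrite !normal_prob_mgf// sqrrN -EFinD lee_fin mulrDl mul1r.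
Qed.

Lemma integral_spike_slab_neq0 (p m s : R) : (0 <= p <= 1)%R ->
  \int[real_law (spike_slab p m s)]_x ((x != 0)%R%:R)%:E = p%:E.
Proof.
move=> p01.
have mN : measurable_fun setT (fun x : R => ((x != 0)%R%:R)%:E : \bar R).
  apply/measurable_EFinP; rewrite (_ : (fun _ => _) = \1_([set~ 0%R])).
    by apply: measurable_indic; exact: measurableC.
  apply/funext => x; rewrite indicE; congr (_ %:R)%R; congr (nat_of_bool _).
  by apply/idP/idP; rewrite inE/= => /eqP.
rewrite ge0_integral_spike_slab//.
rewrite eqxx/= mule0 adde0 -[RHS]mule1; congr (_ * _).
rewrite -(@probability_setT _ _ _ (normal_prob m s)) -[RHS]mul1e -integral_cst//.
apply: ae_eq_integral => //.
exists [set 0%R]; split; [exact: measurable_set1|exact: normal_prob_set1|].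
by move=> x H; apply: contrapT => /eqP x0; apply: H => _; rewrite /= x0.
Qed.

End real_laws.

Section spike_slab_moments.
Context (R : realType).
Local Open Scope ereal_scope.
Local Notation mu := (@lebesgue_measure R).

Lemma measurable_neq0 : measurable_fun setT (fun x : R => (x != 0)%R%:R : R).
Proof.
rewrite (_ : (fun _ => _) = \1_([set~ 0%R])).
  by apply: measurable_indic; exact: measurableC.
apply/funext => x; rewrite indicE; congr (_ %:R)%R; congr (nat_of_bool _).
by apply/idP/idP; rewrite inE/= => /eqP.
Qed.

Lemma integral_normal_neq0 (m s : R) (f : R -> R) :
  measurable_fun setT f ->
  \int[normal_prob m s]_x ((x != 0)%R%:R * f x)%:E = \int[normal_prob m s]_x (f x)%:E.
Proof.
move=> mf; apply: ae_eq_integral => //.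
- by apply/measurable_EFinP; apply: measurable_funM => //; exact: measurable_neq0.
- exact/measurable_EFinP.
exists [set 0%R]; split; [exact: measurable_set1|exact: normal_prob_set1|].
by move=> x H; apply: contrapT => /eqP x0; apply: H => _; rewrite /= x0 mul1r.
Qed.

Lemma spike_slab_expR_le (lambda s a : R) : (0 <= lambda <= 1)%R -> s != 0%R -> (0 <= a)%R ->
  \int[real_law (spike_slab lambda 0 s)]_x
    (expR (a * (x != 0)%R%:R + x ^+ 2 / (4 * s ^+ 2)))%:E
  <= (1 + lambda * (Num.sqrt 2 * expR a))%:E.
Proof.
move=> l01 s0 a0; have /andP[l0 l1] := l01.
have mf : measurable_fun setT
    (fun x : R => expR (a * (x != 0)%R%:R + x ^+ 2 / (4 * s ^+ 2))).
  apply: measurableT_comp => //; apply: measurable_funD.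
    by apply: measurable_funM => //; exact: measurable_neq0.
  by apply: measurable_funM => //.
rewrite ge0_integral_spike_slab//; last exact/measurable_EFinP.
rewrite eqxx mulr0 add0r expr0n/= mul0r expR0 mule1 addeC.
rewrite [leRHS]EFinD [X in _ <= _ + X]EFinM; apply: leeD; first by rewrite lee_fin gerBl.
apply: lee_wpmul2l => //.
rewrite EFinM -(normal_prob_expR_sqr s0) muleC -ge0_integralZl//; last first.
  by apply/measurable_EFinP; apply: measurableT_comp => //; exact: measurable_funM.
apply: ge0_le_integral => //.
- exact/measurable_EFinP.
- by apply: measurable_funeM; apply/measurable_EFinP; apply: measurableT_comp => //; exact: measurable_funM.
- move=> x _; rewrite -EFinM lee_fin -expRD ler_expR lerD2r.
  by case: (x != 0)%R; rewrite ?mulr1 ?mulr0.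
Qed.

Lemma spike_slab_expR_neq0_le (p m s : R) : (0 <= p <= 1)%R ->
  \int[real_law (spike_slab p m s)]_x (expR ((x != 0)%R%:R))%:E <=
  (expR (p * (expR 1 - 1)))%:E.
Proof.
move=> p01; have /andP[p0 p1] := p01.
have mf : measurable_fun setT (fun x : R => expR ((x != 0)%R%:R) : R).
  exact: (measurableT_comp (@measurable_expR R) measurable_neq0).
rewrite ge0_integral_spike_slab//; last exact/measurable_EFinP.
rewrite eqxx expR0 mule1.
apply: (@le_trans _ _ (p * expR 1 + (1 - p))%:E).
  rewrite [leRHS]EFinD [X in _ <= X + _]EFinM leeD2r// lee_wpmul2l//.
  have PT : normal_prob m s setT = 1 by exact: probability_setT.
  apply: (@le_trans _ _ (\int[normal_prob m s]_x (cst (expR 1)%:E x))).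
    apply: ge0_le_integral => //; first exact/measurable_EFinP.
    by move=> x _; rewrite lee_fin ler_expR; case: (x != 0)%R.
  by rewrite integral_cst// [X in _ * X]PT mule1.
by rewrite lee_fin; apply: le_trans (expR_ge1Dx _); lra.
Qed.

(** The condition [p != 1 -> m = 0] places the atom at the centre of the slab; elsewhere the spike
    would contribute exp(t |m / s|), which is huge for the small [s] of the comparison law. *)
Lemma spike_slab_expR_norm_le (p m s t : R) : (0 <= p <= 1)%R -> s != 0%R ->
  (p != 1 -> m = 0)%R ->
  \int[real_law (spike_slab p m s)]_x (expR (t * `|(x - m) / s|))%:E <=
  (2 * expR (t ^+ 2 / 2))%:E.
Proof.
move=> p01 s0 pm; have /andP[p0 p1] := p01.
have e1 : (1 <= 2 * expR (t ^+ 2 / 2))%R.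
  suff : (1 <= expR (t ^+ 2 / 2))%R by lra.
  by rewrite -expR0 ler_expR divr_ge0// sqr_ge0.
rewrite ge0_integral_spike_slab//; last first.
  apply/measurable_EFinP; apply: measurableT_comp => //; apply: measurable_funM => //.
  apply: (measurableT_comp (@normr_measurable R setT)).
  by apply: measurable_funM => //; exact: measurable_funB.
apply: (@le_trans _ _ (p%:E * (2 * expR (t ^+ 2 / 2))%:E +
    (1 - p)%:E * (2 * expR (t ^+ 2 / 2))%:E)).
  apply: leeD; first by rewrite lee_wpmul2l// normal_prob_expR_norm_le.
  have [->|/pm ->] := eqVneq p 1%R; first by rewrite subrr !mul0e.
  rewrite subrr mul0r normr0 mulr0 expR0 lee_wpmul2l// lee_fin subr_ge0//.
by rewrite -!EFinM -EFinD lee_fin -mulrDl addrC subrK mul1r.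
Qed.

(** Density, with respect to the prior on one coordinate, of the point mass at 0 if [m = 0] and of
    N(m, tau^2) otherwise. The former lives on the atom, of prior mass 1 - lambda; the latter on its
    complement, where the prior is lambda times N(0, s^2). *)
Definition spike_slab_ratio (lambda s tau m x : R) : R :=
  (if m == 0 then (x == 0)%:R / (1 - lambda)
   else (x != 0)%:R * (normal_pdf m tau x / (lambda * normal_pdf 0 s x)))%R.

Lemma normal_pdf_gt0 (m s x : R) : s != 0%R -> (0 < normal_pdf m s x)%R.
Proof.
move=> s0; rewrite /normal_pdf (negbTE s0)/= mulr_gt0 ?expR_gt0//.
exact: normal_peak_gt0.
Qed.

Lemma measurable_normal_ratio (m tau s : R) : s != 0%R ->
  measurable_fun setT (fun x => normal_pdf m tau x / normal_pdf 0 s x)%R.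
Proof.
move=> s0.
rewrite (_ : (fun _ => _) = (fun x => normal_pdf m tau x * expR (- ln (normal_pdf 0 s x)))%R).
  apply: measurable_funM; first exact: measurable_normal_pdf.
  apply: measurableT_comp => //; apply: measurableT_comp => //.
  by apply: measurableT_comp => //; exact: measurable_normal_pdf.
by apply/funext => x; rewrite expRN lnK// posrE normal_pdf_gt0.
Qed.

Lemma measurable_spike_slab_ratio (lambda s tau m : R) : s != 0%R ->
  measurable_fun setT (spike_slab_ratio lambda s tau m).
Proof.
move=> s0; rewrite /spike_slab_ratio; case: (m == 0)%R.
  apply: measurable_funM => //.
  rewrite (_ : (fun _ => _) = (fun x : R => 1 - (x != 0)%:R)%R).
    by apply: measurable_funB => //; exact: measurable_neq0.
  by apply/funext => x; case: eqVneq => _; rewrite ?subrr ?subr0.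
apply: measurable_funM; first exact: measurable_neq0.
rewrite (_ : (fun _ => _) = (fun x => lambda^-1 * (normal_pdf m tau x / normal_pdf 0 s x))%R).
  by apply: measurable_funM => //; exact: measurable_normal_ratio.
by apply/funext => x; rewrite invfM; ring.
Qed.

Lemma spike_slab_ratio_ge0 (lambda s tau m x : R) : (0 <= lambda <= 1)%R ->
  (0 <= spike_slab_ratio lambda s tau m x)%R.
Proof.
move=> /andP[l0 l1]; rewrite /spike_slab_ratio; case: ifP => _.
  by rewrite divr_ge0// subr_ge0.
by rewrite mulr_ge0// divr_ge0 ?mulr_ge0 ?normal_pdf_ge0.
Qed.

(** A Gaussian law does not charge 0. So the ratio removes the slab of the prior and keeps its atom
    when [m = 0], and does the opposite otherwise. *)
Lemma spike_slab_ratioE (lambda s tau m : R) (A : set R) :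
  (0 < lambda < 1)%R -> s != 0%R -> measurable A ->
  real_law (spike_slab (m != 0)%R%:R m tau) A =
  \int[real_law (spike_slab lambda 0 s)]_(x in A) (spike_slab_ratio lambda s tau m x)%:E.
Proof.
move=> /andP[l0 l1] s0 mA.
have l01 : (0 <= lambda <= 1)%R by rewrite !ltW.
have b01 : (0 <= ((m != 0)%R%:R : R) <= 1)%R by case: (m != 0)%R; rewrite /= ?lexx ?ler01.
pose g := spike_slab_ratio lambda s tau m.
have mg : measurable_fun setT g by exact: measurable_spike_slab_ratio.
have mi : measurable_fun setT (fun x : R => (\1_A x : R)) by exact: measurable_indic.
transitivity (\int[real_law (spike_slab (m != 0)%R%:R m tau)]_x (\1_A x)%:E).
  by rewrite integral_indic// setIT.
transitivity (\int[real_law (spike_slab lambda 0 s)]_x (\1_A x * g x)%:E); last first.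
  rewrite [RHS]integral_mkcond; apply: eq_integral => x _.
  by rewrite patchE indicE; case: ifPn; rewrite ?mul1r ?mul0r.
rewrite ge0_integral_spike_slab//; last exact/measurable_EFinP.
rewrite [RHS]ge0_integral_spike_slab//; last 2 first.
- by apply/measurable_EFinP; exact: measurable_funM.
- by move=> x; rewrite lee_fin mulr_ge0// spike_slab_ratio_ge0.
rewrite /g /spike_slab_ratio; case: eqVneq => [m0|m0] /=.
  rewrite mul0e add0e subr0 mul1e eqxx.
  under eq_integral do rewrite mulrCA.
  rewrite (_ : \int[_]_x _ = 0).
    by rewrite mule0 add0e -EFinM/=; congr (_%:E); field; rewrite subr_eq0 gt_eqF.
  rewrite -(integral_normal_neq0 0 s).
    apply: integral0_eq => x _; case: eqVneq => _; by rewrite ?mul0r ?mulr0 ?mul0r.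
  apply: measurable_funM.
    rewrite (_ : (fun _ => _) = (fun x : R => 1 - (x != 0)%:R)%R).
      by apply: measurable_funB => //; exact: measurable_neq0.
    by apply/funext => x; case: eqVneq => _; rewrite ?subrr ?subr0.
  by apply: measurable_funM.
rewrite mul1e subrr mul0e adde0 eqxx/= mul0r mulr0 mule0 adde0.
under [in RHS]eq_integral do rewrite mulrCA.
have mN : measurable_fun setT (fun x => \1_A x *
    (normal_pdf m tau x / (lambda * normal_pdf 0 s x)) : R)%R.
  apply: measurable_funM => //.
  rewrite (_ : (fun _ => _) = (fun x => lambda^-1 * (normal_pdf m tau x / normal_pdf 0 s x))%R).
    by apply: measurable_funM => //; exact: measurable_normal_ratio.
  by apply/funext => x; rewrite invfM; ring.
rewrite integral_normal_neq0// !ge0_integral_normal_prob//; last 3 first.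
- exact/measurable_EFinP.
- exact/measurable_EFinP.
- by move=> x; rewrite lee_fin !mulr_ge0// ?invr_ge0 ?mulr_ge0 ?normal_pdf_ge0// ltW.
rewrite -ge0_integralZl//; last 3 first.
- apply: emeasurable_funM; first exact/measurable_EFinP.
  by apply/measurable_EFinP; exact: measurable_normal_pdf.
- move=> x _; rewrite -EFinM lee_fin !mulr_ge0 ?normal_pdf_ge0//.
  by rewrite invr_ge0 mulr_ge0 ?normal_pdf_ge0// ltW.
- by rewrite lee_fin ltW.
apply: eq_integral => x _; rewrite -!EFinM; congr (_%:E); field.
by rewrite !gt_eqF// normal_pdf_gt0.
Qed.

Lemma normal_peakE (s : R) : (0 < s)%R ->
  (normal_peak s = s^-1 * (Num.sqrt (pi *+ 2))^-1)%R.
Proof.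
move=> s0; rewrite /normal_peak -mulrnAr sqrtrM ?sqr_ge0// sqrtr_sqr gtr0_norm//.
by rewrite invfM.
Qed.

(** The numerator is bounded by its peak alone, so its decay away from [m] is given up; the
    remaining exp(x^2 / (2 s^2)) is later controlled under the comparison law, where [x] stays close
    to [m]. *)
Lemma normal_pdf_le_ratio (m s tau x : R) : (0 < s)%R -> (0 < tau)%R ->
  (normal_pdf m tau x <=
   s / tau * expR (x ^+ 2 / (2 * s ^+ 2)) * normal_pdf 0 s x)%R.
Proof.
move=> s0 t0; apply: le_trans (normal_pdf_ub _ _ _) _; first by rewrite gt_eqF.
rewrite /normal_pdf (gt_eqF s0)/= /normal_fun subr0 !normal_peakE//.
rewrite mulrACA mulrA -mulrA -expRD.
rewrite (_ : _ / _ + _ = 0)%R; last by field; rewrite gt_eqF.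
rewrite expR0 mulr1 mulrA.
by rewrite (_ : s / tau / s = tau^-1)%R//; field; rewrite !gt_eqF.
Qed.

Lemma spike_slab_ratio_le (lambda s tau m x : R) : (0 < lambda < 1)%R ->
  (0 < s)%R -> (0 < tau)%R ->
  (spike_slab_ratio lambda s tau m x <=
   expR (- ln (1 - lambda) + (m != 0)%R%:R *
     (- ln lambda + ln (s / tau) + x ^+ 2 / (2 * s ^+ 2))))%R.
Proof.
move=> /andP[l0 l1] s0 t0; rewrite /spike_slab_ratio; case: eqVneq => _ /=.
  rewrite mul0r addr0 expRN lnK ?posrE ?subr_gt0//.
  rewrite ler_piMl ?invr_ge0 ?subr_ge0 ?(ltW l1)//.
  by case: (x == 0)%R; rewrite ?ler01.
have p0 : (0 < lambda * normal_pdf 0 s x)%R.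
  by rewrite mulr_gt0// normal_pdf_gt0// gt_eqF.
rewrite mul1r; apply: (@le_trans _ _ (normal_pdf m tau x / (lambda * normal_pdf 0 s x))%R).
  rewrite ler_piMl//; first by rewrite divr_ge0 ?normal_pdf_ge0// ltW.
  by case: (x != 0)%R; rewrite ?ler01.
apply: (@le_trans _ _ (expR (- ln lambda + ln (s / tau) + x ^+ 2 / (2 * s ^+ 2)))%R).
  rewrite !expRD expRN !lnK ?posrE ?divr_gt0// ler_pdivrMr//.
  apply: le_trans (normal_pdf_le_ratio m x s0 t0) _.
  by rewrite le_eqVlt; apply/orP; left; apply/eqP; field; rewrite !gt_eqF.
rewrite ler_expR lerDr oppr_ge0 -(ln1 R) ler_ln ?posrE ?subr_gt0//; lra.
Qed.

End spike_slab_moments.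

(** * Expectations under the sampling model *)

Section sampling_expectation.
Context d (Omega : measurableType d) (R : realType) (P : probability Omega R).
Variables (n p : nat) (s : R).
Variables (X : 'I_n -> {RV P >-> p.-tuple R}) (eps : 'I_n -> {RV P >-> R}).
Hypothesis model : sampling_model s X eps.
Local Open Scope ereal_scope.

Let noise : probability R R := real_law (normal_prob 0 s).

Let sample om : n.-tuple (p.-tuple R * R)%type := [tuple (X i om, eps i om) | i < n].

Let msample : measurable_fun setT sample.
Proof.
apply/measurable_fun_tnthP => i.
rewrite (_ : _ \o _ = fun om => (X i om, eps i om)).
  by apply/measurable_fun_pair.
by apply/funext => om /=; rewrite tnth_mktuple.
Qed.

HB.instance Definition _ := isMeasurableFun.Build _ _ _ _ sample msample.

Let sample_law A : measurable A ->
  distribution P sample A = product_law (fun=> (cube_uniform p \x noise)%E) A.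
Proof.
pose G : set (set (p.-tuple R * R)) :=
  [set C | exists2 A, measurable A & exists2 B, measurable B & C = A `*` B].
apply: (product_law_unique (G := G)).
- rewrite measurable_prod_measurableType; congr (<<s _ >>).
  apply/seteqP; split=> [_ [A1 mA [B1 mB <-]]|_ [A1 mA [B1 mB ->]]].
    by exists A1 => //; exists B1.
  by exists A1 => //; exists B1.
- move=> _ _ [A1 mA1 [B1 mB1 ->]] [A2 mA2 [B2 mB2 ->]].
  by rewrite -setXI; exists (A1 `&` A2); [exact: measurableI|
    exists (B1 `&` B2) => //; exact: measurableI].
- by exists setT => //; exists setT => //; rewrite setXTT.
- move=> C GC.
  have {}GC i : exists AB : set (p.-tuple R) * set R,
      [/\ measurable AB.1, measurable AB.2 & C i = AB.1 `*` AB.2].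
    by have [A1 mA [B1 mB CE]] := GC i; exists (A1, B1).
  have /choice[AB ABP] := GC.
  have [lX leps indep] := model.
  transitivity (P [set om | forall i, (AB i).1 (X i om) /\ (AB i).2 (eps i om)]).
    rewrite /distribution /pushforward; congr (P _).
    apply/seteqP; split=> om /= H i; have := H i; rewrite tnth_mktuple;
      by have [_ _ ->] := ABP i.
  rewrite (indep (fun i => (AB i).1) (fun i => (AB i).2)); last 2 first.
    by move=> i; have [] := ABP i.
    by move=> i; have [] := ABP i.
  rewrite -big_split/=; apply: eq_bigr => i _.
  have [mA mB ->] := ABP i; apply/esym.
  transitivity (cube_uniform p (AB i).1 * noise (AB i).2).
    exact: (product_measure1E (cube_uniform p) noise mA mB).
  by congr (_ * _); apply/esym; [exact: (lX i)|exact: (leps i)].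
Qed.

(** Independence makes the law of the sample a product law of pairs (design point, noise); the
    expectation then factorises over observations, and each factor is an iterated integral with the
    noise inside. *)
Lemma sampling_expectation (F : 'I_n -> p.-tuple R * R -> R) :
  (forall i, measurable_fun setT (F i)) -> (forall i z, (0 <= F i z)%R) ->
  \int[P]_om (\prod_(i < n) F i (X i om, eps i om))%:E =
  \prod_(i < n) \int[cube_uniform p]_x \int[normal_prob 0 s]_e (F i (x, e))%:E.
Proof.
move=> mF F0.
pose f (t : n.-tuple (p.-tuple R * R)) : \bar R := (\prod_(i < n) F i (tnth t i))%:E.
have mf : measurable_fun setT f.
  apply/measurable_EFinP; apply: measurable_prod => i _.
  by apply: measurableT_comp => //; exact: measurable_tnth.
have f0 t : 0 <= f t by rewrite lee_fin prodr_ge0.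
transitivity (\int[distribution P sample]_t f t).
  rewrite ge0_integral_pushforward// preimage_setT; apply: eq_integral => om _ /=.
  by congr (_%:E); apply: eq_bigr => i _; rewrite tnth_mktuple.
rewrite (eq_measure_integral (product_law (fun=> (cube_uniform p \x noise)%E))); last first.
  by move=> A mA _; exact: sample_law.
rewrite ge0_integral_product_law_prod//; apply: eq_bigr => i _.
rewrite (fubini_tonelli1 (fun z => (F i z)%:E)); last 2 first.
- exact/measurable_EFinP.
- by move=> z; rewrite lee_fin.
apply: eq_integral => x _; rewrite /fubini_F ge0_integral_real_law//.
  by apply/measurable_EFinP; apply: measurableT_comp.
by move=> y; rewrite lee_fin.
Qed.

End sampling_expectation.

(** * Networks *)

Section network_bounds.
Context (R : realType) (sigma : R -> R) (w : nat -> nat) (L : nat).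
Hypothesis sigma_lip : 1.-lipschitz sigma.
Hypothesis w_gt0 : forall k, (0 < w k)%N.
Implicit Types (theta : (nparams w L).-tuple R) (b eta : R).

Let lip u v : `|sigma u - sigma v| <= `|u - v|.
Proof. by have /= := @sigma_lip (u, v) (conj Logic.I Logic.I); rewrite mul1r. Qed.

(** Bound on the neurons of layer [l] when the parameters are at most [b]. An affine map with [w k]
    inputs multiplies the current bound by at most [2 * b * w k], weights and bias together, and
    [|sigma 0|] pays for |sigma u| <= |u| + |sigma 0|. *)
Definition net_growth b l : R :=
  ((`|sigma 0| + 2) * b) ^+ l * \prod_(k < l) (w k)%:R.

Lemma net_growthS b l :
  net_growth b l.+1 = (`|sigma 0| + 2) * b * (w l)%:R * net_growth b l.
Proof. by rewrite /net_growth exprS big_ord_recr/=; ring. Qed.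

Let w_ge1 k : 1 <= (w k)%:R :> R.
Proof. by rewrite ler1n. Qed.

Lemma net_growth_ge1 b l : 1 <= b -> 1 <= net_growth b l.
Proof.
move=> b1; elim: l => [|l IHl]; first by rewrite /net_growth expr0 big_ord0 mulr1.
rewrite net_growthS; apply: le_trans IHl _.
have s0 : 0 <= `|sigma 0| by [].
have := w_ge1 l; set W := (w l)%:R => W1.
rewrite ler_peMl//; first by rewrite /net_growth mulr_ge0 ?exprn_ge0 ?prodr_ge0// mulr_ge0//; lra.
have : 1 <= (`|sigma 0| + 2) * b by nra.
nra.
Qed.

Definition bounded_params b theta := forall i, `|tnth theta i| <= b.

Let nth_bounded b theta k : 0 <= b -> bounded_params b theta -> `|nth 0 theta k| <= b.
Proof.
move=> b0 tb; have [kT|kT] := ltnP k (nparams w L).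
  by rewrite -(tnth_nth _ theta (Ordinal kT)).
by rewrite nth_default ?size_tuple// normr0.
Qed.

Let nth_close eta theta theta' k : 0 <= eta ->
  (forall i, `|tnth theta i - tnth theta' i| <= eta) ->
  `|nth 0 theta k - nth 0 theta' k| <= eta.
Proof.
move=> e0 tb; have [kT|kT] := ltnP k (nparams w L).
  by rewrite -(tnth_nth _ theta (Ordinal kT)) -(tnth_nth _ theta' (Ordinal kT)).
by rewrite !nth_default ?size_tuple// subrr normr0.
Qed.

Lemma hiddenS theta x l i : hidden sigma theta x l.+1 i 0 =
  sigma (\sum_(j < w l) nth 0 theta (layer_offset w l + i * (w l).+1 + j)%N *
     hidden sigma theta x l j 0 - nth 0 theta (layer_offset w l + i * (w l).+1 + w l)%N).
Proof.
rewrite /= !mxE; congr (sigma (_ - _)).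
by apply: eq_bigr => j _; rewrite !mxE.
Qed.

Lemma netE theta x : net sigma theta x =
  \sum_(j < w L) nth 0 theta (layer_offset w L + j)%N * hidden sigma theta x L j 0
  + nth 0 theta (layer_offset w L + w L)%N.
Proof.
rewrite /net !mxE; congr (_ + _).
by apply: eq_bigr => j _; rewrite !mxE.
Qed.

Let affine_bound n (a h : 'I_n -> R) (c b M : R) : (0 < n)%N -> 1 <= b -> 1 <= M ->
  (forall j, `|a j| <= b) -> (forall j, `|h j| <= M) -> `|c| <= b ->
  `|\sum_(j < n) a j * h j + c| <= 2 * b * n%:R * M.
Proof.
move=> n0 b1 M1 ab hM cb.
have n1 : 1 <= n%:R :> R by rewrite ler1n.
have H : `|\sum_(j < n) a j * h j| <= n%:R * (b * M).
  apply: le_trans (ler_norm_sum _ _ _) _.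
  rewrite mulr_natl -[X in _ *+ X](card_ord n) -sumr_const; apply: ler_sum => j _.
  by rewrite normrM ler_pM.
have H2 : b <= n%:R * (b * M) by rewrite mulrCA ler_peMr//; nra.
by apply: le_trans (ler_normD _ _) _; lra.
Qed.

Let affine_close n (a a' h h' : 'I_n -> R) (c c' b M D eta : R) :
  (0 < n)%N -> 1 <= b -> 1 <= M -> 0 <= eta -> 0 <= D ->
  (forall j, `|a j| <= b) -> (forall j, `|h' j| <= M) ->
  (forall j, `|a j - a' j| <= eta) -> (forall j, `|h j - h' j| <= D) ->
  `|c - c'| <= eta ->
  `|(\sum_(j < n) a j * h j + c) - (\sum_(j < n) a' j * h' j + c')| <=
  n%:R * (b * D + 2 * eta * M).
Proof.
move=> n0 b1 M1 e0 D0 ab hM aa hh cc.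
have n1 : 1 <= n%:R :> R by rewrite ler1n.
have -> : (\sum_(j < n) a j * h j + c) - (\sum_(j < n) a' j * h' j + c') =
  \sum_(j < n) (a j * (h j - h' j) + (a j - a' j) * h' j) + (c - c').
  rewrite opprD addrACA -sumrB; congr (_ + _).
  by apply: eq_bigr => j _; ring.
have H : `|\sum_(j < n) (a j * (h j - h' j) + (a j - a' j) * h' j)| <=
    n%:R * (b * D + eta * M).
  apply: le_trans (ler_norm_sum _ _ _) _.
  rewrite mulr_natl -[X in _ *+ X](card_ord n) -sumr_const; apply: ler_sum => j _.
  apply: le_trans (ler_normD _ _) _; rewrite !normrM; apply: lerD.
    by rewrite ler_pM.
  by rewrite ler_pM.
have H2 : eta <= n%:R * (eta * M) by rewrite mulrCA ler_peMr//; nra.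
by apply: le_trans (ler_normD _ _) _; lra.
Qed.

Lemma hidden_bound b theta x l i : 1 <= b -> bounded_params b theta -> cube (w 0) x ->
  `|hidden sigma theta x l i 0| <= net_growth b l.
Proof.
move=> b1 tb xc; have b0 : 0 <= b by exact: le_trans b1.
elim: l i => [|l IHl] i.
  rewrite /net_growth expr0 big_ord0 mulr1 /= mxE ler_norml; exact: xc.
have g1 := net_growth_ge1 l b1.
rewrite hiddenS net_growthS; set u := \sum_(_ < _) _ - _.
have : `|sigma u| <= `|u| + `|sigma 0|.
  have := lip u 0; rewrite subr0 => H.
  have := ler_normD (sigma u - sigma 0) (sigma 0); rewrite subrK; lra.
have : `|u| <= 2 * b * (w l)%:R * net_growth b l.
  apply: affine_bound => //; first by move=> j; exact: nth_bounded.
  by rewrite normrN; exact: nth_bounded.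
have : `|sigma 0| <= `|sigma 0| * (b * (w l)%:R * net_growth b l).
  rewrite ler_peMr//; have := w_ge1 l; set W := (w l)%:R => W1.
  have : 1 <= b * W by nra.
  nra.
lra.
Qed.

Lemma net_bound b theta x : 1 <= b -> bounded_params b theta -> cube (w 0) x ->
  `|net sigma theta x| <= net_growth b L.+1.
Proof.
move=> b1 tb xc; have b0 : 0 <= b by exact: le_trans b1.
have g1 := net_growth_ge1 L b1.
rewrite netE net_growthS.
apply: (@le_trans _ _ (2 * b * (w L)%:R * net_growth b L)).
  apply: affine_bound => //.
  - by move=> j; exact: nth_bounded.
  - by move=> j; exact: hidden_bound.
  - exact: nth_bounded.
rewrite ler_wpM2r ?(le_trans _ g1)// ler_wpM2r// ler_wpM2r//.
by rewrite lerDr.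
Qed.

Let growth_step b eta l : 1 <= b -> 0 <= eta ->
  (w l)%:R * (b * (2 * l%:R * eta * net_growth b l) + 2 * eta * net_growth b l)
  <= 2 * l.+1%:R * eta * net_growth b l.+1.
Proof.
move=> b1 e0; have g1 := net_growth_ge1 l b1.
rewrite net_growthS; have s0 : 0 <= `|sigma 0| by [].
set G := net_growth b l in g1 *; set W := (w l)%:R; set l' := l%:R.
have W0 : 0 <= W by [].
have -> : l.+1%:R = l' + 1 :> R by rewrite -natr1.
have l0 : 0 <= l' by [].
have G0 : 0 <= G by exact: le_trans ler01 g1.
have : 0 <= W * eta * G by apply: mulr_ge0 => //; exact: mulr_ge0.
set Z := W * eta * G => Z0.
have -> : W * (b * (2 * l' * eta * G) + 2 * eta * G) = Z * (2 * l' * b + 2) by rewrite /Z; ring.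
have -> : 2 * (l' + 1) * eta * ((`|sigma 0| + 2) * b * W * G) =
  Z * (2 * (l' + 1) * ((`|sigma 0| + 2) * b)) by rewrite /Z; ring.
apply: ler_wpM2l => //.
have H1 : b <= (`|sigma 0| + 2) * b by rewrite ler_peMl//; lra.
have H2 : l' * b <= l' * ((`|sigma 0| + 2) * b) by exact: ler_wpM2l.
lra.
Qed.

(** In each layer the weights and the bias inject an error of at most 2 eta per unit of signal, and
    the later layers amplify it no more than they amplify the signal; summing over layers gives the
    factor [2 * l]. *)
Lemma hidden_close b eta theta theta' x l i : 1 <= b -> 0 <= eta ->
  bounded_params b theta -> bounded_params b theta' -> cube (w 0) x ->
  (forall i, `|tnth theta i - tnth theta' i| <= eta) ->
  `|hidden sigma theta x l i 0 - hidden sigma theta' x l i 0| <=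
  2 * l%:R * eta * net_growth b l.
Proof.
move=> b1 e0 tb tb' xc tt'; have b0 : 0 <= b by exact: le_trans b1.
elim: l i => [|l IHl] i; first by rewrite /= !mxE subrr normr0 mulr0 !mul0r.
have g1 := net_growth_ge1 l b1.
rewrite !hiddenS; apply: le_trans (lip _ _) _.
have D0 : 0 <= 2 * l%:R * eta * net_growth b l.
  by apply: mulr_ge0 (le_trans ler01 g1); rewrite !mulr_ge0.
apply: le_trans.
  apply: (affine_close (w_gt0 l) b1 g1 e0 D0).
  - by move=> j; exact: nth_bounded.
  - by move=> j; exact: hidden_bound.
  - by move=> j; exact: nth_close.
  - exact: IHl.
  - by rewrite -opprD normrN; exact: nth_close.
exact: growth_step.
Qed.

Lemma net_close b eta theta theta' x : 1 <= b -> 0 <= eta ->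
  bounded_params b theta -> bounded_params b theta' -> cube (w 0) x ->
  (forall i, `|tnth theta i - tnth theta' i| <= eta) ->
  `|net sigma theta x - net sigma theta' x| <= 2 * L.+1%:R * eta * net_growth b L.+1.
Proof.
move=> b1 e0 tb tb' xc tt'; have b0 : 0 <= b by exact: le_trans b1.
have g1 := net_growth_ge1 L b1.
have D0 : 0 <= 2 * L%:R * eta * net_growth b L.
  by apply: mulr_ge0 (le_trans ler01 g1); rewrite !mulr_ge0.
rewrite !netE; apply: le_trans.
  apply: (affine_close (w_gt0 L) b1 g1 e0 D0).
  - by move=> j; exact: nth_bounded.
  - by move=> j; exact: hidden_bound.
  - by move=> j; exact: nth_close.
  - by move=> j; exact: hidden_close.
  - exact: nth_close.
exact: growth_step.
Qed.

End network_bounds.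

Section network_measurability.
Context (R : realType) (sigma : R -> R) (w : nat -> nat) (L : nat).
Hypothesis sigma_lip : 1.-lipschitz sigma.
Context d (S : measurableType d).
Variables (theta : S -> (nparams w L).-tuple R) (x : S -> (w 0).-tuple R).
Hypotheses (mtheta : measurable_fun setT theta) (mx : measurable_fun setT x).

Let mparam k : measurable_fun setT (fun s => nth 0 (theta s) k).
Proof. exact: (measurableT_comp (@measurable_param R w L k) mtheta). Qed.

Lemma measurable_hidden_comp l i :
  measurable_fun setT (fun s => hidden sigma (theta s) (x s) l i 0).
Proof.
have msigma := lipschitz_measurable sigma_lip.
elim: l i => [|l IHl] i.
  rewrite (_ : (fun _ => _) = (fun s => tnth (x s) i)).
    exact: (measurableT_comp (measurable_tnth i) mx).
  by apply/funext => s; rewrite /= mxE.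
under eq_fun do rewrite hiddenS.
apply: measurableT_comp => //; apply: measurable_funB => //.
by apply: measurable_sum => j; apply: measurable_funM.
Qed.

Lemma measurable_net_comp : measurable_fun setT (fun s => net sigma (theta s) (x s)).
Proof.
under eq_fun do rewrite netE.
apply: measurable_funD => //; apply: measurable_sum => j.
by apply: measurable_funM => //; exact: measurable_hidden_comp.
Qed.

End network_measurability.

Section cube.
Context (R : realType) (p : nat).

Lemma cubeE : cube p = \bigcap_(i in [set: 'I_p])
  ((fun x : p.-tuple R => tnth x i) @^-1` `[-1, 1]%classic).
Proof.
by apply/seteqP; split=> [x xc i _|x xc i]; [have := xc i|have := xc i Logic.I];
  rewrite /= in_itv.
Qed.

Lemma measurable_cube : measurable (cube p : set (p.-tuple R)).
Proof.
rewrite cubeE; apply: fin_bigcap_measurable => // i _.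
by rewrite -[X in measurable X]setTI; exact: measurable_tnth.
Qed.

Local Open Scope ereal_scope.

Lemma cube_uniform_cube : cube_uniform p (cube p : set (p.-tuple R)) = 1.
Proof.
pose I : set R := `[(-1)%R, 1%R]%classic.
have -> : cube p = [set x : p.-tuple R | forall i : 'I_p, I (tnth x i)].
  by apply/seteqP; split=> x xc i; have := xc i; rewrite /I /= in_itv.
transitivity (\prod_(i < p) real_law (uniform_prob (@ltN11 R)) I).
  by apply: (product_lawE (fun=> real_law (uniform_prob (@ltN11 R)))) => i; exact: measurable_itv.
rewrite big1// => i _.
by rewrite /= /real_law /uniform_prob integral_uniform_pdf1.
Qed.

Lemma integral_cube (f : p.-tuple R -> \bar R) : measurable_fun setT f ->
  (forall x, 0 <= f x) ->
  \int[cube_uniform p]_(x in cube p) f x = \int[cube_uniform p]_x f x.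
Proof.
move=> mf f0; have mc := measurable_cube.
have c0 : cube_uniform p (~` (cube p : set (p.-tuple R))) = 0.
  by rewrite probability_setC// cube_uniform_cube subee.
rewrite -[in RHS](setUv (cube p)) ge0_integral_setU//; last 3 first.
- exact: measurableC.
- by rewrite setUv.
- exact/disj_setPCl.
rewrite [X in _ + X](_ : _ = 0) ?adde0//.
by apply: null_set_integral => //; [exact: measurableC|exact: measurable_funTS].
Qed.

End cube.

(** * The Hellinger affinity and the distance of the theorem *)

Section hellinger.
Context (R : realType) (p : nat) (s_eps : R).
Variables (d : measure_display) (S : measurableType d).
Variables (f : S -> p.-tuple R -> R) (f0 : p.-tuple R -> R).
Hypothesis mf : measurable_fun setT (fun z : S * p.-tuple R => f z.1 z.2).
Hypothesis mf0 : measurable_fun (cube p) f0.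
Local Open Scope ereal_scope.

(** The function [f0] is measurable on the cube only; its extension by 0 is measurable everywhere
    and agrees with it at the design points, which lie in the cube almost surely. *)
Definition on_cube (g : p.-tuple R -> R) : p.-tuple R -> R := g \_ (cube p).

Lemma measurable_on_cube : measurable_fun setT (on_cube f0).
Proof. by apply/(measurable_restrictT f0 (@measurable_cube R p)). Qed.

(** Integral of the square root of the product of the densities of one observation under [g] and
    under [f0]: two Gaussian laws of variance s_eps^2 whose means differ by u have affinity exp(-
    u^2 / (8 s_eps^2)). *)
Definition affinity (g : p.-tuple R -> R) : R :=
  fine (\int[cube_uniform p]_x (expR (- (g x - on_cube f0 x) ^+ 2 / (8 * s_eps ^+ 2)))%:E).

Let mg s : measurable_fun setT (f s).
Proof.
rewrite (_ : f s = (fun z : S * p.-tuple R => f z.1 z.2) \o (fun x => (s, x))) //.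
by apply: (measurableT_comp mf); exact: pair1_measurable.
Qed.

Let mexp s : measurable_fun setT
  (fun x => expR (- (f s x - on_cube f0 x) ^+ 2 / (8 * s_eps ^+ 2))).
Proof.
apply: measurableT_comp => //; apply: measurable_funM => //.
apply: measurableT_comp => //; apply: measurable_funX.
by apply: measurable_funB => //; exact: measurable_on_cube.
Qed.

Let exp_le1 (u : R) : (expR (- u ^+ 2 / (8 * s_eps ^+ 2)) <= 1)%R.
Proof.
rewrite -expR0 ler_expR mulNr oppr_le0 divr_ge0 ?sqr_ge0//.
by rewrite mulr_ge0// sqr_ge0.
Qed.

Let UT : cube_uniform p (setT : set (p.-tuple R)) = 1.
Proof. exact: probability_setT. Qed.

Lemma affinityE s : (affinity (f s))%:E =
  \int[cube_uniform p]_x (expR (- (f s x - on_cube f0 x) ^+ 2 / (8 * s_eps ^+ 2)))%:E.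
Proof.
rewrite fineK// ge0_fin_numE; last by apply: integral_ge0 => x _; rewrite lee_fin expR_ge0.
apply: (@le_lt_trans _ _ (\int[cube_uniform p]_x (cst 1 x))).
  apply: ge0_le_integral => //; first exact/measurable_EFinP.
  by move=> x _; rewrite lee_fin exp_le1.
by rewrite integral_cst// [X in _ * X]UT mule1 ltry.
Qed.

Lemma affinity_ge0 g : (0 <= affinity g)%R.
Proof. by apply/fine_ge0/integral_ge0 => x _; rewrite lee_fin expR_ge0. Qed.

Lemma affinity_le1 s : (affinity (f s) <= 1)%R.
Proof.
rewrite -lee_fin affinityE.
apply: (@le_trans _ _ (\int[cube_uniform p]_x (cst 1 x))).
  apply: ge0_le_integral => //; first exact/measurable_EFinP.
  by move=> x _; rewrite lee_fin exp_le1.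
by rewrite integral_cst// [X in _ * X]UT mule1.
Qed.

Lemma d2E s : d2 s_eps (f s) f0 = (1 - affinity (f s))%:E.
Proof.
have m1 : measurable_fun setT (fun x =>
   (1 - expR (- (f s x - on_cube f0 x) ^+ 2 / (8 * s_eps ^+ 2)))%:E).
  by apply/measurable_EFinP; exact: measurable_funB.
have -> : d2 s_eps (f s) f0 = \int[cube_uniform p]_x
   (1 - expR (- (f s x - on_cube f0 x) ^+ 2 / (8 * s_eps ^+ 2)))%:E.
  rewrite -integral_cube//; last by move=> x; rewrite lee_fin subr_ge0 exp_le1.
  by apply: eq_integral => x xc; rewrite /on_cube patchE xc.
rewrite EFinB affinityE.
have E : \int[cube_uniform p]_x (cst (1%:E : \bar R) x) = 1 by rewrite integral_cst// [X in _ * X]UT mule1.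
rewrite -[in RHS]E -integralB//.
- exact: finite_measure_integrable_cst.
- apply/integrableP; split; first exact/measurable_EFinP.
  under eq_integral do rewrite gee0_abs ?lee_fin ?expR_ge0//.
  by rewrite -affinityE ltry.
Qed.

Lemma measurable_affinity : measurable_fun setT (fun s => affinity (f s)).
Proof.
apply: measurableT_comp => //.
apply: (measurable_fun_fubini_tonelli_F (m2 := cube_uniform p) (fun z : S * p.-tuple R =>
  (expR (- (f z.1 z.2 - on_cube f0 z.2) ^+ 2 / (8 * s_eps ^+ 2)))%:E)).
  apply/measurable_EFinP; apply: measurableT_comp => //; apply: measurable_funM => //.
  apply: measurableT_comp => //; apply: measurable_funX.
  apply: measurable_funB => //; apply: measurableT_comp => //.
  exact: measurable_on_cube.
by move=> z; rewrite lee_fin expR_ge0.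
Qed.

End hellinger.

(** * Finite nets of sparse bounded parameters *)

Section sparse_net.
Context (R : realType) (T s : nat) (b eta : R).
Hypotheses (b_ge0 : 0 <= b) (eta_gt0 : 0 < eta).

Let G := Num.truncn (b / eta).

Definition net_code : finType := {ffun 'I_s -> 'I_T * (bool * 'I_G.+1)}.

(* A code lists at most [s] coordinates together with a signed multiple of
   [eta]; the coordinates that are not listed are set to 0. *)
Definition net_point (c : net_code) : T.-tuple R :=
  [tuple (if [pick k | (c k).1 == i] is Some k
          then (-1) ^+ (c k).2.1 * (eta * ((c k).2.2 : nat)%:R) else 0) | i < T].

Lemma card_net_code : #|net_code| = ((T * (2 * G.+1)) ^ s)%N.
Proof. by rewrite card_ffun card_prod !card_ord card_prod card_bool card_ord. Qed.

Lemma net_point_bounded c i : `|tnth (net_point c) i| <= b.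
Proof.
rewrite tnth_mktuple; case: pickP => [k _|_]; last by rewrite normr0.
rewrite normrM normrX normrN1 expr1n mul1r ger0_norm; last by rewrite mulr_ge0// ltW.
rewrite mulrC -ler_pdivlMr//.
apply: (@le_trans _ _ G%:R); first by rewrite ler_nat -ltnS.
by rewrite /G truncn_le divr_ge0// ltW.
Qed.

Lemma sparse_net (theta : T.-tuple R) : (0 < T)%N -> (norm0 theta <= s)%N ->
  (forall i, `|tnth theta i| <= b) ->
  exists c, forall i, `|tnth theta i - tnth (net_point c) i| <= eta.
Proof.
move=> T0 ts tb; pose i0 : 'I_T := Ordinal T0.
pose supp := [seq i <- enum 'I_T | tnth theta i != 0].
have size_supp : size supp = norm0 theta.
  by rewrite /norm0 -[in RHS](map_tnth_enum theta) count_map -size_filter.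

pose code (a : R) : bool * 'I_G.+1 := (a < 0, inord (Num.truncn (`|a| / eta))).
(* Slots beyond the support repeat [i0]. Repetitions are consistent because the recorded value
   depends on the coordinate only. Values are rounded towards 0 with their sign kept, so they remain
   bounded by [b]. *)
exists [ffun k : 'I_s => let i := nth i0 supp k in (i, code (tnth theta i))] => i.
rewrite tnth_mktuple; case: pickP => [k|none].
  rewrite ffunE /= => /eqP ->; set a := tnth theta i.
  have y0 : 0 <= `|a| / eta by rewrite divr_ge0// ltW.
  rewrite inordK; last first.
    by rewrite ltnS /G le_truncn// ler_pM2r ?invr_gt0//; exact: tb.
  have /andP[y1 y2] := truncn_itv y0.
  rewrite {1}(numEsign a) -mulrBr normrM normrX normrN1 expr1n mul1r.
  have aE : `|a| = eta * (`|a| / eta) by rewrite mulrC divfK// gt_eqF.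
  rewrite {1}aE -mulrBr normrM (gtr0_norm eta_gt0) ler_piMr ?(ltW eta_gt0)//.
  by rewrite ger0_norm ?subr_ge0// lerBlDl natr1 ltW.
rewrite subr0; have [->|ai] := eqVneq (tnth theta i) 0; first by rewrite normr0 ltW.
have iS : i \in supp by rewrite mem_filter ai mem_enum.
have kS : (index i supp < s)%N by rewrite (leq_trans _ ts)// -size_supp index_mem.
by have := none (Ordinal kS); rewrite ffunE /= nth_index// eqxx.
Qed.

End sparse_net.

(** * Likelihood ratios *)

Lemma lee_prod (R : realDomainType) (I : Type) (r : seq I) (f g : I -> \bar R) :
  (forall i, (0 <= f i)%E) -> (forall i, (f i <= g i)%E) ->
  (\prod_(i <- r) f i <= \prod_(i <- r) g i)%E.
Proof.
move=> f0 fg; suff /andP[] : (0 <= \prod_(i <- r) f i <= \prod_(i <- r) g i)%E by [].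
elim/big_rec2 : _ => [|i y x _ /andP[y0 yx]]; first by rewrite lee01 lexx.
by rewrite mule_ge0//= lee_pmul.
Qed.

Section exponential_moments.
Context d (Omega : measurableType d) (R : realType) (P : probability Omega R).
Variables (n p : nat) (s : R).
Variables (X : 'I_n -> {RV P >-> p.-tuple R}) (eps : 'I_n -> {RV P >-> R}).
Hypothesis model : sampling_model s X eps.
Hypothesis s_gt0 : (0 < s)%R.
Local Open Scope ereal_scope.

Let s_neq0 : s != 0%R. Proof. by rewrite gt_eqF. Qed.

Let UT : cube_uniform p (setT : set (p.-tuple R)) = 1.
Proof. exact: probability_setT. Qed.

(** For a fixed design point the noise is integrated by the Gaussian moment generating function,
    with parameter [g x]. The three moments below are instances for different [g] and [h], except
    the one of the absolute noise. *)
Lemma sampling_expR_affine (g h : p.-tuple R -> R) :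
  measurable_fun setT g -> measurable_fun setT h ->
  \int[P]_om (expR (\sum_(i < n) (g (X i om) * (eps i om / s) + h (X i om))))%:E =
  \prod_(i < n) \int[cube_uniform p]_x (expR (g x ^+ 2 / 2 + h x))%:E.
Proof.
move=> mg mh.
pose F (z : p.-tuple R * R) : R := expR (g z.1 * (z.2 / s) + h z.1).
have mF : measurable_fun setT F.
  apply: measurableT_comp => //; apply: measurable_funD; last exact: measurableT_comp.
  apply: measurable_funM; first exact: measurableT_comp.
  exact: measurable_funM.
under eq_integral do rewrite expR_sum.
rewrite (sampling_expectation model (F := fun=> F))//; last first.
  by move=> _ z; exact: expR_ge0.
apply: eq_bigr => _ _; apply: eq_integral => x _.
rewrite /F/=; under eq_integral do rewrite addrC expRD EFinM.
rewrite ge0_integralZl//; last first.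
  apply/measurable_EFinP; apply: measurableT_comp => //.
  by apply: measurable_funM => //; exact: measurable_funM.
rewrite (_ : \int[_]_y _ = (expR (g x ^+ 2 / 2))%:E).
  by rewrite -EFinM -expRD addrC.
rewrite -(normal_prob_mgf 0 (g x) s_neq0).
by apply: eq_integral => y _; rewrite subr0.
Qed.

Lemma sampling_expR_noise :
  \int[P]_om (expR (\sum_(i < n) `|eps i om| / s))%:E <=
  \prod_(i < n) (2 * expR (1 / 2))%:E.
Proof.
pose F (z : p.-tuple R * R) : R := expR (`|z.2| / s).
have mF : measurable_fun setT F.
  apply: measurableT_comp => //; apply: measurable_funM => //.
  exact: measurableT_comp.
under eq_integral do rewrite expR_sum.
rewrite (sampling_expectation model (F := fun=> F))//; last first.
  by move=> _ z; exact: expR_ge0.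
apply: lee_prod => i.
  by apply: integral_ge0 => x _; apply: integral_ge0 => y _; rewrite lee_fin expR_ge0.
have -> : (2 * expR (1 / 2))%:E = \int[cube_uniform p]_x (cst (2 * expR (1 / 2))%:E x) :> \bar R.
  by rewrite integral_cst// [X in _ * X]UT mule1.
apply: ge0_le_integral => //.
- by move=> x _; apply: integral_ge0 => y _; rewrite lee_fin expR_ge0.
- by rewrite /F/=; exact: measurable_cst.
- move=> x _; have := normal_prob_expR_norm_le 0 1 s_neq0.
  rewrite expr1n; apply: le_trans; rewrite le_eqVlt; apply/orP; left; apply/eqP.
  apply: eq_integral => y _; rewrite /F /= subr0 mul1r normrM.
  by rewrite normfV (gtr0_norm s_gt0).
Qed.

Variable f0 : p.-tuple R -> R.
Hypothesis mf0 : measurable_fun (cube p) f0.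

Definition excess (f : p.-tuple R -> R) x : R := (f x - on_cube f0 x)%R.

(** With u the excess, the residual is eps - u under [f] and eps under [f0]; the summand is (eps^2 -
    (eps - u)^2) / (2 s^2). *)
Definition log_likelihood_ratio (f : p.-tuple R -> R) om : R :=
  (\sum_(i < n) (2 * eps i om * excess f (X i om) - excess f (X i om) ^+ 2) / (2 * s ^+ 2))%R.

Variable f : p.-tuple R -> R.
Hypothesis mf : measurable_fun setT f.

Let mu : measurable_fun setT (excess f).
Proof. by apply: measurable_funB => //; exact: measurable_on_cube. Qed.

Lemma expectation_likelihood_ratio :
  \int[P]_om (expR (log_likelihood_ratio f om))%:E = 1.
Proof.
transitivity (\int[P]_om (expR (\sum_(i < n) ((excess f (X i om) / s) * (eps i om / s) +
   - (excess f (X i om) ^+ 2 / (2 * s ^+ 2)))))%:E).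
  apply: eq_integral => om _; congr (expR _)%:E.
  apply: eq_bigr => i _; by field; rewrite s_neq0.
rewrite (sampling_expR_affine (g := fun x => excess f x / s)
  (h := fun x => - (excess f x ^+ 2 / (2 * s ^+ 2)))%R).
- apply: big1 => _ _; transitivity (\int[cube_uniform p]_x (cst 1%:E x) : \bar R).
    apply: eq_integral => x _ /=; rewrite [X in expR X](_ : _ = 0)%R ?expR0//; by field; rewrite s_neq0.
  by rewrite integral_cst// [X in _ * X]UT mule1.
- exact: measurable_funM.
- apply: measurableT_comp => //; apply: measurable_funM => //.
  exact: measurable_funX.
Qed.

(** Half of the log-ratio has drift - u^2 / (4 s^2) and the Gaussian moment adds u^2 / (8 s^2); the
    sum - u^2 / (8 s^2) is the exponent in the definition of [affinity]. *)
Lemma expectation_sqrt_likelihood_ratio :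
  \int[P]_om (expR (log_likelihood_ratio f om / 2))%:E = (affinity s f0 f ^+ n)%:E.
Proof.
transitivity (\int[P]_om (expR (\sum_(i < n) ((excess f (X i om) / (2 * s)) * (eps i om / s) +
   - (excess f (X i om) ^+ 2 / (4 * s ^+ 2)))))%:E).
  apply: eq_integral => om _; congr (expR _)%:E.
  rewrite /log_likelihood_ratio mulr_suml; apply: eq_bigr => i _; by field; rewrite s_neq0.
rewrite (sampling_expR_affine (g := fun x => excess f x / (2 * s))
  (h := fun x => - (excess f x ^+ 2 / (4 * s ^+ 2)))%R).
- rewrite -[n in RHS]card_ord -prodr_const -prodEFin; apply: eq_bigr => _ _.
  rewrite (@affinityE R p s _ unit (fun _ => f) f0 _ mf0 tt).
    apply: eq_integral => x _ /=; congr (expR _)%:E; rewrite /excess; by field; rewrite s_neq0.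
  by apply: measurableT_comp.
- exact: measurable_funM.
- apply: measurableT_comp => //; apply: measurable_funM => //.
  exact: measurable_funX.
Qed.

(** The sign [c] allows both tails to be treated at once, for a two-sided bound on the weighted
    noise. *)
Lemma expectation_weighted_noise (c V : R) : (c ^+ 2 = 1)%R ->
  (forall x, `|excess f x| <= V)%R ->
  \int[P]_om (expR (c * \sum_(i < n) eps i om * excess f (X i om) / s ^+ 2))%:E <=
  (expR (n%:R * (V ^+ 2 / (2 * s ^+ 2))))%:E.
Proof.
move=> c1 fV.
have -> : \int[P]_om (expR (c * \sum_(i < n) eps i om * excess f (X i om) / s ^+ 2))%:E =
    \int[P]_om (expR (\sum_(i < n) ((c * excess f (X i om) / s) * (eps i om / s) + 0)))%:E.
  apply: eq_integral => om _; congr (expR _)%:E.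
  rewrite mulr_sumr; apply: eq_bigr => i _; by field; rewrite s_neq0.
rewrite (sampling_expR_affine (g := fun x => (c * excess f x / s)%R) (h := fun=> 0%R))//; last first.
  by apply: measurable_funM => //; exact: measurable_funM.
rewrite expRM_natl -[X in (_ ^+ X)%:E](card_ord n) -prodr_const -prodEFin.
apply: lee_prod => i.
  by apply: integral_ge0 => x _; rewrite lee_fin expR_ge0.
have -> : (expR (V ^+ 2 / (2 * s ^+ 2)))%:E = \int[cube_uniform p]_x (cst (expR (V ^+ 2 / (2 * s ^+ 2)))%:E x) :> \bar R.
  by rewrite integral_cst// [X in _ * X]UT mule1.
apply: ge0_le_integral => //.
- apply/measurable_EFinP; apply: measurableT_comp => //.
  apply: measurable_funD => //; apply: measurable_funM => //; apply: measurable_funX.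
  by apply: measurable_funM => //; exact: measurable_funM.
- move=> x _; rewrite lee_fin ler_expR addr0.
  have -> : ((c * excess f x / s) ^+ 2 / 2 = excess f x ^+ 2 / (2 * s ^+ 2))%R.
    by rewrite !exprMn c1 exprVn; field; rewrite s_neq0.
  rewrite ler_pM2r ?invr_gt0 ?mulr_gt0 ?exprn_gt0//.
  by rewrite -[leLHS]real_normK ?num_real// lerXn2r ?nnegrE// (le_trans _ (fV x)).
Qed.

End exponential_moments.

Section likelihood_ratio.
Context d (Omega : measurableType d) (R : realType) (P : probability Omega R).
Variables (n p : nat) (s : R).
Variables (X : 'I_n -> {RV P >-> p.-tuple R}) (eps : 'I_n -> {RV P >-> R}).
Hypothesis s_gt0 : 0 < s.
Variable f0 : p.-tuple R -> R.
Hypothesis mf0 : measurable_fun (cube p) f0.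

Local Notation llr := (log_likelihood_ratio s X eps f0).
Local Notation u := (excess f0).

Lemma prod_normal_pdf_excess om (f : p.-tuple R -> R) :
  (forall i, cube p (X i om)) ->
  \prod_(i < n) normal_pdf (f (X i om)) s (f0 (X i om) + eps i om) =
  \prod_(i < n) normal_pdf 0 s (eps i om) * expR (llr f om).
Proof.
move=> Xc; rewrite /log_likelihood_ratio expR_sum -big_split/=; apply: eq_bigr => i _.
rewrite /normal_pdf (gt_eqF s_gt0)/= /normal_fun.
rewrite -[RHS]mulrA -expRD; congr (_ * expR _).
by rewrite /excess /on_cube patchE mem_set//; field; rewrite gt_eqF.
Qed.

Lemma llr_close om (f g : p.-tuple R -> R) (delta U : R) :
  (forall i, cube p (X i om)) -> 0 <= delta ->
  (forall x, cube p x -> `|f x - g x| <= delta) ->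
  (forall x, cube p x -> `|u f x| <= U) -> (forall x, cube p x -> `|u g x| <= U) ->
  llr f om <= llr g om + delta * (\sum_(i < n) `|eps i om| + n%:R * U) / s ^+ 2.
Proof.
move=> Xc d0 fg fU gU; rewrite -lerBlDl -sumrB.
rewrite mulrDr mulr_sumr mulrDl mulr_suml.
have -> : delta * (n%:R * U) / s ^+ 2 = \sum_(i < n) (delta * U / s ^+ 2).
  by rewrite sumr_const card_ord -[RHS]mulr_natl; ring.
rewrite -big_split/=; apply: ler_sum => i _.
have H : u f (X i om) = u g (X i om) + (f (X i om) - g (X i om)) by rewrite /excess; ring.
have := fg _ (Xc i); have := fU _ (Xc i); have := gU _ (Xc i); move: H.
set a := u f _; set b := u g _; set D := f _ - g _; set e := eps i om => aE.
move=> bU aU DU.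
rewrite -mulrBl.
have -> : delta * `|e| / s ^+ 2 + delta * U / s ^+ 2 =
  (2 * (delta * `|e|) + 2 * delta * U) / (2 * s ^+ 2) by field; rewrite gt_eqF.
rewrite ler_pM2r ?invr_gt0 ?mulr_gt0 ?exprn_gt0//.
have H1 : e * D <= delta * `|e|.
  by rewrite (le_trans (ler_norm _))// normrM mulrC ler_wpM2r.
have H2 : b ^+ 2 - a ^+ 2 <= delta * (2 * U).
  have -> : b ^+ 2 - a ^+ 2 = - D * (a + b) by rewrite aE; ring.
  rewrite (le_trans (ler_norm _))// normrM normrN ler_pM//.
  by rewrite (le_trans (ler_normD _ _))//; lra.
have -> : 2 * e * a - a ^+ 2 - (2 * e * b - b ^+ 2) = 2 * (e * D) + (b ^+ 2 - a ^+ 2).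
  by rewrite aE; ring.
lra.
Qed.

(** The excess of [f] is b + D, with b the excess of [g] and D = f - g, and its square is at most 2
    b^2 + 2 D^2. The noise against D is bounded absolutely, but the noise against b is kept signed:
    its exponential moment yields a bound with n V^2, whereas absolute values would give n V. *)
Lemma opp_llr_le om (f g : p.-tuple R -> R) (delta V : R) :
  (forall i, cube p (X i om)) -> 0 <= delta -> 0 <= V ->
  (forall x, cube p x -> `|f x - g x| <= delta) -> (forall x, cube p x -> `|u g x| <= V) ->
  - llr f om <= n%:R * (delta ^+ 2 + V ^+ 2) / s ^+ 2
    + delta * (\sum_(i < n) `|eps i om|) / s ^+ 2
    - \sum_(i < n) eps i om * u g (X i om) / s ^+ 2.
Proof.
move=> Xc d0 V0 fg gV; rewrite mulr_sumr mulr_suml -sumrN -[X in _ - X]opprK.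
have -> : n%:R * (delta ^+ 2 + V ^+ 2) / s ^+ 2 =
    \sum_(i < n) ((delta ^+ 2 + V ^+ 2) / s ^+ 2).
  by rewrite sumr_const card_ord -[RHS]mulr_natl; ring.
rewrite -big_split/= opprK -sumrB; apply: ler_sum => i _.
have H : u f (X i om) = u g (X i om) + (f (X i om) - g (X i om)) by rewrite /excess; ring.
have := fg _ (Xc i); have := gV _ (Xc i); move: H.
set a := u f _; set b := u g _; set D := f _ - g _; set e := eps i om => aE bV DU.
rewrite -mulNr.
have -> : (delta ^+ 2 + V ^+ 2) / s ^+ 2 + delta * `|e| / s ^+ 2 - e * b / s ^+ 2 =
  (2 * delta ^+ 2 + 2 * V ^+ 2 + 2 * (delta * `|e|) - 2 * (e * b)) / (2 * s ^+ 2).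
  by field; rewrite gt_eqF.
rewrite ler_pM2r ?invr_gt0 ?mulr_gt0 ?exprn_gt0//.
have H1 : - (e * D) <= delta * `|e|.
  by rewrite (le_trans (ler_norm _))// normrN normrM mulrC ler_wpM2r.
have H2 : D ^+ 2 <= delta ^+ 2.
  by rewrite -[leLHS]real_normK ?num_real// lerXn2r ?nnegrE.
have H3 : b ^+ 2 <= V ^+ 2.
  by rewrite -[leLHS]real_normK ?num_real// lerXn2r ?nnegrE.
have H4 : 0 <= (b - D) ^+ 2 by exact: sqr_ge0.
have -> : - (2 * e * a - a ^+ 2) = - 2 * (e * b) + 2 * (- (e * D)) + (2 * b ^+ 2 + 2 * D ^+ 2 - (b - D) ^+ 2).
  by rewrite aE; ring.
lra.
Qed.

Lemma affinity_close (f g : p.-tuple R -> R) (delta U : R) :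
  measurable_fun setT f -> measurable_fun setT g -> 0 <= delta -> 0 <= U ->
  (forall x, cube p x -> `|f x - g x| <= delta) ->
  (forall x, cube p x -> `|u f x| <= U) -> (forall x, cube p x -> `|u g x| <= U) ->
  affinity s f0 g <= affinity s f0 f + delta * U / (4 * s ^+ 2).
Proof.
move=> mf mg d0 U0 fg fU gU.
pose ex (h : p.-tuple R -> R) x := expR (- (h x - on_cube f0 x) ^+ 2 / (8 * s ^+ 2)).
have mex h : measurable_fun setT h -> measurable_fun setT (ex h).
  move=> mh; apply: measurableT_comp => //; apply: measurable_funM => //.
  apply: measurableT_comp => //; apply: measurable_funX.
  by apply: measurable_funB => //; exact: measurable_on_cube.
have ex0 h x : 0 <= ex h x by exact: expR_ge0.
have affE h : measurable_fun setT h ->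
    (affinity s f0 h)%:E = (\int[cube_uniform p]_(x in cube p) (ex h x)%:E)%E.
  move=> mh; rewrite (@affinityE R p s _ unit (fun _ => h) f0 _ mf0 tt).
    rewrite -integral_cube//; apply/measurable_EFinP; exact: (mex h).
  exact: (measurableT_comp mh).
have mc : measurable (cube p : set (p.-tuple R)) by exact: measurable_cube.
have s2 k : (0 <= k%:R * s ^+ 2 :> R) by rewrite mulr_ge0// sqr_ge0.
have k0 : 0 <= delta * U / (4 * s ^+ 2) by apply: divr_ge0 => //; exact: mulr_ge0.
rewrite -lee_fin EFinD !affE//.
have -> : (delta * U / (4 * s ^+ 2))%:E =
    (\int[cube_uniform p]_(x in cube p) (cst (delta * U / (4 * s ^+ 2))%:E x))%E.
  by rewrite integral_cst// [X in (_ * X)%E]cube_uniform_cube mule1.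
rewrite -ge0_integralD//; last 2 first.
- by move=> x _; rewrite lee_fin.
- by apply/measurable_EFinP; apply: measurable_funTS; exact: mex.
apply: ge0_le_integral => //.
- by move=> x _; rewrite lee_fin.
- by apply/measurable_EFinP; apply: measurable_funTS; exact: mex.
- apply: emeasurable_funD => //; apply/measurable_EFinP; apply: measurable_funTS; exact: mex.
- move=> x xc; rewrite -EFinD lee_fin /ex.
  have H : u f x = u g x + (f x - g x) by rewrite /excess; ring.
  have := fg _ xc; have := fU _ xc; have := gU _ xc; move: H.
  rewrite -/(excess f0 f x) -/(excess f0 g x).
  set a := u f x; set b := u g x; set D := f x - g x => aE bU aU DU.
  (* The map v -> exp(- v) is 1-Lipschitz on the half-line, which reduces the comparison of
     affinities to that of the squared excesses. *)
  have exp_lip (v v' : R) : 0 <= v' -> expR (- v') <= expR (- v) + `|v - v'|.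
    move=> v'0; have [vv|vv] := leP v v'.
      by rewrite (le_trans (_ : _ <= expR (- v)))// ?lerDl// ler_expR lerN2.
    have -> : expR (- v) = expR (- v') * expR (- (v - v')).
      by rewrite -expRD; congr expR; ring.
    have e1 := expR_ge1Dx (- (v - v')).
    have e2 : expR (- v') <= 1 by rewrite -expR0 ler_expR oppr_le0.
    have e3 := expR_gt0 (- v').
    rewrite gtr0_norm ?subr_gt0//; nra.
  rewrite !mulNr; apply: le_trans (exp_lip (a ^+ 2 / (8 * s ^+ 2)) _ _) _.
    by apply: divr_ge0 => //; exact: sqr_ge0.
  rewrite lerD2l -mulrBl normrM [`|_^-1|]ger0_norm; last first.
    by rewrite invr_ge0.
  have -> : delta * U / (4 * s ^+ 2) = delta * (2 * U) / (8 * s ^+ 2).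
    by field; rewrite gt_eqF.
  rewrite ler_pM2r ?invr_gt0 ?mulr_gt0 ?exprn_gt0//.
  have -> : a ^+ 2 - b ^+ 2 = D * (a + b) by rewrite aE; ring.
  by rewrite normrM ler_pM// (le_trans (ler_normD _ _))//; lra.
Qed.

End likelihood_ratio.

(** * Sparsity and size of vectors with independent spike-and-slab coordinates *)

Section spike_slab_products.
Context (R : realType) (T : nat).
Implicit Types (theta : T.-tuple R).

Lemma norm0E theta : (norm0 theta)%:R = \sum_(i < T) (tnth theta i != 0)%:R :> R.
Proof.
rewrite /norm0 -{1}(map_tnth_enum theta) count_map -sum1_count natr_sum big_mkcond/=.
by rewrite big_enum/=; apply: eq_bigr => i _; case: eqP.
Qed.

Lemma measurable_norm0 : measurable_fun setT (fun theta : T.-tuple R => (norm0 theta)%:R : R).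
Proof.
under eq_fun do rewrite norm0E; apply: measurable_sum => i.
exact: (measurableT_comp (@measurable_neq0 R) (measurable_tnth i)).
Qed.

Lemma integral_product_law_tnth (mu : 'I_T -> probability R R) (i : 'I_T) (f : R -> R) :
  measurable_fun setT f -> (forall x, 0 <= f x) ->
  (\int[product_law mu]_t (f (tnth t i))%:E = \int[mu i]_x (f x)%:E)%E.
Proof.
move=> mf f0; pose F j : R -> R := if j == i then f else cst 1.
have -> : (\int[product_law mu]_t (f (tnth t i))%:E =
    \int[product_law mu]_t (\prod_(j < T) F j (tnth t j))%:E)%E.
  apply: eq_integral => t _; rewrite (bigD1 i)//= big1 => [|j ji].
    by rewrite /F eqxx mulr1.
  by rewrite /F (negbTE ji).
rewrite ge0_integral_product_law_prod; last 2 first.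
- by move=> j; rewrite /F; case: eqP.
- by move=> j x; rewrite /F; case: eqP => //= _; rewrite ler01.
rewrite (bigD1 i)//= big1 ?mule1 => [|j ji]; first by rewrite /F eqxx.
rewrite /F (negbTE ji)/=.
have muT : mu j setT = 1%E by exact: probability_setT.
by rewrite integral_cst// [X in (_ * X)%E]muT mule1.
Qed.

Lemma spike_slab_prior_expR_le (lambda s a : R) : 0 <= lambda <= 1 -> s != 0 -> 0 <= a ->
  (\int[spike_slab_prior T lambda s]_theta
     (expR (a * (norm0 theta)%:R + \sum_(i < T) tnth theta i ^+ 2 / (4 * s ^+ 2)))%:E
   <= ((1 + lambda * (Num.sqrt 2 * expR a)) ^+ T)%:E)%E.
Proof.
move=> l01 s0 a0.
pose F (x : R) : R := expR (a * (x != 0)%:R + x ^+ 2 / (4 * s ^+ 2)).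
have mF : measurable_fun setT F.
  apply: measurableT_comp => //; apply: measurable_funD.
    by apply: measurable_funM => //; exact: measurable_neq0.
  by apply: measurable_funM => //.
have F0 x : 0 <= F x by exact: expR_ge0.
under eq_integral do rewrite norm0E mulr_sumr -big_split/= expR_sum.
rewrite (ge0_integral_product_law_prod (fun=> real_law (spike_slab lambda 0 s)) (F := fun=> F))//.
rewrite -[X in (_ ^+ X)%:E](card_ord T) -prodr_const -prodEFin; apply: lee_prod => i.
  by apply: integral_ge0 => x _; rewrite lee_fin.
exact: spike_slab_expR_le.
Qed.

Lemma integral_spike_slab_norm0 (phi m s : 'I_T -> R) : (forall i, 0 <= phi i <= 1) ->
  (\int[product_law (fun i => real_law (spike_slab (phi i) (m i) (s i)))]_theta
    ((norm0 theta)%:R)%:E = (\sum_(i < T) phi i)%:E)%E.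
Proof.
move=> p01; under eq_integral do rewrite norm0E -sumEFin.
rewrite ge0_integral_sum//; last first.
  move=> i; apply/measurable_EFinP.
  exact: (measurableT_comp (@measurable_neq0 R) (measurable_tnth i)).
rewrite -sumEFin; apply: eq_bigr => i _.
rewrite (integral_product_law_tnth _ i (f := fun x : R => (x != 0)%:R))//.
  exact: integral_spike_slab_neq0.
exact: measurable_neq0.
Qed.

(** Chernoff's bound at exponent 1: a Bernoulli coordinate has exponential moment at most 1 + phi (e
    - 1) <= exp(phi (e - 1)), so only the sum of the inclusion probabilities matters. *)
Lemma spike_slab_norm0_tail (phi m s : 'I_T -> R) (k : nat) : (forall i, 0 <= phi i <= 1) ->
  (\int[product_law (fun i => real_law (spike_slab (phi i) (m i) (s i)))]_theta
    (((k < norm0 theta)%N)%:R)%:E <=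
   (expR ((expR 1 - 1) * \sum_(i < T) phi i - k%:R))%:E)%E.
Proof.
move=> p01; set q := product_law _.
have mk : measurable_fun setT (fun theta : T.-tuple R => expR ((norm0 theta)%:R) : R).
  exact: (measurableT_comp (@measurable_expR R) measurable_norm0).
have mt : measurable_fun setT (fun theta : T.-tuple R => ((k < norm0 theta)%N)%:R : R).
  rewrite (_ : (fun _ => _) = (fun theta : T.-tuple R => if (k%:R : R) < (norm0 theta)%:R then 1 else 0)).
    apply: measurable_fun_ifT => //; apply: measurable_fun_ltr => //; exact: measurable_norm0.
  by apply/funext => theta; rewrite ltr_nat; case: ltnP.
apply: (@le_trans _ _ (\int[q]_theta ((expR (- k%:R))%:E * (expR ((norm0 theta)%:R))%:E))%E).
  apply: ge0_le_integral => //.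
  - exact/measurable_EFinP.
  - by apply: measurable_funeM; exact/measurable_EFinP.
  - move=> theta _; rewrite -EFinM lee_fin -expRD.
    case: ltnP => [kt|_]; last by rewrite expR_ge0.
    by rewrite -[leLHS]expR0 ler_expR addrC subr_ge0 ler_nat ltnW.
rewrite ge0_integralZl//; last exact/measurable_EFinP.
rewrite addrC expRD EFinM lee_wpmul2l//.
under eq_integral do rewrite norm0E expR_sum.
have mF : measurable_fun setT (fun x : R => expR ((x != 0)%:R) : R).
  exact: (measurableT_comp (@measurable_expR R) (@measurable_neq0 R)).
rewrite /q (ge0_integral_product_law_prod _ (F := fun=> (fun x : R => expR ((x != 0)%:R) : R)))//.
rewrite mulr_sumr expR_sum -prodEFin; apply: lee_prod => i.
  by apply: integral_ge0 => x _; rewrite lee_fin expR_ge0.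
by rewrite mulrC; exact: spike_slab_expR_neq0_le.
Qed.

Lemma spike_slab_ratio_prod_le (lambda s tau : R) (m theta : T.-tuple R) :
  0 < lambda < 1 -> 0 < s -> 0 < tau ->
  \prod_(i < T) spike_slab_ratio lambda s tau (tnth m i) (tnth theta i) <=
  expR (- T%:R * ln (1 - lambda) + (norm0 m)%:R * (- ln lambda + ln (s / tau))
        + \sum_(i < T | tnth m i != 0) tnth theta i ^+ 2 / (2 * s ^+ 2)).
Proof.
move=> l01 s0 t0.
have -> : - T%:R * ln (1 - lambda) + (norm0 m)%:R * (- ln lambda + ln (s / tau))
        + \sum_(i < T | tnth m i != 0) tnth theta i ^+ 2 / (2 * s ^+ 2) =
  \sum_(i < T) (- ln (1 - lambda) + (tnth m i != 0)%:R *
     (- ln lambda + ln (s / tau) + tnth theta i ^+ 2 / (2 * s ^+ 2))).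
  rewrite big_split/= sumr_const card_ord -[(- _) *+ _]mulr_natl mulrN -mulNr -addrA; congr (_ + _).
  rewrite norm0E mulr_suml [X in _ + X]big_mkcond -big_split/=; apply: eq_bigr => i _.
  by case: eqP => _; rewrite /= ?mul0r ?mul1r ?addr0.
rewrite expR_sum; apply: ler_prod => i _; apply/andP; split.
  by apply: spike_slab_ratio_ge0; case/andP: l01 => ? ?; rewrite !ltW.
exact: spike_slab_ratio_le.
Qed.

End spike_slab_products.

(** * The event on which all data-dependent quantities are controlled *)

Section good_event.
Context d (Omega : measurableType d) (R : realType) (P : probability Omega R).
Variables (n p : nat) (s : R).
Variables (X : 'I_n -> {RV P >-> p.-tuple R}) (eps : 'I_n -> {RV P >-> R}).
Hypothesis model : sampling_model s X eps.
Hypotheses (s_gt0 : 0 < s) (n_gt0 : (0 < n)%N).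
Variable f0 : p.-tuple R -> R.
Hypothesis mf0 : measurable_fun (cube p) f0.

Local Notation llr := (log_likelihood_ratio s X eps f0).
Local Notation u := (excess f0).

Lemma probability_le_ge (psi : Omega -> \bar R) (c t : R) :
  measurable_fun setT psi -> (forall om, (0 <= psi om)%E) -> 0 < t ->
  (\int[P]_om psi om <= c%:E)%E ->
  measurable [set om | (psi om <= t%:E)%E] /\
  ((1 - c / t)%:E <= P [set om | (psi om <= t%:E)%E])%E.
Proof.
move=> mpsi psi0 t0 psic.
have mA : measurable [set om | (psi om <= t%:E)%E].
  by rewrite -[X in measurable X]setTI; apply: measurable_lee.
split=> //.
set A := [set om | (psi om <= t%:E)%E] in mA *.
have -> : P A = (1 - P (~` A))%E.
  by rewrite -[in LHS](setCK A) probability_setC//; exact: measurableC.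
have H : (P (~` A) <= (c / t)%:E)%E.
  rewrite EFinM lee_pdivlMr//; apply: le_trans psic.
  rewrite muleC -[X in (_ * P X)%E]setIT -integral_indic//; last exact: measurableC.
  rewrite -ge0_integralZl//; last 2 first.
  - by apply/measurable_EFinP; apply: measurable_indic; exact: measurableC.
  - by rewrite lee_fin ltW.
  apply: ge0_le_integral => //.
  - by move=> x _; rewrite mule_ge0// lee_fin ltW.
  - apply: measurable_funeM; apply/measurable_EFinP; apply: measurable_indic.
    exact: measurableC.
  - move=> x _; rewrite indicE; case: (boolP (_ \in _)) => [|_]; last by rewrite mule0.
    by rewrite inE/= mule1 => /negP; rewrite -ltNge => /ltW.
rewrite EFinB; exact: leeB.
Qed.

Lemma probability_cube :
  measurable [set om | forall i, cube p (X i om)] /\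
  P [set om | forall i, cube p (X i om)] = 1%E.
Proof.
have [lX leps indep] := model.
have mc : measurable (cube p : set (p.-tuple R)) by exact: measurable_cube.
split.
  rewrite (_ : mkset _ = \bigcap_(i in [set: 'I_n]) (X i @^-1` cube p)).
    apply: fin_bigcap_measurable => // i _.
    by rewrite -[Y in measurable Y]setTI; exact: measurable_funPT.
  by apply/seteqP; split=> [om H i _|om H i]; exact: H.
have := indep (fun=> cube p) (fun=> setT) (fun=> mc) (fun=> measurableT).
rewrite big1 => [|i _]; last first.
  have := lX i _ mc; rewrite /distribution /pushforward => ->.
  exact: cube_uniform_cube.
rewrite big1 => [|i _]; last by rewrite preimage_setT; exact: probability_setT.
rewrite mul1e => <-; congr (P _).
by apply/seteqP; split=> [om H i|om H i]; [split|have [] := H i].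
Qed.

Lemma measurable_llr_joint d' (S : measurableType d') (f : S -> p.-tuple R -> R) :
  measurable_fun setT (fun z : S * p.-tuple R => f z.1 z.2) ->
  measurable_fun setT (fun z : Omega * S => llr (f z.2) z.1).
Proof.
move=> mf; apply: measurable_sum => i; apply: measurable_funM => //.
have mu : measurable_fun setT (fun z : Omega * S => u (f z.2) (X i z.1)).
  apply: measurable_funB.
    apply: (measurableT_comp mf (g := fun z : Omega * S => (z.2, X i z.1))).
    by apply: measurable_fun_pair => //; exact: measurableT_comp.
  apply: measurableT_comp; first exact: measurable_on_cube.
  exact: measurableT_comp.
apply: measurable_funB; last exact: measurable_funX.
apply: measurable_funM => //; apply: measurable_funM => //; exact: measurableT_comp.
Qed.

Lemma measurable_llr (f : p.-tuple R -> R) : measurable_fun setT f ->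
  measurable_fun setT (llr f).
Proof.
move=> mf; apply: measurable_sum => i; apply: measurable_funM => //.
have mu : measurable_fun setT (fun om => u f (X i om)).
  apply: (measurableT_comp (f := u f)) => //.
  by apply: measurable_funB => //; exact: measurable_on_cube.
apply: measurable_funB; last exact: measurable_funX.
by apply: measurable_funM => //; apply: measurable_funM.
Qed.

Variables (d' : measure_display) (S : measurableType d') (prior : probability S R).
Variable f : S -> p.-tuple R -> R.
Hypothesis mf : measurable_fun setT (fun z : S * p.-tuple R => f z.1 z.2).
Variables (h : S -> R) (C3 : R).
Hypotheses (mh : measurable_fun setT h) (C3_gt0 : 0 < C3).
Hypothesis hC3 : (\int[prior]_t (expR (h t))%:E <= C3%:E)%E.
Variables (fstar : p.-tuple R -> R) (V : R).
Hypotheses (mfstar : measurable_fun setT fstar) (fstarV : forall x, `|u fstar x| <= V).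
Variables (J : finType) (g : J -> p.-tuple R -> R).
Hypotheses (mg : forall j, measurable_fun setT (g j)).

(* Each clause bounds a nonnegative statistic of small expectation, so that
   one application of Markov's inequality to their sum controls all of them. *)
Definition good om : Prop :=
  [/\ forall i, cube p (X i om),
      \sum_(i < n) `|eps i om| <= 3 * n%:R * s,
      `|\sum_(i < n) eps i om * u fstar (X i om) / s ^+ 2| <=
        n%:R * (V ^+ 2 / (2 * s ^+ 2)) + ln n%:R,
      (\int[prior]_t (expR (h t + llr (f t) om))%:E <= (n%:R * C3)%:E)%E &
      forall j, llr (g j) om + 2 * n%:R * (1 - affinity s f0 (g j)) <=
        2 * ln (n%:R * #|J|%:R)].

Let mll : measurable_fun setT (fun z : Omega * S => (expR (h z.2 + llr (f z.2) z.1))%:E : \bar R).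
Proof.
apply/measurable_EFinP; apply: measurableT_comp => //; apply: measurable_funD.
  exact: measurableT_comp.
exact: measurable_llr_joint.
Qed.

Let psi3 om : \bar R := (\int[prior]_t (expR (h t + llr (f t) om))%:E)%E.

Let mpsi3 : measurable_fun setT psi3.
Proof.
apply: (measurable_fun_fubini_tonelli_F (m2 := prior)
  (fun z : Omega * S => (expR (h z.2 + llr (f z.2) z.1))%:E)) => //.
Qed.

(** Tonelli's theorem exchanges the data and the prior; each likelihood ratio has mean 1, which
    leaves the prior moment of exp(h). *)
Let Epsi3 : (\int[P]_om psi3 om <= C3%:E)%E.
Proof.
rewrite /psi3 (fubini_tonelli (fun z : Omega * S => (expR (h z.2 + llr (f z.2) z.1))%:E))//=.
apply: le_trans hC3; apply: ge0_le_integral => //.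
- by move=> t _; apply: integral_ge0 => om _; rewrite lee_fin expR_ge0.
- apply: (measurable_fun_fubini_tonelli_G (m1 := P)
    (fun z : Omega * S => (expR (h z.2 + llr (f z.2) z.1))%:E)) => //.
- by apply/measurable_EFinP; exact: measurableT_comp.
move=> t _; under eq_integral do rewrite expRD EFinM.
have mft : measurable_fun setT (f t).
  exact: (measurableT_comp mf (pair1_measurable t)).
rewrite ge0_integralZl//; last first.
  by apply/measurable_EFinP; apply: measurableT_comp => //; exact: measurable_llr.
by rewrite (expectation_likelihood_ratio model)// mule1.
Qed.

Let psi1 om : R := expR (\sum_(i < n) `|eps i om| / s) / (2 * expR (1 / 2)) ^+ n.

Let psi2 (c : R) om : R := expR (c * \sum_(i < n) eps i om * u fstar (X i om) / s ^+ 2) /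
  expR (n%:R * (V ^+ 2 / (2 * s ^+ 2))).

Let psi5 om : R := #|J|%:R^-1 *
  \sum_(j : J) expR (llr (g j) om / 2) * expR (n%:R * (1 - affinity s f0 (g j))).

Let integral_divr_le1 (F : Omega -> R) (c : R) : measurable_fun setT F ->
  (forall om, 0 <= F om) -> 0 < c ->
  (\int[P]_om (F om)%:E <= c%:E)%E -> (\int[P]_om (F om / c)%:E <= 1%:E)%E.
Proof.
move=> mF F0 c0 Fc; under eq_integral do rewrite mulrC EFinM.
rewrite ge0_integralZl//; last 3 first.
- exact/measurable_EFinP.
- by move=> om _; rewrite lee_fin.
- by rewrite lee_fin invr_ge0 ltW.
by rewrite lee_pdivrMl// mule1.
Qed.

Let mexp_noise : measurable_fun setT (fun om => expR (\sum_(i < n) `|eps i om| / s)).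
Proof.
apply: measurableT_comp => //; apply: measurable_sum => i.
by apply: measurable_funM => //; exact: measurableT_comp.
Qed.

Let mpsi1 : measurable_fun setT psi1.
Proof. exact: measurable_funM. Qed.

Let Epsi1 : (\int[P]_om (psi1 om)%:E <= 1%:E)%E.
Proof.
apply: (integral_divr_le1 mexp_noise) => [om||]; first exact: expR_ge0.
  by apply: exprn_gt0; rewrite mulr_gt0 ?expR_gt0.
apply: le_trans (sampling_expR_noise model s_gt0) _.
by rewrite prodEFin prodr_const card_ord.
Qed.

Let mexp_weighted c : measurable_fun setT
  (fun om => expR (c * \sum_(i < n) eps i om * u fstar (X i om) / s ^+ 2)).
Proof.
apply: measurableT_comp => //; apply: measurable_funM => //; apply: measurable_sum => i.
apply: measurable_funM => //; apply: measurable_funM => //.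
apply: (measurableT_comp (f := u fstar)) => //.
by apply: measurable_funB => //; exact: measurable_on_cube.
Qed.

Let mpsi2 c : measurable_fun setT (psi2 c).
Proof. exact: measurable_funM. Qed.

Let Epsi2 c : c ^+ 2 = 1 -> (\int[P]_om (psi2 c om)%:E <= 1%:E)%E.
Proof.
move=> c1; apply: (integral_divr_le1 (mexp_weighted c)) => [om||]; first exact: expR_ge0.
  exact: expR_gt0.
exact: (expectation_weighted_noise model).
Qed.

Let maff j : affinity s f0 (g j) <= expR (- (1 - affinity s f0 (g j))).
Proof. by apply: le_trans (expR_ge1Dx _); lra. Qed.

Let mpsi5 : measurable_fun setT psi5.
Proof.
apply: measurable_funM => //; apply: measurable_sum => j; apply: measurable_funM => //.
apply: measurableT_comp => //; apply: measurable_funM => //; exact: measurable_llr.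
Qed.

(** For an affinity a, the mean of each summand is a^n exp(n (1 - a)), at most 1 because a <=
    exp(-(1 - a)). *)
Let Epsi5 : (0 < #|J|)%N -> (\int[P]_om (psi5 om)%:E <= 1%:E)%E.
Proof.
move=> J0; rewrite /psi5; under eq_integral do rewrite mulrC.
have mj j : measurable_fun setT (fun om => expR (llr (g j) om / 2)).
  apply: measurableT_comp => //; apply: measurable_funM => //; exact: measurable_llr.
apply: integral_divr_le1; last 2 first.
- by rewrite ltr0n.
- under eq_integral do rewrite -sumEFin.
  rewrite ge0_integral_sum//; last first.
    by move=> j; apply/measurable_EFinP; exact: measurable_funM.
  apply: (@le_trans _ _ (\sum_(j : J) 1%:E)%E); last first.
    by rewrite sumEFin sumr_const.
  apply: lee_sum => j _; under eq_integral do rewrite mulrC EFinM.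
  rewrite ge0_integralZl//; last exact/measurable_EFinP.
  rewrite (expectation_sqrt_likelihood_ratio model)// -EFinM lee_fin.
  rewrite expRM_natl -exprMn; apply: exprn_ile1.
    by rewrite mulr_ge0 ?expR_ge0 ?affinity_ge0.
  rewrite mulrC -ler_pdivlMr ?expR_gt0// div1r -expRN; exact: maff.
- by apply: measurable_sum => j; exact: measurable_funM.
- by move=> om; apply: sumr_ge0 => j _; rewrite mulr_ge0 ?expR_ge0.
Qed.

Lemma good_event : (0 < #|J|)%N -> exists A : set Omega,
  [/\ measurable A, ((1 - 5 / n%:R)%:E <= P A)%E & forall om, A om -> good om].
Proof.
move=> J0; have n0 : 0 < n%:R :> R by rewrite ltr0n.
(* Each of the five statistics is scaled to have mean at most 1; their sum has mean at most 5 and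
   exceeds n with probability at most 5 / n. *)
pose F (k : 'I_5) : Omega -> \bar R := nth (cst 0%E)
  [:: EFin \o psi1; EFin \o psi2 1; EFin \o psi2 (-1);
      (fun om => (C3^-1)%:E * psi3 om)%E; EFin \o psi5] k.
have psi30 om : (0 <= psi3 om)%E by apply: integral_ge0 => t _; rewrite lee_fin expR_ge0.
have C30 : (0 <= (C3^-1)%:E :> \bar R)%E by rewrite lee_fin invr_ge0 ltW.
have F0 k om : (0 <= F k om)%E.
  case: k => -[|[|[|[|[|//]]]]] /= k5; rewrite /F/= ?lee_fin.
  - by rewrite divr_ge0 ?expR_ge0// exprn_ge0// mulr_ge0// expR_ge0.
  - by rewrite divr_ge0 ?expR_ge0.
  - by rewrite divr_ge0 ?expR_ge0.
  - exact: mule_ge0.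
  - by rewrite mulr_ge0// sumr_ge0// => j _; rewrite mulr_ge0 ?expR_ge0.
have mF k : measurable_fun setT (F k).
  case: k => -[|[|[|[|[|//]]]]] /= k5; rewrite /F/=; try exact/measurable_EFinP.
  exact: measurable_funeM.
have EF k : (\int[P]_om F k om <= 1%:E)%E.
  case: k => -[|[|[|[|[|//]]]]] /= k5; rewrite /F/=.
  - exact: Epsi1.
  - by apply: Epsi2; rewrite expr1n.
  - by apply: Epsi2; rewrite sqrrN expr1n.
  - by rewrite ge0_integralZl// lee_pdivrMl// mule1; exact: Epsi3.
  - exact: Epsi5.
pose Psi om := (\sum_(k < 5) F k om)%E.
have mPsi : measurable_fun setT Psi by apply: emeasurable_sum => k.
have Psi0 om : (0 <= Psi om)%E by apply: sume_ge0.
have EPsi : (\int[P]_om Psi om <= 5%:E)%E.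
  rewrite /Psi ge0_integral_sum//.
  apply: (@le_trans _ _ (\sum_(k < 5) 1%:E)%E); first by apply: lee_sum => k _; exact: EF.
  by rewrite sumEFin sumr_const card_ord.
have [mA PA] := probability_le_ge mPsi Psi0 n0 EPsi.
have [mC PC] := probability_cube.
exists ([set om | (Psi om <= n%:R%:E)%E] `&` [set om | forall i, cube p (X i om)]); split.
- exact: measurableI.
- apply: le_trans PA _; set A := [set om | _] in mA *; set C := [set om | _] in mC PC *.
  have nC : P (~` C) = 0%E by rewrite probability_setC// PC subee.
  have -> : P A = (P (A `&` C) + P (A `&` ~` C))%E.
    rewrite -measureU//; [by rewrite -setIUr setUv setIT|exact: measurableI| |].
      by apply: measurableI => //; exact: measurableC.
    by rewrite setIACA setIid setICr setI0.
  rewrite [X in (_ + X)%E](_ : _ = 0%E) ?adde0//.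
  apply/eqP; rewrite -measure_le0 -nC le_measure// ?inE//; last exact: measurableC.
  by apply: measurableI => //; exact: measurableC.
- move=> om [/= Psin Xc].
  have Fn k : (F k om <= n%:R%:E)%E.
    apply: le_trans Psin; rewrite /Psi (bigD1 k)//= leeDl//.
    by apply: sume_ge0.
  split => //.
  + have := Fn (@Ordinal 5 0 isT); rewrite /F/= lee_fin /psi1.
    rewrite ler_pdivrMr; last by apply: exprn_gt0; rewrite mulr_gt0 ?expR_gt0.
    (* Origin of the 3 in the noise bound: the normalisation contributes 2 n to the exponent and the
       threshold n <= exp(n) one more n. *)
    have e2 : 2 * expR (1 / 2) <= expR 2 :> R.
      have -> : expR 2 = expR (1 + 1 / 2) * expR (1 / 2) :> R.
        by rewrite -expRD; congr expR; lra.
      rewrite ler_pM2r ?expR_gt0//.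
      by have := @expR_ge1Dx R (1 + 1 / 2); lra.
    have en : n%:R <= expR n%:R :> R by have := @expR_ge1Dx R n%:R; lra.
    move=> H; have : expR (\sum_(i < n) `|eps i om| / s) <= expR (n%:R + n%:R * 2).
      apply: le_trans H _; rewrite expRD expRM_natl ler_pM//.
      by rewrite lerXn2r// nnegrE ?expR_ge0// mulr_ge0// expR_ge0.
    rewrite ler_expR -mulr_suml ler_pdivrMr//.
    by have -> : (n%:R + n%:R * 2) * s = 3 * n%:R * s by ring.
  + have nE : n%:R = expR (ln n%:R) :> R by rewrite lnK.
    have H1 := Fn (@Ordinal 5 1 isT); have H2 := Fn (@Ordinal 5 2 isT).
    move: H1 H2; rewrite /F/= !lee_fin /psi2 !ler_pdivrMr ?expR_gt0//.
    set q := n%:R * (V ^+ 2 / (2 * s ^+ 2)); rewrite {1 2}nE.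
    rewrite -!expRD !ler_expR mul1r mulN1r => H1 H2.
    by rewrite ler_norml; lra.
  + have := Fn (@Ordinal 5 3 isT); rewrite /F/= -/(psi3 om) => H.
    by rewrite EFinM muleC -lee_pdivrMl.
  + move=> j; have := Fn (@Ordinal 5 4 isT); rewrite /F/= lee_fin /psi5.
    have J1 : 0 < #|J|%:R :> R by rewrite ltr0n.
    rewrite ler_pdivrMl// => H.
    (* One term of the average is at most #|J| times the average: here the entropy of the net
       enters. It is doubled because the statistic contains the square root of the likelihood
       ratio. *)
    have : expR (llr (g j) om / 2) * expR (n%:R * (1 - affinity s f0 (g j))) <=
        expR (ln (n%:R * #|J|%:R)).
      rewrite lnK ?posrE ?mulr_gt0// mulrC [leRHS]mulrC; apply: le_trans H.
      rewrite mulrC (bigD1 j)//= lerDl; apply: sumr_ge0 => k _.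
      by apply: mulr_ge0; exact: expR_ge0.
    by rewrite -expRD ler_expR; lra.
Qed.

End good_event.

(** * Variational risk for a fixed sample size *)

Lemma ge0_integral_scale d (S : measurableType d) (R : realType)
    (q : {measure set S -> \bar R}) (c : R) (F : S -> R) :
  0 <= c -> measurable_fun setT F -> (forall x, 0 <= F x) ->
  (\int[q]_x (c * F x)%:E = c%:E * \int[q]_x (F x)%:E)%E.
Proof.
move=> c0 mF F0; under eq_integral do rewrite EFinM.
apply: ge0_integralZl => //; first exact/measurable_EFinP.
by move=> x _; rewrite lee_fin.
Qed.

Section posterior_bound.
Context (R : realType) (sigma : R -> R) (w : nat -> nat) (L : nat).
Hypothesis sigma_lip : 1.-lipschitz sigma.
Hypothesis w_gt0 : forall k, (0 < w k)%N.
Let T := nparams w L.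
Context d (Omega : measurableType d) (P : probability Omega R).
Variables (n : nat) (s : R).
Variables (X : 'I_n -> {RV P >-> (w 0).-tuple R}) (eps : 'I_n -> {RV P >-> R}).
Hypotheses (s_gt0 : 0 < s) (n_gt0 : (0 < n)%N).
Variable f0 : (w 0).-tuple R -> R.
Hypothesis mf0 : measurable_fun (cube (w 0)) f0.
Variables (lambda s0 : R).
Hypotheses (l01 : 0 < lambda < 1) (s0_gt0 : 0 < s0).
Variables (B V : R) (tstar : T.-tuple R).
Hypotheses (B_ge1 : 1 <= B) (V_ge0 : 0 <= V) (V_le1 : V <= 1).
Hypothesis tstarB : bounded_params B tstar.
Hypothesis tstarV : forall x, cube (w 0) x -> `|net sigma tstar x - f0 x| <= V.

Let prior := spike_slab_prior T lambda s0.

Local Notation llr := (log_likelihood_ratio s X eps f0).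
Local Notation u := (excess f0).

Definition net_lip b : R := 2 * L.+1%:R * net_growth sigma w b L.+1.

Let K := net_lip B.
(** One factor per loss: [K] converts a shift of parameters into a shift of the network, [n]
    compensates the sum over observations, and [T] the number of summands of [dist_exp]. *)
Let tau := (K * n%:R * T%:R)^-1.

Lemma nparams_gt0 : (0 < T)%N.
Proof. by rewrite /T /nparams addnS. Qed.

Let nR : 1 <= n%:R :> R. Proof. by rewrite ler1n. Qed.
Let TR : 1 <= T%:R :> R. Proof. by rewrite ler1n nparams_gt0. Qed.
Let LR : 1 <= L.+1%:R :> R. Proof. by rewrite ler1n. Qed.
Let s0_neq0 : s0 != 0. Proof. by rewrite gt_eqF. Qed.

Let K_ge : 2 * L.+1%:R <= K.
Proof. by rewrite /K ler_peMr ?net_growth_ge1// mulr_ge0. Qed.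

Let K_gt0 : 0 < K. Proof. by apply: lt_le_trans K_ge; rewrite mulr_gt0 ?ltr0n. Qed.

Let tau_gt0 : 0 < tau.
Proof.
rewrite invr_gt0; apply: mulr_gt0; last by rewrite ltr0n nparams_gt0.
by apply: mulr_gt0 => //; rewrite ltr0n.
Qed.

Let tauK : tau * K = (n%:R * T%:R)^-1.
Proof.
rewrite /tau -mulrA invfM mulrAC mulVf ?mul1r// gt_eqF//.
Qed.

Let nT_ge1 : 1 <= n%:R * T%:R :> R. Proof. by rewrite -[leLHS]mulr1 ler_pM. Qed.

Let tauL : L.+1%:R * tau <= 1.
Proof.
have : tau * (2 * L.+1%:R) <= tau * K by rewrite ler_pM2l.
rewrite tauK; have : (n%:R * T%:R)^-1 <= 1 :> R by rewrite invf_le1// (lt_le_trans ltr01).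
move: tau_gt0 LR => *; lra.
Qed.

Let tau_le1 : tau <= 1.
Proof. by apply: le_trans tauL; rewrite ler_peMl// ltW. Qed.

(** A sum replaces the maximal deviation so that its mean under a product law can be computed
    coordinate by coordinate. If m is the largest rescaled deviation, the network moves by a
    multiple of m exp(m) <= exp(2 m), and the square of this is at most exp(4 m): hence the 4. *)
Definition dist_exp (theta : T.-tuple R) : R :=
  \sum_(i < T) expR (4 * `|(tnth theta i - tnth tstar i) / tau|).

Let net_growth_shift y : 0 <= y ->
  net_growth sigma w (B + y) L.+1 <= net_growth sigma w B L.+1 * expR (L.+1%:R * y).
Proof.
move=> y0; rewrite /net_growth [leRHS]mulrAC ler_wpM2r ?prodr_ge0//.
have k0 : 0 <= `|sigma 0| + 2 by rewrite addr_ge0.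
rewrite expRM_natl -exprMn lerXn2r ?nnegrE ?mulr_ge0 ?expR_ge0//.
- by rewrite addr_ge0// (le_trans ler01).
- by rewrite (le_trans ler01).
rewrite -mulrA ler_wpM2l//; apply: (@le_trans _ _ (B * (1 + y))).
  by rewrite mulrDr mulr1 lerD2l ler_peMl.
by rewrite ler_wpM2l ?expR_ge1Dx// (le_trans ler01).
Qed.

(* The parameters of [theta] may exceed the bound [B], which costs a factor
   [exp ((L + 1) |theta - tstar|)] in the Lipschitz constant; the scale [tau] is
   small enough for it to be absorbed by the exponentials of [dist_exp]. *)
Lemma net_close_star theta x : cube (w 0) x ->
  exists2 delta, 0 <= delta &
    [/\ `|net sigma theta x - net sigma tstar x| <= delta,
        delta <= tau * K * dist_exp theta &
        delta ^+ 2 <= (tau * K) ^+ 2 * dist_exp theta].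
Proof.
move=> xc.
pose z i := `|(tnth theta i - tnth tstar i) / tau|.
pose i0 : 'I_T := Ordinal nparams_gt0.
have [i1 zmax] : exists i1, forall i, z i <= z i1.
  exists [arg max_(i > i0) z i]%O.
  by case: Order.TotalTheory.arg_maxP => // i _ H j; exact: H.
set m := z i1 in zmax.
have m0 : 0 <= m by exact: normr_ge0.
have mE : expR (4 * m) <= dist_exp theta.
  by rewrite /dist_exp (bigD1 i1)//= lerDl sumr_ge0// => i _; exact: expR_ge0.
have em : m <= expR m by have := @expR_ge1Dx R m; lra.
have tm : 0 <= tau * m by apply: mulr_ge0 => //; exact: ltW.
have close i : `|tnth theta i - tnth tstar i| <= tau * m.
  have := zmax i; rewrite /z normrM normfV (gtr0_norm tau_gt0).
  by rewrite ler_pdivrMr// mulrC.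
have Bt : bounded_params (B + tau * m) theta.
  move=> i; have := ler_normD (tnth tstar i) (tnth theta i - tnth tstar i).
  rewrite addrC subrK; have := close i; have := tstarB i; lra.
have Bs : bounded_params (B + tau * m) tstar.
  by move=> i; apply: le_trans (tstarB i) _; rewrite lerDl.
have B1 : 1 <= B + tau * m by rewrite (le_trans B_ge1)// lerDl.
have tK : 0 <= tau * K by apply: mulr_ge0; exact: ltW.
have me2 : m * expR m <= expR (2 * m).
  have -> : 2 * m = m + m by ring.
  by rewrite expRD ler_wpM2r ?expR_ge0.
have me0 : 0 <= m * expR m by apply: mulr_ge0 => //; exact: expR_ge0.
exists (tau * K * (m * expR m)); first exact: mulr_ge0.
split.
- apply: le_trans (net_close sigma_lip w_gt0 B1 tm Bt Bs xc close) _.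
  have -> : tau * K * (m * expR m) =
    2 * L.+1%:R * (tau * m) * (net_growth sigma w B L.+1 * expR m).
    by rewrite /K /net_lip; ring.
  apply: ler_wpM2l; first by apply: mulr_ge0 => //; exact: mulr_ge0.
  apply: le_trans (net_growth_shift tm) _; apply: ler_wpM2l.
    by apply: le_trans ler01 _; exact: net_growth_ge1.
  by rewrite ler_expR mulrA ler_piMl.
- apply: ler_wpM2l => //; apply: le_trans me2 _; apply: le_trans mE.
  by rewrite ler_expR; lra.
- rewrite exprMn ler_wpM2l ?exprn_ge0//; apply: le_trans mE.
  have -> : expR (4 * m) = expR (2 * m) ^+ 2 by rewrite -expRM_natl; congr expR; ring.
  by rewrite lerXn2r ?nnegrE ?expR_ge0.
Qed.

Definition slack_rate : R := (1 + 3 * s) / s ^+ 2 + 1 / s0 ^+ 2.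

Let slack theta := slack_rate / T%:R * dist_exp theta.

(** The constant part c of the density bound. The bias occurs three times: twice from (b + D)^2 <= 2
    b^2 + 2 D^2 in the squared excess, and once, together with [ln n], from the weighted noise. *)
Definition fit_cost : R :=
  - T%:R * ln (1 - lambda)
  + (norm0 tstar)%:R * (- ln lambda + ln (s0 / tau) + B ^+ 2 / s0 ^+ 2)
  + 3 * (n%:R * (V ^+ 2 / (2 * s ^+ 2))) + ln n%:R.

Let dist_exp_ge0 theta : 0 <= dist_exp theta.
Proof. by apply: sumr_ge0 => i _; exact: expR_ge0. Qed.

Let slack_rate_ge0 : 0 <= slack_rate.
Proof.
apply: addr_ge0; apply: divr_ge0 => //; try exact: sqr_ge0.
by apply: addr_ge0 => //; apply: mulr_ge0 => //; exact: ltW.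
Qed.

Variable om : Omega.
Hypothesis Xc : forall i, cube (w 0) (X i om).
Hypothesis noise_le : \sum_(i < n) `|eps i om| <= 3 * n%:R * s.
Hypothesis weighted_noise_le :
  `|\sum_(i < n) eps i om * u (net sigma tstar) (X i om) / s ^+ 2| <=
    n%:R * (V ^+ 2 / (2 * s ^+ 2)) + ln n%:R.

Let tstar_excess x : cube (w 0) x -> `|u (net sigma tstar) x| <= V.
Proof. by move=> xc; rewrite /excess /on_cube patchE mem_set//; exact: tstarV. Qed.

Let opp_llr_le_slack theta :
  - llr (net sigma theta) om <=
  3 * (n%:R * (V ^+ 2 / (2 * s ^+ 2))) + ln n%:R
  + (1 + 3 * s) / s ^+ 2 / T%:R * dist_exp theta.
Proof.
have s2 : 0 < s ^+ 2 by exact: exprn_gt0.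
have T0 : 0 < T%:R :> R by exact: lt_le_trans TR.
have n0 : 0 < n%:R :> R by exact: lt_le_trans nR.
pose E := dist_exp theta.
have E0 : 0 <= E by exact: dist_exp_ge0.
(* The deviation produced by [net_close_star] depends on the input; the minimum of its two bounds is
   valid for all inputs at once, and its square is still linear in [dist_exp]. *)
pose delta := Num.min (tau * K * E) (Num.sqrt ((tau * K) ^+ 2 * E)).
have d0 : 0 <= delta.
  rewrite le_min sqrtr_ge0 andbT; apply: mulr_ge0 => //; apply: mulr_ge0; exact: ltW.
have dE : delta <= tau * K * E by rewrite ge_min lexx.
have d2E : delta ^+ 2 <= (tau * K) ^+ 2 * E.
  rewrite -[leRHS]sqr_sqrtr; last by apply: mulr_ge0 => //; exact: sqr_ge0.
  by rewrite lerXn2r ?nnegrE ?sqrtr_ge0// ge_min lexx orbT.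
have close x : cube (w 0) x -> `|net sigma theta x - net sigma tstar x| <= delta.
  move=> xc; have [e e0 [H1 H2 H3]] := net_close_star theta xc.
  rewrite le_min (le_trans H1 H2)/=; apply: le_trans H1 _.
  by rewrite -[leLHS]ger0_norm// -sqrtr_sqr ler_wsqrtr.
apply: le_trans (opp_llr_le eps s_gt0 Xc d0 V_ge0 close tstar_excess) _.
have Z : - \sum_(i < n) eps i om * u (net sigma tstar) (X i om) / s ^+ 2 <=
    n%:R * (V ^+ 2 / (2 * s ^+ 2)) + ln n%:R.
  apply: le_trans weighted_noise_le; rewrite -normrN; exact: ler_norm.
have nTi : (n%:R * T%:R)^-1 <= 1 :> R by rewrite invf_le1// (lt_le_trans ltr01).
have nTi0 : 0 < (n%:R * T%:R)^-1 :> R by rewrite invr_gt0 mulr_gt0.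
have A1 : n%:R * delta ^+ 2 <= E / T%:R.
  have : n%:R * delta ^+ 2 <= n%:R * ((tau * K) ^+ 2 * E) by rewrite ler_wpM2l.
  move=> H; apply: le_trans H _; rewrite tauK.
  have -> : n%:R * ((n%:R * T%:R)^-1 ^+ 2 * E) = (E / T%:R) * (n%:R * T%:R)^-1.
    by field; rewrite !gt_eqF.
  by rewrite ler_piMr// divr_ge0// ltW.
have A2 : delta * (\sum_(i < n) `|eps i om|) <= 3 * s * E / T%:R.
  apply: (@le_trans _ _ (tau * K * E * (3 * n%:R * s))).
    apply: ler_pM => //; first by apply: sumr_ge0.
  rewrite tauK le_eqVlt; apply/orP; left; apply/eqP; field.
  by rewrite !gt_eqF.
have A3 : n%:R * (delta ^+ 2 + V ^+ 2) / s ^+ 2 =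
    n%:R * delta ^+ 2 / s ^+ 2 + 2 * (n%:R * (V ^+ 2 / (2 * s ^+ 2))).
  by field; rewrite gt_eqF.
have A4 : n%:R * delta ^+ 2 / s ^+ 2 + delta * (\sum_(i < n) `|eps i om|) / s ^+ 2 <=
    (1 + 3 * s) / s ^+ 2 / T%:R * E.
  rewrite -mulrDl.
  have -> : (1 + 3 * s) / s ^+ 2 / T%:R * E = (E / T%:R + 3 * s * E / T%:R) / s ^+ 2.
    by field; rewrite !gt_eqF.
  by rewrite ler_pM2r ?invr_gt0// lerD.
rewrite A3; move: A4 Z; rewrite -/E; lra.
Qed.

(** With z the rescaled deviation, theta_i^2 <= 2 B^2 + 2 tau^2 z^2; then tau^2 <= 1 / T and z^2 <=
    exp(4 |z|) put the second part into [dist_exp]. *)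
Let sqr_le_dist theta :
  \sum_(i < T | tnth tstar i != 0) tnth theta i ^+ 2 / (2 * s0 ^+ 2) <=
  (norm0 tstar)%:R * (B ^+ 2 / s0 ^+ 2) + 1 / s0 ^+ 2 / T%:R * dist_exp theta.
Proof.
have s2 : 0 < s0 ^+ 2 by exact: exprn_gt0.
have T0 : 0 < T%:R :> R by exact: lt_le_trans TR.
have tauT : tau ^+ 2 <= T%:R^-1.
  apply: (@le_trans _ _ tau).
    by rewrite expr2 ler_piMr// ltW.
  rewrite /tau invfM ler_piMl ?invr_ge0 ?ler0n//.
  rewrite invf_le1; last by apply: mulr_gt0 => //; exact: lt_le_trans nR.
  rewrite -[leLHS]mulr1; apply: ler_pM => //.
  apply: le_trans K_ge; rewrite -[leLHS]mulr1; apply: ler_pM => //; by rewrite ler1n.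
rewrite norm0E mulr_suml /dist_exp mulr_sumr -big_split/= big_mkcond/=.
apply: ler_sum => i _.
set e := expR _; have e0 : 0 <= e by exact: expR_ge0.
have r0 : 0 <= 1 / s0 ^+ 2 / T%:R * e.
  by apply: mulr_ge0 => //; apply: divr_ge0; [apply: divr_ge0 => //; exact: ltW|exact: ltW].
case: ifP => _; last by rewrite mul0r add0r.
rewrite [true%:R * _]mul1r.
set z := (tnth theta i - tnth tstar i) / tau.
have zE : tnth theta i = tnth tstar i + tau * z.
  by rewrite /z mulrC divfK ?gt_eqF// addrC subrK.
have z2 : z ^+ 2 <= e.
  rewrite -[leLHS]real_normK ?num_real// /e -/z.
  have -> : 4 * `|z| = 2%:R * (2 * `|z|) by ring.
  rewrite expRM_natl lerXn2r ?nnegrE ?expR_ge0//.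
  have := @expR_ge1Dx R (2 * `|z|); have := normr_ge0 z; lra.
have H1 : tnth theta i ^+ 2 <= 2 * B ^+ 2 + 2 * (tau ^+ 2 * z ^+ 2).
  have : tnth tstar i ^+ 2 <= B ^+ 2.
    by rewrite -[leLHS]real_normK ?num_real// lerXn2r ?nnegrE// (le_trans ler01).
  have := sqr_ge0 (tnth tstar i - tau * z); rewrite zE.
  rewrite -exprMn; set a := tnth tstar i; set b := tau * z; nra.
have H2 : tau ^+ 2 * z ^+ 2 <= T%:R^-1 * e.
  by apply: ler_pM => //; exact: sqr_ge0.
have -> : B ^+ 2 / s0 ^+ 2 + 1 / s0 ^+ 2 / T%:R * e =
  (2 * B ^+ 2 + 2 * (T%:R^-1 * e)) / (2 * s0 ^+ 2).
  by field; rewrite !gt_eqF.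
rewrite ler_pM2r ?invr_gt0 ?mulr_gt0//; lra.
Qed.

Lemma spike_slab_ratio_le_lik theta :
  \prod_(i < T) spike_slab_ratio lambda s0 tau (tnth tstar i) (tnth theta i) <=
  expR (fit_cost + slack theta + llr (net sigma theta) om).
Proof.
apply: le_trans (spike_slab_ratio_prod_le _ _ l01 s0_gt0 tau_gt0) _.
rewrite ler_expR.
have := opp_llr_le_slack theta; have := sqr_le_dist theta.
have -> : slack theta = (1 + 3 * s) / s ^+ 2 / T%:R * dist_exp theta +
    1 / s0 ^+ 2 / T%:R * dist_exp theta.
  by rewrite /slack /slack_rate; ring.
rewrite /fit_cost; lra.
Qed.

Let post := posterior s (fun i => X i om) (fun i => f0 (X i om) + eps i om)
  sigma_lip prior.

Let lik0 := \prod_(i < n) normal_pdf 0 s (eps i om).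

Let lik0_gt0 : 0 < lik0.
Proof. by apply: prodr_gt0 => i _; apply: normal_pdf_gt0; rewrite gt_eqF. Qed.

Let likE (theta : T.-tuple R) : likelihood (L := L) sigma s (fun i => X i om)
    (fun i => f0 (X i om) + eps i om) theta =
  lik0 * expR (llr (net (L := L) sigma theta) om).
Proof. exact: prod_normal_pdf_excess. Qed.

Let fit : probability (T.-tuple R) R := product_law (fun i =>
  real_law (spike_slab (tnth tstar i != 0)%:R (tnth tstar i) tau)).

Let mdist : measurable_fun setT (fun theta : T.-tuple R => dist_exp theta).
Proof.
apply: measurable_sum => i; apply: measurableT_comp => //; apply: measurable_funM => //.
apply: measurableT_comp => //; apply: measurable_funM => //.
by apply: measurable_funB => //; exact: measurable_tnth.
Qed.

(** Each of the T exponentials has mean at most 2 exp(4^2 / 2), and the factor 1 / T of [slack]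
    leaves a constant free of n. The atom of an inactive coordinate sits at its centre, as the
    moment bound requires. *)
Let integral_slack :
  (\int[fit]_theta (slack theta)%:E <= (slack_rate * (2 * expR 8))%:E)%E.
Proof.
have T0 : 0 < T%:R :> R by exact: lt_le_trans TR.
have c0 : 0 <= slack_rate / T%:R by apply: divr_ge0 => //; exact: ltW.
rewrite /slack; under eq_integral do rewrite EFinM.
rewrite ge0_integralZl//; last 2 first.
- exact/measurable_EFinP.
- by move=> theta _; rewrite lee_fin.
have -> : slack_rate * (2 * expR 8) = slack_rate / T%:R * (T%:R * (2 * expR 8)).
  by field; rewrite gt_eqF.
rewrite [leRHS]EFinM; apply: lee_wpmul2l; first by rewrite lee_fin.
rewrite /dist_exp; under eq_integral do rewrite -sumEFin.
have mz i : measurable_fun setT (fun x : R => expR (4 * `|(x - tnth tstar i) / tau|) : R).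
  apply: measurableT_comp => //; apply: measurable_funM => //.
  apply: measurableT_comp => //; apply: measurable_funM => //.
  exact: measurable_funB.
rewrite ge0_integral_sum//; last first.
  move=> i; apply/measurable_EFinP.
  exact: (measurableT_comp (mz i) (measurable_tnth i)).
have -> : T%:R * (2 * expR 8) = \sum_(i < T) (2 * expR 8) :> R.
  by rewrite sumr_const card_ord mulr_natl.
rewrite -sumEFin; apply: lee_sum => i _.
rewrite (integral_product_law_tnth _ i (mz i)); last by move=> x; exact: expR_ge0.
have -> : 2 * expR 8 = 2 * expR (4 ^+ 2 / 2) :> R by congr (_ * expR _); lra.
apply: spike_slab_expR_norm_le.
- by case: (tnth tstar i != 0); rewrite ?lexx ?ler01.
- by rewrite gt_eqF.
- by case: (tnth tstar i =P 0) => //= _; rewrite eqxx.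
Qed.

Let mnet : measurable_fun setT
  (fun z : T.-tuple R * (w 0).-tuple R => net (L := L) sigma z.1 z.2).
Proof. exact: measurable_net_comp. Qed.

Let mllr : measurable_fun setT (fun theta : T.-tuple R => llr (net (L := L) sigma theta) om).
Proof.
exact: (measurableT_comp (measurable_llr_joint s X eps mf0 mnet) (pair1_measurable om)).
Qed.

Variable qhat : probability (T.-tuple R) R.
Hypothesis qhatP : is_variational_posterior post qhat.

Definition fit_bound : R := fit_cost + slack_rate * (2 * expR 8).

(** The posterior is built from the likelihood, which is [lik0] times the likelihood ratio. As
    [lik0] is free of theta, its logarithm cancels between the cost [fit_cost - ln lik0] and the
    moment [lik0 * M]. *)
Lemma variational_integral_le (h : T.-tuple R -> R) (M : R) :
  measurable_fun setT h -> (forall theta, 0 <= h theta) -> 0 < M ->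
  (\int[prior]_theta (expR (h theta + llr (net (L := L) sigma theta) om))%:E <= M%:E)%E ->
  (\int[qhat]_theta (h theta)%:E <= (fit_bound + ln M)%:E)%E.
Proof.
move=> mh h0 M0 hM; have [qf qmin] := qhatP.
have fitF : variational_family fit.
  exists (fun i => (tnth tstar i != 0)%:R), (tnth tstar), (fun=> tau); split => // i.
  by case: (tnth tstar i != 0); rewrite ?lexx ?ler01.
have sneq0 : s != 0 by rewrite gt_eqF.
pose lik := likelihood (L := L) sigma s (fun i => X i om) (fun i => f0 (X i om) + eps i om).
have lik_gt0 theta : 0 < lik theta by rewrite /lik likE mulr_gt0// expR_gt0.
have lik_le theta : lik theta <= normal_peak s ^+ n.
  rewrite /lik /likelihood -[n in leRHS]card_ord -prodr_const.
  by apply: ler_prod => i _; rewrite normal_pdf_ge0 normal_pdf_ub.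
have ml01 : 0 <= lambda <= 1 by case/andP: l01 => ? ?; rewrite !ltW.
pose rho (theta : T.-tuple R) : R :=
  \prod_(i < T) spike_slab_ratio lambda s0 tau (tnth tstar i) (tnth theta i).
have mrho : measurable_fun setT rho.
  apply: measurable_prod => i _.
  apply: (measurableT_comp (f := spike_slab_ratio lambda s0 tau (tnth tstar i))).
    exact: measurable_spike_slab_ratio.
  exact: measurable_tnth.
have fitE A : measurable A -> fit A = (\int[prior]_(theta in A) (rho theta)%:E)%E.
  move=> mA; apply: (product_law_density
    (mu := fun=> real_law (spike_slab lambda 0 s0))
    (g := fun i => spike_slab_ratio lambda s0 tau (tnth tstar i))) => //.
  - by move=> i; exact: measurable_spike_slab_ratio.
  - by move=> i x; exact: spike_slab_ratio_ge0.
  - by move=> i C mC; exact: spike_slab_ratioE.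
have := @variational_posterior_bound _ _ R prior lik
  (measurable_likelihood s (fun i => X i om) (fun i => f0 (X i om) + eps i om) sigma_lip)
  (likelihood_ge0 sigma s (fun i => X i om) (fun i => f0 (X i om) + eps i om))
  lik_gt0 _ lik_le fit qhat rho (fit_cost - ln lik0) slack h (lik0 * M) mrho.
have mslack : measurable_fun setT slack by exact: measurable_funM.
move=> /(_ mslack mh).
have rho0 theta : 0 <= rho theta.
  by apply: prodr_ge0 => i _; exact: spike_slab_ratio_ge0.
have slack0 theta : 0 <= slack theta.
  by apply: mulr_ge0 => //; apply: divr_ge0.
move=> /(_ rho0 slack0 h0 fitE).
have rho_le theta : rho theta <= expR (fit_cost - ln lik0 + slack theta) * lik theta.
  rewrite /lik likE.
  have -> : expR (fit_cost - ln lik0 + slack theta) * (lik0 * expR (llr (net sigma theta) om)) =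
      expR (fit_cost + slack theta + llr (net sigma theta) om).
    by rewrite -{2}(lnK lik0_gt0) -!expRD; congr expR; ring.
  exact: spike_slab_ratio_le_lik.
move=> /(_ rho_le (qmin _ fitF)).
have hM' : (\int[prior]_theta (expR (h theta) * lik theta)%:E <= (lik0 * M)%:E)%E.
  have E theta : (expR (h theta) * lik theta)%:E =
      (lik0%:E * (expR (h theta + llr (net sigma theta) om))%:E)%E.
    by rewrite -EFinM /lik likE expRD; congr (_%:E); ring.
  under eq_integral do rewrite E.
  rewrite ge0_integralZl//; last 2 first.
  - by apply/measurable_EFinP; apply: measurableT_comp => //; exact: measurable_funD.
  - by rewrite lee_fin ltW.
  by rewrite EFinM lee_wpmul2l// lee_fin ltW.
move=> /(_ hM') /le_trans; apply.
rewrite lnM ?posrE//.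
apply: (@le_trans _ _ ((fit_cost - ln lik0)%:E + (slack_rate * (2 * expR 8))%:E + (ln lik0 + ln M)%:E)%E).
  by apply: leeD2r; apply: leeD2l.
by rewrite -!EFinD lee_fin /fit_bound; lra.
Qed.

Variables (a b : R) (sn : nat).
Hypotheses (a_gt0 : 0 < a) (b_geB : B <= b).

(* With [a = kappa H] the factor [lambda] of the prior compensates [exp a], so
   that the prior exponential moment of the penalty stays bounded. *)
Definition sparsity_penalty (theta : T.-tuple R) : R :=
  a * (norm0 theta)%:R + \sum_(i < T) tnth theta i ^+ 2 / (4 * s0 ^+ 2).

(* On the sieve, moving [theta] by the mesh changes the log-likelihood ratio and
   [2 n d2] by at most 1 in total. *)
Definition net_mesh : R :=
  s ^+ 2 / (net_lip b * (n%:R * (3 * s + 6 * net_growth sigma w b L.+1))).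

Variable C3 : R.
Hypothesis C3_gt0 : 0 < C3.
Hypothesis penalty_le :
  (\int[prior]_theta (expR (sparsity_penalty theta + llr (net (L := L) sigma theta) om))%:E
    <= (n%:R * C3)%:E)%E.
Hypothesis net_le : forall c : net_code T sn b net_mesh,
  llr (net (L := L) sigma (net_point c)) om
  + 2 * n%:R * (1 - affinity s f0 (net (L := L) sigma (net_point c))) <=
  2 * ln (n%:R * #|net_code T sn b net_mesh|%:R).

Let growth := net_growth sigma w b L.+1.

Let b_ge1 : 1 <= b. Proof. exact: le_trans b_geB. Qed.

Let growth_ge1 : 1 <= growth. Proof. exact: net_growth_ge1. Qed.

Let growth_B : net_growth sigma w B L.+1 <= growth.
Proof.
rewrite /growth /net_growth ler_wpM2r ?prodr_ge0// lerXn2r// ?nnegrE.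
- by apply: mulr_ge0; [exact: addr_ge0|exact: le_trans ler01 B_ge1].
- by apply: mulr_ge0; [exact: addr_ge0|exact: le_trans ler01 b_ge1].
- by apply: ler_wpM2l => //; exact: addr_ge0.
Qed.

(** The size of [f0] is controlled through [tstar], whose network is within V <= 1 of [f0] and is
    itself at most [growth]. *)
Let excess_bound theta x : bounded_params b theta -> cube (w 0) x ->
  `|u (net (L := L) sigma theta) x| <= 3 * growth.
Proof.
move=> tb xc.
have H1 := net_bound sigma_lip w_gt0 b_ge1 tb xc.
have H2 := net_bound sigma_lip w_gt0 B_ge1 tstarB xc.
have H3 := tstar_excess xc.
have -> : u (net (L := L) sigma theta) x =
  net sigma theta x - net sigma tstar x + u (net sigma tstar) x.
  by rewrite /excess; ring.
have := ler_normD (net sigma theta x - net sigma tstar x) (u (net sigma tstar) x).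
have := ler_normB (net sigma theta x) (net sigma tstar x).
move: H1 H2 H3 growth_B growth_ge1 V_le1; rewrite -/growth; lra.
Qed.

Let mesh_gt0 : 0 < net_mesh.
Proof.
have g0 : 0 < growth by exact: lt_le_trans growth_ge1.
apply: divr_gt0; first exact: exprn_gt0.
apply: mulr_gt0; first by apply: mulr_gt0 => //; apply: mulr_gt0.
apply: mulr_gt0; first by rewrite ltr0n.
by apply: addr_gt0; apply: mulr_gt0.
Qed.

Lemma sieve_llr_le theta : (norm0 theta <= sn)%N -> bounded_params b theta ->
  llr (net (L := L) sigma theta) om +
  2 * n%:R * (1 - affinity s f0 (net (L := L) sigma theta)) <=
  2 * ln (n%:R * #|net_code T sn b net_mesh|%:R) + 1.
Proof.
move=> ts tb.
have b0 : 0 <= b by exact: le_trans b_ge1.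
have [c cP] := sparse_net mesh_gt0 nparams_gt0 ts tb.
have cb : bounded_params b (net_point c) by exact: net_point_bounded.
have n0 : 0 < n%:R :> R by rewrite ltr0n.
have g0 : 0 < growth by exact: lt_le_trans growth_ge1.
have q0 : 0 < 3 * s + 6 * growth by apply: addr_gt0; apply: mulr_gt0.
have lip0 : 0 < net_lip b.
  by apply: mulr_gt0 => //; apply: mulr_gt0 => //; rewrite ltr0n.
pose delta := net_lip b * net_mesh.
have dE : delta = s ^+ 2 / (n%:R * (3 * s + 6 * growth)).
  by rewrite /delta /net_mesh -/growth; field; rewrite !gt_eqF.
have d0 : 0 <= delta by apply: mulr_ge0; exact: ltW.
have close x : cube (w 0) x ->
    `|net sigma theta x - net sigma (net_point c) x| <= delta.
  move=> xc; apply: le_trans (net_close sigma_lip w_gt0 b_ge1 (ltW mesh_gt0) tb cb xc cP) _.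
  by rewrite /delta /net_lip le_eqVlt; apply/orP; left; apply/eqP; ring.
have mf (theta' : T.-tuple R) : measurable_fun setT (net (L := L) sigma theta').
  exact: (measurableT_comp mnet (pair1_measurable theta')).
have g30 : 0 <= 3 * growth by apply: mulr_ge0 => //; exact: ltW.
have L1 := llr_close eps s_gt0 Xc d0 close
  (fun x => excess_bound tb) (fun x => excess_bound cb).
have L2 := affinity_close s_gt0 mf0 (mf theta) (mf (net_point c)) d0 g30 close
  (fun x => excess_bound tb) (fun x => excess_bound cb).
have L3 := net_le c.
have E1 : delta * (\sum_(i < n) `|eps i om| + n%:R * (3 * growth)) / s ^+ 2 <=
    delta * (3 * n%:R * s + n%:R * (3 * growth)) / s ^+ 2.
  rewrite ler_pM2r ?invr_gt0 ?exprn_gt0//; apply: ler_wpM2l => //; exact: lerD.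
have E2 : 2 * n%:R * affinity s f0 (net (L := L) sigma (net_point c)) <=
    2 * n%:R * affinity s f0 (net (L := L) sigma theta) +
    2 * n%:R * (delta * (3 * growth) / (4 * s ^+ 2)).
  by rewrite -mulrDr; apply: ler_wpM2l => //; apply: mulr_ge0 => //; exact: ltW.
(* The log-ratio contributes 3 s + 3 growth and the affinity 3/2 growth; the 6 in [net_mesh] exceeds
   9/2, so the total error is below 1. *)
have E3 : delta * (3 * n%:R * s + n%:R * (3 * growth)) / s ^+ 2 +
    2 * n%:R * (delta * (3 * growth) / (4 * s ^+ 2)) =
    (3 * s + 9 / 2 * growth) / (3 * s + 6 * growth).
  by rewrite dE; field; rewrite !gt_eqF.
have E4 : (3 * s + 9 / 2 * growth) / (3 * s + 6 * growth) <= 1.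
  rewrite ler_pdivrMr// mul1r; lra.
lra.
Qed.

Let D (theta : T.-tuple R) : R := 1 - affinity s f0 (net (L := L) sigma theta).

Let mD : measurable_fun setT D.
Proof. by apply: measurable_funB => //; exact: measurable_affinity. Qed.

Let D_ge0 theta : 0 <= D theta.
Proof. by rewrite subr_ge0; exact: (affinity_le1 s mnet mf0). Qed.

Let D_le1 theta : D theta <= 1.
Proof. by rewrite gerBl affinity_ge0. Qed.

Let sieve (theta : T.-tuple R) : bool :=
  (norm0 theta <= sn)%N && (\sum_(i < T) tnth theta i ^+ 2 <= b ^+ 2).

Let sieve_bounded theta : sieve theta -> bounded_params b theta.
Proof.
move=> /andP[_ H] i; have b0 : 0 <= b by exact: le_trans b_ge1.
rewrite -(ger0_norm b0) -ler_sqr ?nnegrE// !real_normK ?num_real//.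
apply: le_trans H; rewrite (bigD1 i)//= lerDl; apply: sumr_ge0 => j _; exact: sqr_ge0.
Qed.

Let msumsq : measurable_fun setT (fun theta : T.-tuple R => \sum_(i < T) tnth theta i ^+ 2).
Proof.
by apply: measurable_sum => i; apply: measurable_funX; exact: measurable_tnth.
Qed.

Let msieve : measurable_fun setT sieve.
Proof.
apply: measurable_and; last exact: measurable_fun_ler.
rewrite (_ : (fun _ => _) = (fun theta : T.-tuple R => (norm0 theta)%:R <= sn%:R :> R)).
  apply: measurable_fun_ler => //; exact: measurable_norm0.
by apply/funext => theta; rewrite ler_nat.
Qed.

Definition penalty_bound : R := fit_bound + ln (n%:R * C3).

Definition risk_bound : R :=
  fit_bound + ln (expR (2 * ln (n%:R * #|net_code T sn b net_mesh|%:R) + 1) + n%:R * C3).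

Let mpenalty : measurable_fun setT sparsity_penalty.
Proof.
apply: measurable_funD.
  by apply: measurable_funM => //; exact: measurable_norm0.
apply: measurable_sum => i; apply: measurable_funM => //; apply: measurable_funX.
exact: measurable_tnth.
Qed.

Let sumsq_ge0 theta : 0 <= \sum_(i < T) tnth theta i ^+ 2 / (4 * s0 ^+ 2).
Proof.
apply: sumr_ge0 => i _; apply: divr_ge0; first exact: sqr_ge0.
by apply: mulr_ge0 => //; exact: sqr_ge0.
Qed.

Let penalty_ge0 theta : 0 <= sparsity_penalty theta.
Proof. by apply: addr_ge0 => //; apply: mulr_ge0 => //; exact: ltW. Qed.

Lemma integral_penalty_le :
  (\int[qhat]_theta (sparsity_penalty theta)%:E <= penalty_bound%:E)%E.
Proof.
apply: variational_integral_le => //.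
by apply: mulr_gt0 => //; rewrite ltr0n.
Qed.

(** On the sieve the integrand is bounded through the net. Off the sieve h is 0 and the likelihood
    ratio is at most exp(penalty) times itself, so the moment already bounded for the penalty covers
    this part as well. *)
Lemma integral_sieve_risk_le :
  (\int[qhat]_theta (2 * n%:R * (D theta * (sieve theta)%:R))%:E <= risk_bound%:E)%E.
Proof.
have n2 : 0 <= 2 * n%:R :> R by [].
have mb : measurable_fun setT (fun theta => (sieve theta)%:R : R).
  rewrite (_ : (fun _ => _) = (fun theta => if sieve theta then 1 else 0)).
    exact: measurable_fun_ifT.
  by apply/funext => theta; case: sieve.
have n0 : 0 < n%:R :> R by rewrite ltr0n.
rewrite /risk_bound; set S := 2 * ln (n%:R * #|net_code T sn b net_mesh|%:R) + 1.
apply: variational_integral_le.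
- by apply: measurable_funM => //; exact: measurable_funM.
- by move=> theta; apply: mulr_ge0 => //; apply: mulr_ge0.
- by apply: addr_gt0; [exact: expR_gt0|exact: mulr_gt0].
have pT : prior setT = 1%E by exact: probability_setT.
apply: (@le_trans _ _ (\int[prior]_theta ((cst (expR S)%:E theta) +
   (expR (sparsity_penalty theta + llr (net (L := L) sigma theta) om))%:E)%E)%E).
  apply: ge0_le_integral => //.
  - apply/measurable_EFinP; apply: measurableT_comp => //; apply: measurable_funD => //.
    by apply: measurable_funM => //; exact: measurable_funM.
  - apply: emeasurable_funD => //; apply/measurable_EFinP; apply: measurableT_comp => //.
    exact: measurable_funD.
  - move=> theta _; rewrite -EFinD lee_fin.
    case: (boolP (sieve theta)) => H.
      rewrite mulr1; apply: (@le_trans _ _ (expR S)); last by rewrite lerDl expR_ge0.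
      rewrite ler_expR addrC; apply: sieve_llr_le; last exact: sieve_bounded.
      by case/andP: H.
    rewrite mulr0 mulr0 add0r; apply: (@le_trans _ _ (expR
      (sparsity_penalty theta + llr (net (L := L) sigma theta) om))).
      by rewrite ler_expR lerDr.
    by rewrite lerDr expR_ge0.
rewrite ge0_integralD//; last 2 first.
- by move=> theta _; rewrite lee_fin expR_ge0.
- by apply/measurable_EFinP; apply: measurableT_comp => //; exact: measurable_funD.
have E : (\int[prior]_theta (cst (expR S)%:E theta) = (expR S)%:E)%E.
  by rewrite integral_cst// [X in (_ * X)%E]pT mule1.
by rewrite [X in (X + _)%E]E EFinD; exact: leeD2l.
Qed.

Lemma integral_d2_le :
  (\int[qhat]_theta d2 s (net (L := L) sigma theta) f0 <=
   (risk_bound / (2 * n%:R) + 4 * s0 ^+ 2 * penalty_bound / b ^+ 2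
    + expR ((expR 1 - 1) * (penalty_bound / a) - sn%:R))%:E)%E.
Proof.
have n2 : 0 < 2 * n%:R :> R by apply: mulr_gt0 => //; rewrite ltr0n.
have b2 : 0 < b ^+ 2 by apply: exprn_gt0; exact: lt_le_trans b_ge1.
have s02 : 0 < 4 * s0 ^+ 2 by apply: mulr_gt0 => //; exact: exprn_gt0.
have mb : measurable_fun setT (fun theta => (sieve theta)%:R : R).
  rewrite (_ : (fun _ => _) = (fun theta => if sieve theta then 1 else 0)).
    exact: measurable_fun_ifT.
  by apply/funext => theta; case: sieve.
pose t1 theta := (2 * n%:R)^-1 * (2 * n%:R * (D theta * (sieve theta)%:R)).
pose t2 theta := 4 * s0 ^+ 2 / b ^+ 2 * sparsity_penalty theta.
pose t3 (theta : T.-tuple R) : R := ((sn < norm0 theta)%N)%:R.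
have mt1 : measurable_fun setT t1.
  by apply: measurable_funM => //; apply: measurable_funM => //; exact: measurable_funM.
have mt2 : measurable_fun setT t2 by exact: measurable_funM.
have mt3 : measurable_fun setT t3.
  rewrite (_ : t3 = (fun theta => if (sn%:R : R) < (norm0 theta)%:R then 1 else 0)).
    by apply: measurable_fun_ifT => //; apply: measurable_fun_ltr => //; exact: measurable_norm0.
  by apply/funext => theta; rewrite /t3 ltr_nat; case: ltnP.
have t10 theta : 0 <= t1 theta.
  by apply: mulr_ge0; [rewrite invr_ge0 ltW|apply: mulr_ge0; [exact: ltW|exact: mulr_ge0]].
have t20 theta : 0 <= t2 theta.
  by apply: mulr_ge0 => //; apply: divr_ge0; exact: ltW.
have d2_le theta : (d2 s (net (L := L) sigma theta) f0 <= (t1 theta + t2 theta + t3 theta)%:E)%E.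
  rewrite (d2E s mnet mf0 theta) lee_fin -/(D theta).
  have t1E : t1 theta = D theta * (sieve theta)%:R.
    by rewrite /t1 mulKf ?gt_eqF.
  rewrite t1E /t3; case: (boolP (sieve theta)) => H.
    by rewrite mulr1 -addrA lerDl; apply: addr_ge0.
  rewrite mulr0 add0r; apply: le_trans (D_le1 theta) _.
  move: H; rewrite negb_and -ltnNge => /orP[->|H]; first by rewrite lerDr.
  apply: (@le_trans _ _ (t2 theta)); last by rewrite lerDl.
  rewrite -ltNge in H; rewrite /t2 mulrAC ler_pdivlMr// mul1r.
  apply: le_trans (ltW H) _; rewrite /sparsity_penalty mulrDr -[leLHS]add0r.
  apply: lerD; first by apply: mulr_ge0; [exact: ltW|apply: mulr_ge0 => //; exact: ltW].
  rewrite -mulr_suml mulrCA mulfV ?mulr1// gt_eqF//.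
have PI := integral_penalty_le.
have I1 : (\int[qhat]_theta (t1 theta)%:E <= (risk_bound / (2 * n%:R))%:E)%E.
  have c0 : 0 <= (2 * n%:R)^-1 :> R by rewrite invr_ge0 ltW.
  rewrite /t1 ge0_integral_scale//; last 2 first.
  - by apply: measurable_funM => //; exact: measurable_funM.
  - by move=> theta; apply: mulr_ge0; [exact: ltW|exact: mulr_ge0].
  rewrite [X in (_ <= X%:E)%E]mulrC [leRHS]EFinM.
  apply: lee_wpmul2l; first by rewrite lee_fin.
  exact: integral_sieve_risk_le.
have I2 : (\int[qhat]_theta (t2 theta)%:E <= (4 * s0 ^+ 2 * penalty_bound / b ^+ 2)%:E)%E.
  have c0 : 0 <= 4 * s0 ^+ 2 / b ^+ 2 by apply: divr_ge0; exact: ltW.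
  rewrite /t2 ge0_integral_scale//.
  have -> : 4 * s0 ^+ 2 * penalty_bound / b ^+ 2 = 4 * s0 ^+ 2 / b ^+ 2 * penalty_bound by ring.
  by rewrite [leRHS]EFinM; apply: lee_wpmul2l; first by rewrite lee_fin.
have I3 : (\int[qhat]_theta (t3 theta)%:E <=
    (expR ((expR 1 - 1) * (penalty_bound / a) - sn%:R))%:E)%E.
  (* Membership in the family: the mean of [norm0] is the sum of the inclusion probabilities. The
     penalty bound divided by [a] bounds this sum, which is all that the Chernoff bound asks for. *)
  have [[phi [m [sd [phi01 sd0 qE]]]] _] := qhatP.
  have phi_le : \sum_(i < T) phi i <= penalty_bound / a.
    rewrite ler_pdivlMr// -lee_fin EFinM -(integral_spike_slab_norm0 m sd phi01) -qE.
    rewrite muleC -ge0_integralZl//; last 2 first.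
    - by apply/measurable_EFinP; exact: measurable_norm0.
    - by rewrite lee_fin ltW.
    apply: le_trans PI; apply: ge0_le_integral => //.
    - by move=> theta _; rewrite -EFinM lee_fin; apply: mulr_ge0 => //; exact: ltW.
    - by apply: measurable_funeM; apply/measurable_EFinP; exact: measurable_norm0.
    - exact/measurable_EFinP.
    - by move=> theta _; rewrite -EFinM lee_fin lerDl.
  rewrite qE; apply: le_trans (spike_slab_norm0_tail m sd sn phi01) _.
  by rewrite lee_fin ler_expR lerD2r; apply: ler_wpM2l.
apply: (@le_trans _ _ (\int[qhat]_theta ((t1 theta)%:E + (t2 theta)%:E + (t3 theta)%:E)%E)%E).
  apply: ge0_le_integral => //.
  - by move=> theta _; rewrite (d2E s mnet mf0 theta) lee_fin; exact: D_ge0.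
  - under eq_fun do rewrite (d2E s mnet mf0); exact/measurable_EFinP.
  - by apply: emeasurable_funD; [apply: emeasurable_funD|]; exact/measurable_EFinP.
rewrite ge0_integralD//; last 4 first.
- by move=> theta _; rewrite -EFinD lee_fin addr_ge0.
- by apply: emeasurable_funD; exact/measurable_EFinP.
- by move=> theta _; rewrite lee_fin.
- exact/measurable_EFinP.
rewrite ge0_integralD//; last 4 first.
- by move=> theta _; rewrite lee_fin.
- exact/measurable_EFinP.
- by move=> theta _; rewrite lee_fin.
- exact/measurable_EFinP.
rewrite !EFinD; apply: leeD => //; exact: leeD.
Qed.

End posterior_bound.

Lemma finite_sample_risk (R : realType) (sigma : R -> R) (w : nat -> nat) (L : nat)
    (sigma_lip : 1.-lipschitz sigma) (w_gt0 : forall k, (0 < w k)%N)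
    d (Omega : measurableType d) (P : probability Omega R) (n : nat) (s : R)
    (X : 'I_n -> {RV P >-> (w 0).-tuple R}) (eps : 'I_n -> {RV P >-> R})
    (model : sampling_model s X eps) (s_gt0 : 0 < s) (n_gt0 : (0 < n)%N)
    (f0 : (w 0).-tuple R -> R) (mf0 : measurable_fun (cube (w 0)) f0)
    (lambda s0 : R) (l01 : 0 < lambda < 1) (s0_gt0 : 0 < s0)
    (B V : R) (tstar : (nparams w L).-tuple R)
    (B_ge1 : 1 <= B) (V_ge0 : 0 <= V) (V_le1 : V <= 1)
    (tstarB : bounded_params B tstar)
    (tstarV : forall x, cube (w 0) x -> `|net sigma tstar x - f0 x| <= V)
    (a b : R) (sn : nat) (a_gt0 : 0 < a) (b_geB : B <= b)
    (C3 := (1 + lambda * (Num.sqrt 2 * expR a)) ^+ nparams w L) :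
  exists A : set Omega, [/\ measurable A, ((1 - 5 / n%:R)%:E <= P A)%E &
    forall om, A om -> forall qhat,
      is_variational_posterior
        (posterior s (fun i => X i om) (fun i => f0 (X i om) + eps i om) sigma_lip
           (spike_slab_prior (nparams w L) lambda s0)) qhat ->
      (\int[qhat]_theta d2 s (net sigma theta) f0 <=
        (risk_bound sigma n s lambda s0 B V tstar b sn C3 / (2 * n%:R)
         + 4 * s0 ^+ 2 * penalty_bound sigma n s lambda s0 B V tstar C3 / b ^+ 2
         + expR ((expR 1 - 1) * (penalty_bound sigma n s lambda s0 B V tstar C3 / a)
             - sn%:R))%:E)%E].
Proof.
have /andP[l0 l1] := l01.
have C3_gt0 : 0 < C3.
  apply: exprn_gt0; apply: ltr_pwDl => //.
  by apply: mulr_ge0; [exact: ltW|apply: mulr_ge0; [exact: sqrtr_ge0|exact: expR_ge0]].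
pose T := nparams w L.
pose prior := spike_slab_prior T lambda s0.
pose f (theta : T.-tuple R) := net (L := L) sigma theta.
have mnet : measurable_fun setT (fun z : T.-tuple R * (w 0).-tuple R => f z.1 z.2).
  exact: measurable_net_comp.
have mf theta : measurable_fun setT (f theta).
  exact: (measurableT_comp mnet (pair1_measurable theta)).
have mpen : measurable_fun setT (sparsity_penalty (L := L) (w := w) s0 a).
  apply: measurable_funD.
    by apply: measurable_funM => //; exact: measurable_norm0.
  apply: measurable_sum => i; apply: measurable_funM => //; apply: measurable_funX.
  exact: measurable_tnth.
have hC3 : (\int[prior]_t (expR (sparsity_penalty s0 a t))%:E <= C3%:E)%E.
  apply: spike_slab_prior_expR_le; [by rewrite !ltW|by rewrite gt_eqF|exact: ltW].
(* The good event requires the bias to be bounded at every point; cutting the network off outside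
   the cube makes its excess 0 there and keeps its values at the design points. *)
pose fstar := on_cube (f tstar).
have mfstar : measurable_fun setT fstar.
  by apply: measurable_on_cube; exact: measurable_funTS.
have excess_star x : cube (w 0) x -> excess f0 fstar x = excess f0 (f tstar) x.
  by move=> xc; rewrite /excess /fstar /on_cube !patchE mem_set.
have fstarV x : `|excess f0 fstar x| <= V.
  rewrite /excess /fstar /on_cube !patchE; case: ifPn => xc; last by rewrite subrr normr0.
  by apply: tstarV; rewrite inE in xc.
pose J := net_code T sn b (net_mesh sigma w L n s b).
have J_gt0 : (0 < #|J|)%N.
  rewrite card_net_code expn_gt0 muln_gt0 /= nparams_gt0//.
have [A [mA PA Agood]] := good_event model s_gt0 n_gt0 mf0 mnet mpen C3_gt0 hC3
  mfstar fstarV (fun c : J => mf (net_point c)) J_gt0.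
exists A; split => // om /Agood [Xc noise weighted pen netc] qhat qhatP.
apply: (integral_d2_le w_gt0 s_gt0 n_gt0 mf0 l01 s0_gt0 B_ge1 V_ge0 V_le1 tstarB tstarV
  Xc noise _ qhatP a_gt0 b_geB C3_gt0 pen netc).
move: weighted; congr (`|_| <= _); apply: eq_bigr => i _.
by rewrite excess_star.
Qed.

(** * Rates *)

Lemma ln_le_id (R : realType) (x : R) : 0 < x -> ln x <= x.
Proof. by move=> x0; have := ln_le_subr1 x0; lra. Qed.

Lemma prod_const_widths (R : realType) (p N L : nat) :
  \prod_(k < L.+1) (const_widths p N k)%:R = p%:R * N%:R ^+ L :> R.
Proof.
rewrite big_ord_recl/=; congr (_ * _).
by rewrite prodr_const card_ord.
Qed.

Section risk_rate.
Context (R : realType) (sigma : R -> R).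
Variables (s s0 B kappa c1 c2 c3 c4 : R).
Hypotheses (s_gt0 : 0 < s) (s0_gt0 : 0 < s0) (B_ge1 : 1 <= B) (kappa_gt0 : 0 < kappa).
Hypotheses (c1_ge0 : 0 <= c1) (c2_ge0 : 0 <= c2) (c3_gt0 : 0 < c3) (c4_ge0 : 0 <= c4).

Let kap : R := `|sigma 0| + 2.

Let kap_ge1 : 1 <= kap. Proof. by rewrite /kap; have := normr_ge0 (sigma 0); lra. Qed.

(** Constants free of n. In units of H, [dK] bounds the log-Lipschitz constant at [B] and [dB] the
    cost of an active coordinate; in units of H ln n, [dG] bounds the log-growth at radius n and
    [dJ] the entropy of one listed coordinate. In units of n r, [D1] and [D2] bound the fit and the
    penalty; [D4] bounds the risk in units of n r ln(n)^2. *)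
Let dK : R := c1 * (2 + ln (kap * B)) + 1.
Let dB : R := c2 + kappa + `|ln s0| + dK + 2 + c2 + B ^+ 2 / s0 ^+ 2.
Let D1 : R := (4 + dB + slack_rate s s0 * (2 * expR 8)) * c3 + 3 * (c4 / (2 * s ^+ 2)).
Let D2 : R := D1 + 4 * c3.
Let dG : R := c1 * (ln kap + 1) + 1.
Let dJ : R := c2 + 4 + c1 + 2 * dG + ln (1 + (3 * s + 6) / s ^+ 2).
Let D4 : R := D1 + (10 + 4 * dJ) * c3.

Let ln_kB : 0 <= ln (kap * B).
Proof. by apply: ln_ge0; rewrite -[leLHS]mulr1 ler_pM. Qed.

Let dB_ge0 : 0 <= dB.
Proof.
have dK0 : 0 <= dK by apply: addr_ge0 => //; apply: mulr_ge0 => //; exact: addr_ge0.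
have q0 : 0 <= B ^+ 2 / s0 ^+ 2 by rewrite divr_ge0 ?sqr_ge0.
rewrite /dB; have := normr_ge0 (ln s0); move: c2_ge0 kappa_gt0; lra.
Qed.

Let sl_ge0 : 0 <= slack_rate s s0 * (2 * expR 8).
Proof.
apply: mulr_ge0; last by apply: mulr_ge0 => //; exact: expR_ge0.
rewrite /slack_rate; apply: addr_ge0; apply: divr_ge0 => //; try exact: sqr_ge0.
by apply: addr_ge0 => //; apply: mulr_ge0 => //; exact: ltW.
Qed.

Let D1_ge0 : 0 <= D1.
Proof.
apply: addr_ge0.
  by apply: mulr_ge0; [move: dB_ge0 sl_ge0; lra|exact: ltW].
by apply: mulr_ge0 => //; apply: divr_ge0 => //; apply: mulr_ge0 => //; exact: sqr_ge0.
Qed.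

(** Chernoff's factor e - 1 times the bound D2 / kappa on the mean of [norm0] divided by [ss]. Once
    [ln n] exceeds it, the tail exponent tail_const * ss - ss * ln n is at most tail_const - ln
    n. *)
Definition tail_const : R := (expR 1 - 1) * (D2 / kappa).

Definition rate_const : R := D4 / 2 + 4 * s0 ^+ 2 * D2 + expR tail_const * c3.

Variables (n p L N ss : nat) (lambda V r : R).
Let w := const_widths p N.
Let T := nparams w L.
Variable tstar : T.-tuple R.
Let ell : R := ln n%:R.
Let H : R := L.+1%:R * ln N%:R + ln (Num.sqrt n%:R * p%:R).

Hypotheses (p_gt0 : (0 < p)%N) (N_gt0 : (0 < N)%N) (n_gt0 : (0 < n)%N).
Hypotheses (ell_ge1 : 1 <= ell) (ell_ge_tail : tail_const <= ell) (H_ge1 : 1 <= H).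
Hypotheses (depth_le : L.+1%:R <= c1 * H) (ln_T_le : ln T%:R <= c2 * H) (T_ge2 : (2 <= T)%N).
Hypotheses (ss_ge1 : (1 <= ss)%N) (ssH_le : ss%:R * H <= c3 * (n%:R * r)).
Hypothesis nr_le : n%:R * r <= ss%:R * H.
Hypothesis V_le : V ^+ 2 <= c4 * r.
Hypothesis tstar_sparse : (norm0 tstar <= ss)%N.
Hypotheses (lambda_gt0 : 0 < lambda) (lambdaE : - ln lambda = ln T%:R + kappa * H).

Let nR : 0 < n%:R :> R. Proof. by rewrite ltr0n. Qed.
Let TR : 0 < T%:R :> R. Proof. by rewrite ltr0n ltnW. Qed.
Let pR : 0 < p%:R :> R. Proof. by rewrite ltr0n. Qed.
Let NR : 0 < N%:R :> R. Proof. by rewrite ltr0n. Qed.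
Let lnN0 : 0 <= ln N%:R :> R. Proof. by rewrite ln_ge0// ler1n. Qed.
Let lnp0 : 0 <= ln p%:R :> R. Proof. by rewrite ln_ge0// ler1n. Qed.
Let ssR : 1 <= ss%:R :> R. Proof. by rewrite ler1n. Qed.
Let LR : 1 <= L.+1%:R :> R. Proof. by rewrite ler1n. Qed.

Let H_gt0 : 0 < H. Proof. exact: lt_le_trans H_ge1. Qed.
Let ssH1 : H <= ss%:R * H. Proof. by rewrite ler_peMl// ltW. Qed.

Let ln_sqrt_n : ln (Num.sqrt n%:R) = ell / 2.
Proof.
have H2 : ell = ln (Num.sqrt n%:R) *+ 2.
  by rewrite -lnXn ?sqrtr_gt0// sqr_sqrtr// ltW.
by rewrite H2 -mulr_natr; field.
Qed.

Let HE : H = L.+1%:R * ln N%:R + ell / 2 + ln p%:R.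
Proof. by rewrite /H lnM ?posrE ?sqrtr_gt0// ln_sqrt_n addrA. Qed.

Let ell_le : ell <= 2 * H.
Proof.
have : 0 <= L.+1%:R * ln N%:R :> R by exact: mulr_ge0.
rewrite HE; move: lnp0; lra.
Qed.

Let width_le : ln p%:R + L%:R * ln N%:R <= H.
Proof.
have H1 : L%:R * ln N%:R <= L.+1%:R * ln N%:R :> R by rewrite ler_wpM2r// ler_nat.
rewrite HE; move: ell_ge1; lra.
Qed.

Let ln_growth b : 1 <= b -> ln (net_growth sigma w b L.+1) =
  L.+1%:R * ln (kap * b) + (ln p%:R + L%:R * ln N%:R).
Proof.
move=> b1; have k0 : 0 < kap * b.
  by apply: mulr_gt0; apply: lt_le_trans ltr01 _.
have NL : 0 < N%:R ^+ L :> R by exact: exprn_gt0.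
have k1 : 0 < (kap * b) ^+ L.+1 by exact: exprn_gt0.
have q1 : 0 < p%:R * N%:R ^+ L :> R by exact: mulr_gt0.
rewrite /net_growth -/kap prod_const_widths [LHS]lnM ?posrE//.
by rewrite lnXn// [ln (p%:R * _)]lnM ?posrE// lnXn//
  -[ln (kap * b) *+ _]mulr_natl -[ln N%:R *+ _]mulr_natl.
Qed.

Let w_gt0 k : (0 < w k)%N. Proof. by case: k. Qed.

Let growth_gt0 b : 1 <= b -> 0 < net_growth sigma w b L.+1.
Proof. by move=> b1; apply: lt_le_trans ltr01 _; exact: net_growth_ge1. Qed.

Let lnL : ln L.+1%:R <= c1 * H :> R.
Proof. by apply: le_trans depth_le; apply: ln_le_id; rewrite ltr0n. Qed.

Let ln2_le1 : ln 2 <= 1 :> R.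
Proof. by have := @ln_le_subr1 R 2; rewrite ltr0n => /(_ isT); lra. Qed.

Let ln_lip_le : ln (net_lip sigma w L B) <= dK * H.
Proof.
have g0 := growth_gt0 B_ge1.
have L0 : 0 < L.+1%:R :> R by rewrite ltr0n.
have L20 : 0 < 2 * L.+1%:R :> R by exact: mulr_gt0.
rewrite /net_lip [ln (_ * net_growth _ _ _ _)]lnM ?posrE// [ln (2 * _)]lnM ?posrE//.
rewrite ln_growth//.
have : L.+1%:R * ln (kap * B) <= c1 * H * ln (kap * B) by exact: ler_wpM2r.
rewrite /dK; move: width_le lnL depth_le LR ln2_le1; lra.
Qed.

Let lambda_lt1 : lambda < 1.
Proof.
rewrite -(lnK lambda_gt0) -expR0 ltr_expR.
have : 0 <= ln T%:R :> R by rewrite ln_ge0// ler1n ltnW.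
have : 0 < kappa * H by exact: mulr_gt0.
move: lambdaE; lra.
Qed.

Let Tlambda : T%:R * lambda = expR (- (kappa * H)).
Proof.
rewrite -{1}(lnK lambda_gt0) -{1}(lnK TR) -expRD; congr expR.
move: lambdaE; lra.
Qed.

Let lambda_le : lambda <= 1 / 2.
Proof.
have k0 : 0 < kappa * H by exact: mulr_gt0.
have : T%:R * lambda <= 1 by rewrite Tlambda -[leRHS]expR0 ler_expR; lra.
have : 2 * lambda <= T%:R * lambda by rewrite ler_pM2r// ler_nat.
lra.
Qed.

Let fit_bound_le : fit_bound sigma n s lambda s0 B V tstar <= D1 * (n%:R * r).
Proof.
rewrite /fit_bound /fit_cost.
set K := net_lip sigma w L B; set sl := slack_rate s s0 * (2 * expR 8).
have K0 : 0 < K.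
  by apply: mulr_gt0 (growth_gt0 B_ge1); apply: mulr_gt0 => //; rewrite ltr0n.
have sl0 : 0 <= sl := sl_ge0.
have k0 : 0 < kappa * H by exact: mulr_gt0.
(* As lambda <= 1/2, - ln(1 - lambda) <= 1 / (1 - lambda) - 1 <= 2 lambda, and T lambda = exp(-
   kappa H) <= 1. *)
have A1 : - T%:R * ln (1 - lambda) <= 2.
  have l1 : 0 < 1 - lambda by rewrite subr_gt0.
  have := @ln_le_subr1 R (1 - lambda)^-1; rewrite invr_gt0 => /(_ l1).
  rewrite lnV ?posrE// => Hl.
  have : (1 - lambda)^-1 - 1 <= 2 * lambda.
    rewrite lerBlDr -[leLHS]mul1r ler_pdivrMr//.
    move: lambda_le lambda_gt0; nra.
  move=> Hl2; have : T%:R * - ln (1 - lambda) <= T%:R * (2 * lambda).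
    by rewrite ler_pM2l//; lra.
  have : T%:R * lambda <= 1 by rewrite Tlambda -[leRHS]expR0 ler_expR; lra.
  rewrite mulrN mulNr; lra.
have A2 : - ln lambda + ln (s0 / (K * n%:R * T%:R)^-1) + B ^+ 2 / s0 ^+ 2 <= dB * H.
  have Kn0 : 0 < K * n%:R by exact: mulr_gt0.
  have -> : ln (s0 / (K * n%:R * T%:R)^-1) = ln s0 + (ln K + ell + ln T%:R).
    have KnT0 : 0 < K * n%:R * T%:R by exact: mulr_gt0.
    by rewrite invrK (lnM s0_gt0 KnT0) (lnM Kn0 TR) (lnM K0 nR).
  rewrite lambdaE.
  have B1 : `|ln s0| <= `|ln s0| * H by rewrite ler_peMr.
  have B2 := ler_norm (ln s0).
  have B3 : B ^+ 2 / s0 ^+ 2 <= B ^+ 2 / s0 ^+ 2 * H.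
    by rewrite ler_peMr// divr_ge0 ?sqr_ge0.
  rewrite /dB; move: ln_lip_le ln_T_le ell_le; rewrite -/K -/ell; lra.
have dB0 := dB_ge0.
have dBH0 : 0 <= dB * H by apply: mulr_ge0 => //; exact: ltW.
have A3 : (norm0 tstar)%:R * (- ln lambda + ln (s0 / (K * n%:R * T%:R)^-1) + B ^+ 2 / s0 ^+ 2) <=
    ss%:R * (dB * H).
  apply: (@le_trans _ _ ((norm0 tstar)%:R * (dB * H))); first exact: ler_wpM2l.
  by apply: ler_wpM2r => //; rewrite ler_nat.
have A4 : n%:R * (V ^+ 2 / (2 * s ^+ 2)) <= c4 / (2 * s ^+ 2) * (n%:R * r).
  have -> : c4 / (2 * s ^+ 2) * (n%:R * r) = n%:R * (c4 * r / (2 * s ^+ 2)) by ring.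
  by rewrite ler_pM2l// ler_pM2r// invr_gt0 mulr_gt0// exprn_gt0.
have A5 : (4 + dB + sl) * (ss%:R * H) <= (4 + dB + sl) * (c3 * (n%:R * r)).
  by apply: ler_wpM2l => //; move: dB0 sl0; lra.
have A6 : sl <= sl * (ss%:R * H) by rewrite ler_peMr//; move: H_gt0 H_ge1 ssH1 ell_ge1; lra.
rewrite /D1 -/sl -/ell.
have -> : ((4 + dB + sl) * c3 + 3 * (c4 / (2 * s ^+ 2))) * (n%:R * r) =
  (4 + dB + sl) * (c3 * (n%:R * r)) + 3 * (c4 / (2 * s ^+ 2) * (n%:R * r)) by ring.
move: A1 A3 A4 A5 A6 ssH1 ell_le H_ge1.
have -> : (4 + dB + sl) * (ss%:R * H) = 4 * (ss%:R * H) + ss%:R * (dB * H) + sl * (ss%:R * H) by ring.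
lra.
Qed.

Let C3 : R := (1 + lambda * (Num.sqrt 2 * expR (kappa * H))) ^+ T.

(** The choice of lambda gives lambda exp(kappa H) = 1 / T, so one coordinate has moment 1 + sqrt 2
    / T and the product of T of them stays bounded. *)
Let C3_le : C3 <= expR 2.
Proof.
have r2 : Num.sqrt 2 <= 2 :> R.
  by rewrite -[leRHS]ger0_norm// -sqrtr_sqr ler_wsqrtr// expr2; lra.
have E : lambda * (Num.sqrt 2 * expR (kappa * H)) = Num.sqrt 2 / T%:R.
  have -> : lambda = expR (- (kappa * H)) / T%:R.
    by rewrite -Tlambda mulrAC mulfV ?mul1r// gt_eqF.
  rewrite expRN; field; rewrite ?gt_eqF ?expR_gt0//.
rewrite /C3 E.
have -> : expR 2 = expR (2 / T%:R) ^+ T :> R.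
  by rewrite -expRM_natl; congr expR; field; rewrite gt_eqF.
have t0 : 0 <= Num.sqrt 2 / T%:R :> R by rewrite divr_ge0 ?sqrtr_ge0// ltW.
apply: lerXn2r; rewrite ?nnegrE ?expR_ge0 ?addr_ge0//.
apply: le_trans (expR_ge1Dx _) _; rewrite ler_expR ler_pM2r// ?invr_gt0//.
Qed.

Let C3_gt0 : 0 < C3.
Proof.
apply: exprn_gt0; apply: ltr_pwDl => //; apply: mulr_ge0; first exact: ltW.
by apply: mulr_ge0; [exact: sqrtr_ge0|exact: expR_ge0].
Qed.

Let penalty_bound_le : penalty_bound sigma n s lambda s0 B V tstar C3 <= D2 * (n%:R * r).
Proof.
rewrite /penalty_bound lnM ?posrE// -/ell.
have : ln C3 <= 2 by rewrite -ler_expR lnK.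
rewrite /D2 mulrDl; move: fit_bound_le ssH_le ssH1 ell_le H_ge1; lra.
Qed.

Let sn : nat := (ss * (Num.truncn ell).+1)%N.

Let sn_ge : ss%:R * ell <= sn%:R.
Proof.
rewrite /sn natrM ler_wpM2l// ltW//; exact: truncnS_gt.
Qed.

Let sn_le : sn%:R <= 2 * (ss%:R * ell).
Proof.
rewrite /sn natrM mulrCA ler_wpM2l// -natr1.
have : (Num.truncn ell)%:R <= ell by rewrite truncn_le (le_trans ler01).
move: ell_ge1; lra.
Qed.

Let mesh := net_mesh sigma w L n s n%:R.

Let n_ge1 : 1 <= n%:R :> R. Proof. by rewrite ler1n. Qed.

(** Source of the ln(n)^2 in the rate. One logarithm comes from [sn], of order ss ln n; the other
    from the cost O(H ln n) of each listed coordinate, since the sieve radius n enters [net_growth]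
    to the power L + 1. *)
Let ln_cover_le : ln #|net_code T sn n%:R mesh|%:R <= 2 * dJ * (ss%:R * H * ell ^+ 2).
Proof.
have G1 := net_growth_ge1 sigma w_gt0 L.+1 n_ge1.
set Gam := net_growth sigma w n%:R L.+1 in G1.
have G0 : 0 < Gam by exact: lt_le_trans G1.
have s2 : 0 < s ^+ 2 by exact: exprn_gt0.
have L0 : 0 < L.+1%:R :> R by rewrite ltr0n.
have HL1 : H <= H * ell by rewrite ler_peMr//; move: H_gt0 H_ge1 ssH1 ell_ge1; lra.
have ln_kap : 0 <= ln kap by exact: ln_ge0.
have lnGam : ln Gam <= dG * (H * ell).
  rewrite /Gam ln_growth// lnM ?posrE ?(lt_le_trans ltr01)// -/ell.
  have B1 : L.+1%:R * (ln kap + ell) <= c1 * H * ((ln kap + 1) * ell).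
    apply: ler_pM => //; first by move: ell_ge1 ln_kap; lra.
    rewrite mulrDl mul1r lerD2r ler_peMr//.
  rewrite /dG; move: width_le HL1 B1; lra.
set g := Num.truncn (n%:R / mesh).
have q0 : 0 < 3 * s + 6 * Gam by apply: addr_gt0; apply: mulr_gt0.
have meshE : n%:R / mesh = n%:R ^+ 2 * (2 * L.+1%:R) * (Gam * (3 * s + 6 * Gam)) / s ^+ 2.
  rewrite /mesh /net_mesh /net_lip -/Gam; field; rewrite !gt_eqF//.
have mesh_gt0 : 0 <= n%:R / mesh.
  rewrite meshE; apply: divr_ge0; last exact: ltW.
  apply: mulr_ge0; apply: mulr_ge0; [exact: sqr_ge0| |exact: ltW|exact: ltW].
  by apply: mulr_ge0 => //; exact: ltW.
set E0 := 1 + (3 * s + 6) / s ^+ 2.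
have E01 : 1 <= E0 by rewrite lerDl divr_ge0// ?sqr_ge0// addr_ge0// mulr_ge0// ltW.
have g_le : g.+1%:R <= n%:R ^+ 2 * (2 * L.+1%:R) * Gam ^+ 2 * E0.
  have : g%:R <= n%:R / mesh by rewrite /g truncn_le.
  rewrite meshE -natr1 => Hg.
  have I1 : 1 <= n%:R ^+ 2 * (2 * L.+1%:R) * Gam ^+ 2.
    apply: mulr_ege1; last exact: exprn_ege1.
    apply: mulr_ege1; first exact: exprn_ege1.
    move: LR; lra.
  have I2 : n%:R ^+ 2 * (2 * L.+1%:R) * (Gam * (3 * s + 6 * Gam)) / s ^+ 2 <=
      n%:R ^+ 2 * (2 * L.+1%:R) * Gam ^+ 2 * ((3 * s + 6) / s ^+ 2).
    have A0 : 0 <= n%:R ^+ 2 * (2 * L.+1%:R) :> R.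
      by apply: mulr_ge0; [exact: sqr_ge0|apply: mulr_ge0 => //; exact: ltW].
    rewrite [leRHS]mulrA; apply: ler_wpM2r; first by rewrite invr_ge0 ltW.
    rewrite -[leRHS]mulrA; apply: ler_wpM2l => //.
    have : 0 <= s * (Gam * (Gam - 1)).
      by apply: mulr_ge0; [exact: ltW|apply: mulr_ge0; [exact: ltW|rewrite subr_ge0]].
    rewrite expr2; lra.
  by rewrite /E0 mulrDr mulr1; lra.
have ln_g : ln g.+1%:R <= 2 * ell + (1 + c1 * H) + 2 * ln Gam + ln E0.
  have p1 : 0 < n%:R ^+ 2 * (2 * L.+1%:R) :> R.
    by apply: mulr_gt0; [exact: exprn_gt0|apply: mulr_gt0].
  have p2 : 0 < n%:R ^+ 2 * (2 * L.+1%:R) * Gam ^+ 2.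
    by apply: mulr_gt0 => //; exact: exprn_gt0.
  have E00 : 0 < E0 by exact: lt_le_trans E01.
  have g00 : 0 < g.+1%:R :> R by rewrite ltr0n.
  have L20 : 0 < 2 * L.+1%:R :> R by exact: mulr_gt0.
  have n20 : 0 < n%:R ^+ 2 :> R by exact: exprn_gt0.
  have Gam20 : 0 < Gam ^+ 2 by exact: exprn_gt0.
  have p30 := mulr_gt0 p2 E00.
  have Hg : ln g.+1%:R <= ln (n%:R ^+ 2 * (2 * L.+1%:R) * Gam ^+ 2 * E0).
    by rewrite ler_ln ?posrE.
  move: Hg; rewrite (lnM p2 E00) (lnM p1 Gam20) (lnM n20 L20) [ln (2 * _)]lnM ?posrE//.
  rewrite !lnXn// -[ln n%:R *+ 2]mulr_natl -[ln Gam *+ 2]mulr_natl => Hg.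
  move: Hg lnL ln2_le1; rewrite -/ell; lra.
have g00 : 0 < g.+1%:R :> R by rewrite ltr0n.
have two0 : 0 < 2 :> R by [].
have g20 := mulr_gt0 two0 g00.
have lncard : ln #|net_code T sn n%:R mesh|%:R = sn%:R * (ln T%:R + (ln 2 + ln g.+1%:R)) :> R.
  rewrite card_net_code -/g natrX (natrM _ T) (natrM _ 2) (lnXn _ (mulr_gt0 TR g20)).
  by rewrite (lnM TR g20) (lnM two0 g00) -[LHS]mulr_natl.
rewrite lncard.
have lnE0 : 0 <= ln E0 by exact: ln_ge0.
have dG0 : 0 <= dG by apply: addr_ge0 => //; apply: mulr_ge0 => //; exact: addr_ge0.
have dJ0 : 0 <= dJ by rewrite /dJ -/E0; move: c2_ge0 c1_ge0; lra.
have HL0 : 0 <= H * ell by apply: mulr_ge0; [exact: ltW|exact: le_trans ell_ge1].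
have X : ln T%:R + (ln 2 + ln g.+1%:R) <= dJ * (H * ell).
  have Y1 : ln E0 <= ln E0 * (H * ell) by rewrite ler_peMr//; move: H_gt0 H_ge1 ssH1 ell_ge1; lra.
  have Y2 : c2 * H <= c2 * (H * ell) by apply: ler_wpM2l.
  have Y3 : c1 * H <= c1 * (H * ell) by apply: ler_wpM2l.
  have Y4 : ell <= H * ell by rewrite ler_peMl//; move: H_ge1 ell_ge1; lra.
  rewrite /dJ -/E0; move: ln_T_le ln_g lnGam ln2_le1 ell_ge1; nra.
apply: (@le_trans _ _ (sn%:R * (dJ * (H * ell)))); first exact: ler_wpM2l.
apply: (@le_trans _ _ (2 * (ss%:R * ell) * (dJ * (H * ell)))).
  by apply: ler_wpM2r => //; exact: mulr_ge0.
by rewrite le_eqVlt; apply/orP; left; apply/eqP; ring.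
Qed.

Let r_gt0 : 0 < r.
Proof.
have : 0 < c3 * (n%:R * r) by move: ssH_le ssH1 H_ge1; lra.
by rewrite pmulr_rgt0// pmulr_rgt0.
Qed.

Let risk_bound_le :
  risk_bound sigma n s lambda s0 B V tstar n%:R sn C3 <= D4 * (n%:R * r * ell ^+ 2).
Proof.
pose J : R := #|net_code T sn n%:R mesh|%:R.
have J0 : 0 < J.
  by rewrite /J ltr0n card_net_code expn_gt0 muln_gt0 (ltnW T_ge2).
have lnJ := ln_cover_le; rewrite -/J in lnJ.
have J1 : 0 <= ln J.
  by rewrite ln_ge0// /J ler1n card_net_code expn_gt0 muln_gt0 (ltnW T_ge2).
rewrite /risk_bound -/mesh -/J.
set S := 2 * ln (n%:R * J) + 1.
have SE : S = 2 * ell + 2 * ln J + 1 by rewrite /S lnM ?posrE// -/ell; ring.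
have S0 : 0 <= S by rewrite SE; move: ell_ge1; lra.
(* Merges the two exponentials by exp(S) >= 1, C3 <= exp(2) and 1 + exp(2) <= exp(3), so that the
   logarithm costs only S + ln n + 3. *)
have e3 : expR S + n%:R * C3 <= expR (S + ell + 3).
  have -> : expR (S + ell + 3) = n%:R * (expR S * expR 3).
    by rewrite -addrA [ell + 3]addrC addrA expRD [expR ell]lnK ?posrE// expRD mulrC.
  have : n%:R * C3 <= n%:R * expR 2 by rewrite ler_pM2l.
  have : expR S <= n%:R * expR S by rewrite ler_peMl// expR_ge0.
  have : 1 + expR 2 <= expR 3 :> R.
    have -> : expR 3 = expR 1 * expR 2 :> R by rewrite -expRD; congr expR; lra.
    have := @expR_ge1Dx R 1; have := @expR_ge1Dx R 2; nra.
  have : 1 <= expR S by rewrite -expR0 ler_expR.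
  move=> E1 E2 E3 E4.
  have : expR S + expR 2 <= expR S * expR 3.
    have := expR_gt0 (2 : R); nra.
  move=> E5; have : n%:R * (expR S + expR 2) <= n%:R * (expR S * expR 3) by rewrite ler_pM2l.
  rewrite mulrDr; lra.
have lnS : ln (expR S + n%:R * C3) <= S + ell + 3.
  rewrite -[leRHS]expRK ler_ln ?posrE ?expR_gt0//.
  by apply: addr_gt0; [exact: expR_gt0|exact: mulr_gt0].
have l2 : 1 <= ell ^+ 2 by exact: exprn_ege1.
have X1 : ss%:R * H <= ss%:R * H * ell ^+ 2.
  by rewrite ler_peMr//; move: H_ge1 ssH1; lra.
have X2 : ss%:R * H * ell ^+ 2 <= c3 * (n%:R * r) * ell ^+ 2.
  by apply: ler_wpM2r => //; exact: sqr_ge0.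
have D10 := D1_ge0.
have nr0 : 0 <= n%:R * r by rewrite mulr_ge0// ltW.
have X3 : D1 * (n%:R * r) <= D1 * (n%:R * r) * ell ^+ 2.
  by rewrite ler_peMr// mulr_ge0.
have dJ0 : 0 <= 2 * dJ * (ss%:R * H * ell ^+ 2) by exact: le_trans lnJ.
have X4 : 0 < ss%:R * H * ell ^+ 2 by move: H_ge1 X1 ssH1; lra.
have dJ1 : 0 <= dJ by move: dJ0; rewrite pmulr_lge0// pmulr_rge0.
have X5 : dJ * (ss%:R * H * ell ^+ 2) <= dJ * (c3 * (n%:R * r) * ell ^+ 2) by exact: ler_wpM2l.
rewrite /D4.
have -> : (D1 + (10 + 4 * dJ) * c3) * (n%:R * r * ell ^+ 2) =
  D1 * (n%:R * r) * ell ^+ 2 + 10 * (c3 * (n%:R * r) * ell ^+ 2) +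
  4 * (dJ * (c3 * (n%:R * r) * ell ^+ 2)) by ring.
move: fit_bound_le lnS lnJ X1 X2 X3 X5 SE ell_le ssH1 H_ge1; lra.
Qed.

Lemma risk_rate_le :
  risk_bound sigma n s lambda s0 B V tstar n%:R sn C3 / (2 * n%:R)
  + 4 * s0 ^+ 2 * penalty_bound sigma n s lambda s0 B V tstar C3 / n%:R ^+ 2
  + expR ((expR 1 - 1) * (penalty_bound sigma n s lambda s0 B V tstar C3 / (kappa * H))
          - sn%:R)
  <= rate_const * (r * ell ^+ 2).
Proof.
have l2 : 1 <= ell ^+ 2 by exact: exprn_ege1.
have H0 := H_gt0.
have kH : 0 < kappa * H by exact: mulr_gt0.
have nr0 : 0 < n%:R * r by exact: mulr_gt0.
have D20 : 0 <= D2 by rewrite /D2; move: D1_ge0 c3_gt0; lra.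
have Y1 : risk_bound sigma n s lambda s0 B V tstar n%:R sn C3 / (2 * n%:R) <=
    D4 / 2 * (r * ell ^+ 2).
  rewrite ler_pdivrMr ?mulr_gt0//; apply: le_trans risk_bound_le _.
  by rewrite le_eqVlt; apply/orP; left; apply/eqP; field.
have Y2 : 4 * s0 ^+ 2 * penalty_bound sigma n s lambda s0 B V tstar C3 / n%:R ^+ 2 <=
    4 * s0 ^+ 2 * D2 * (r * ell ^+ 2).
  have q0 : 0 <= 4 * s0 ^+ 2 by apply: mulr_ge0 => //; exact: sqr_ge0.
  rewrite ler_pdivrMr ?exprn_gt0//.
  apply: (@le_trans _ _ (4 * s0 ^+ 2 * (D2 * (n%:R * r)))); first exact: ler_wpM2l.
  have n1 : n%:R * r <= r * ell ^+ 2 * n%:R ^+ 2.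
    have -> : r * ell ^+ 2 * n%:R ^+ 2 = n%:R * r * (ell ^+ 2 * n%:R) by ring.
    by rewrite ler_peMr ?(ltW nr0)// mulr_ege1.
  have -> : 4 * s0 ^+ 2 * D2 * (r * ell ^+ 2) * n%:R ^+ 2 =
    4 * s0 ^+ 2 * (D2 * (r * ell ^+ 2 * n%:R ^+ 2)) by ring.
  apply: ler_wpM2l => //.
  exact: ler_wpM2l.
have Y3 : expR ((expR 1 - 1) * (penalty_bound sigma n s lambda s0 B V tstar C3 / (kappa * H))
          - sn%:R) <= expR tail_const * c3 * (r * ell ^+ 2).
  have e1 : 0 <= expR 1 - 1 :> R by have := @expR_ge1Dx R 1; lra.
  have Z1 : (expR 1 - 1) * (penalty_bound sigma n s lambda s0 B V tstar C3 / (kappa * H)) <=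
      tail_const * ss%:R.
    rewrite /tail_const -mulrA; apply: ler_wpM2l => //.
    rewrite ler_pdivrMr//; apply: le_trans penalty_bound_le _.
    have -> : D2 / kappa * ss%:R * (kappa * H) = D2 * (ss%:R * H).
      by field; rewrite gt_eqF.
    exact: ler_wpM2l.
  have Z2 : tail_const * ss%:R - sn%:R <= tail_const - ell.
    have : (ell - tail_const) * 1 <= (ell - tail_const) * ss%:R.
      by apply: ler_wpM2l => //; rewrite subr_ge0.
    move: sn_ge; lra.
  (* The tail is O(1 / n), which the rate absorbs because 1 <= H <= ss H <= c3 n r. *)
  apply: (@le_trans _ _ (expR tail_const * n%:R^-1)).
    have -> : n%:R^-1 = expR (- ell) :> R by rewrite expRN lnK.
    rewrite -expRD ler_expR; lra.
  rewrite -mulrA ler_pM2l ?expR_gt0// -div1r ler_pdivrMr//.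
  have : 1 <= c3 * (n%:R * r) by move: ssH_le ssH1 H_ge1; lra.
  have : c3 * (n%:R * r) <= c3 * (n%:R * r) * ell ^+ 2.
    by rewrite ler_peMr// mulr_ge0// ltW.
  have -> : c3 * (r * ell ^+ 2) * n%:R = c3 * (n%:R * r) * ell ^+ 2 by ring.
  lra.
rewrite /rate_const [leRHS]mulrDl [X in _ <= X + _]mulrDl.
by apply: lerD => //; exact: lerD.
Qed.

End risk_rate.

Lemma ln_ge_half (R : realType) (m : nat) : (2 <= m)%N -> 1 / 2 <= ln m%:R :> R.
Proof.
move=> m2; have : ln 2 <= ln m%:R :> R by rewrite ler_ln ?posrE ?ltr0n ?ler_nat// ltnW.
have := @ln_le_subr1 R 2^-1; rewrite invr_gt0 ltr0n lnV ?posrE// => /(_ isT); lra.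
Qed.

Lemma nparams_const_widths_le p N L : (0 < p)%N -> (0 < N)%N ->
  (nparams (const_widths p N) L <= 2 * L.+1 * N ^ 2 * p)%N.
Proof.
move=> p0 N0; have wle k : (const_widths p N k <= N * p)%N.
  by case: k => [|k] /=; rewrite ?leq_pmull ?leq_pmulr.
have Np : (0 < N * p)%N by rewrite muln_gt0 N0.
have offset_le l : (layer_offset (const_widths p N) l <= l * (2 * N ^ 2 * p))%N.
  rewrite /layer_offset -[X in (_ <= X * _)%N](card_ord l) -sum_nat_const.
  by apply: leq_sum => k _; rewrite /= -(leq_add2r 0) !addn0; move: (wle k) Np; nia.
by rewrite /nparams; move: (offset_le L) (wle L) Np; nia.
Qed.

(** * Comparison of the rate with the complexity H *)

Section rate_at_sparsity.
Context (R : realType) (p N L n ss K : nat).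
Hypotheses (p_gt0 : (0 < p)%N) (N_gt0 : (0 < N)%N) (L_gt0 : (0 < L)%N) (n_gt0 : (0 < n)%N).
Hypothesis depth1 : N = 1%N -> (L <= K)%N.
Let T := nparams (const_widths p N) L.
Let ell : R := ln n%:R.
Let H : R := L.+1%:R * ln N%:R + ln (Num.sqrt n%:R * p%:R).
(** The part of [H] without the sample size: H = v + ell / 2, while n times the rate is ss (v + (ell
    - ln ss) / 2). Only [ln ss] separates the two. *)
Let v : R := L.+1%:R * ln N%:R + ln p%:R.

Let nR : 0 < n%:R :> R. Proof. by rewrite ltr0n. Qed.
Let pR : 0 < p%:R :> R. Proof. by rewrite ltr0n. Qed.
Let NR : 0 < N%:R :> R. Proof. by rewrite ltr0n. Qed.
Let LR : 2 <= L.+1%:R :> R. Proof. by rewrite ler_nat. Qed.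
Let lnN0 : 0 <= ln N%:R :> R. Proof. by rewrite ln_ge0// ler1n. Qed.
Let lnp0 : 0 <= ln p%:R :> R. Proof. by rewrite ln_ge0// ler1n. Qed.
Let LlnN0 : 0 <= L.+1%:R * ln N%:R :> R. Proof. exact: mulr_ge0. Qed.
Let v_ge0 : 0 <= v. Proof. exact: addr_ge0. Qed.

Let ln_sqrt (m : R) : 0 < m -> ln (Num.sqrt m) = ln m / 2.
Proof.
move=> m0; have H2 : ln m = ln (Num.sqrt m) *+ 2.
  by rewrite -lnXn ?sqrtr_gt0// sqr_sqrtr// ltW.
by rewrite H2 -mulr_natr; field.
Qed.

Let HE : H = v + ell / 2.
Proof. by rewrite /H lnM ?posrE ?sqrtr_gt0// ln_sqrt// /v /ell; ring. Qed.

Lemma complexity_ge1 : 2 <= ell -> 1 <= H.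
Proof. by rewrite HE; move: v_ge0; lra. Qed.

(** For N >= 2, ln N >= 1/2 lets the depth term of [v] control L + 1; for N = 1 that term is 0 and
    the depth is at most K. *)
Let depth_v : L.+1%:R <= K.+1%:R + 2 * v.
Proof.
have [N1|N2] := leqP N 1.
  have N1E : N = 1%N by apply/eqP; rewrite eqn_leq N1.
  have : L.+1%:R <= K.+1%:R :> R by rewrite ler_nat ltnS depth1.
  move: v_ge0; lra.
have : L.+1%:R * (1 / 2) <= L.+1%:R * ln N%:R :> R.
  by apply: ler_wpM2l => //; exact: ln_ge_half.
have : 0 <= K.+1%:R :> R by [].
rewrite /v; move: lnp0; lra.
Qed.

Let lnT_v : ln T%:R <= K%:R + 2 + 3 * v.
Proof.
have L0 : 0 < L.+1%:R :> R by rewrite ltr0n.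
have two0 : 0 < 2 :> R by [].
have q1 := mulr_gt0 two0 L0.
have q2 : 0 < N%:R ^+ 2 :> R by exact: exprn_gt0.
have TR : 0 < T%:R :> R by rewrite ltr0n nparams_gt0.
have : ln T%:R <= ln (2 * L.+1%:R * N%:R ^+ 2 * p%:R) :> R.
  have := nparams_const_widths_le L p_gt0 N_gt0; rewrite -(ler_nat R) !natrM -expr2 => H1.
  by rewrite ler_ln ?posrE// mulr_gt0// mulr_gt0.
rewrite (lnM (mulr_gt0 q1 q2) pR) (lnM q1 q2) (lnM two0 L0) lnXn// -mulr_natl.
have := ln_le_subr1 two0; have := ln_le_subr1 L0; have := depth_v.
have : 2 * ln N%:R <= L.+1%:R * ln N%:R :> R by exact: ler_wpM2r.
rewrite /v -natr1; move: lnp0; lra.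
Qed.

Lemma depth_le_complexity : 2 <= ell -> L.+1%:R <= (K%:R + 3) * H.
Proof.
move=> l2; have H1 := complexity_ge1 l2.
have : 0 <= (K%:R + 1) * (H - 1) by apply: mulr_ge0; rewrite ?subr_ge0// addr_ge0.
move: depth_v HE; rewrite -natr1; lra.
Qed.

Lemma ln_nparams_le_complexity : 2 <= ell -> ln T%:R <= (K%:R + 5) * H.
Proof.
move=> l2; have H1 := complexity_ge1 l2.
have : 0 <= (K%:R + 2) * (H - 1) by apply: mulr_ge0; rewrite ?subr_ge0// addr_ge0.
move: lnT_v HE; lra.
Qed.

Hypotheses (ss_ge1 : (1 <= ss)%N) (ss_leT : (ss <= T)%N).
Let m : R := v + (ell - ln ss%:R) / 2.
Let ssR : 0 < ss%:R :> R. Proof. by rewrite ltr0n. Qed.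

Let ln_cellE : ln (p%:R * Num.sqrt (n%:R / ss%:R)) = ln p%:R + (ell - ln ss%:R) / 2.
Proof.
have q : 0 < n%:R / ss%:R :> R by exact: divr_gt0.
by rewrite lnM ?posrE ?sqrtr_gt0// ln_sqrt// [ln (_ / _)]lnM ?posrE ?invr_gt0// lnV ?posrE.
Qed.

Let rateE : n%:R * rate n p L N ss = ss%:R * m.
Proof. by rewrite /rate ln_cellE /m /v; field; rewrite gt_eqF. Qed.

Let ln_ss_ge0 : 0 <= ln ss%:R :> R. Proof. by rewrite ln_ge0// ler1n. Qed.

Lemma rate_le_complexity : n%:R * rate n p L N ss <= ss%:R * H.
Proof. by rewrite rateE HE ler_pM2l// /m; move: ln_ss_ge0; lra. Qed.

Variable e : R.
Hypotheses (e_le : e <= expR (- (2 * (K%:R + 2)))).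
Hypotheses (ell_ge : 2 * ln (2 * K.+1%:R) + 2 <= ell).
Hypothesis small_a : ss%:R * ln (p%:R * Num.sqrt (n%:R / ss%:R)) <= e * n%:R.
Hypothesis small_b : L.+1%:R * ss%:R * ln N%:R <= e * n%:R.

Lemma rate_le_small : rate n p L N ss <= 2 * e.
Proof.
rewrite -(ler_pM2l nR) rateE /m; move: small_a small_b; rewrite ln_cellE /v; lra.
Qed.

(* For [N >= 2] the depth term of the rate already contains [s]; for [N = 1]
   there are at most [2 (K + 1) p] parameters, hence [p >= s / (2 (K + 1))] and
   the other term contains [s log n]. *)
Let ss_le : ss%:R <= e * n%:R.
Proof.
have [N1|N2] := leqP N 1; last first.
  apply: le_trans small_b; rewrite mulrAC ler_peMl ?(ltW ssR)//.
  have := @ln_ge_half R _ N2 => h; have : 2 * (1 / 2) <= L.+1%:R * ln N%:R :> R.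
    by apply: ler_pM.
  lra.
have N1E : N = 1%N by apply/eqP; rewrite eqn_leq N1.
have k0 : 0 < 2 * K.+1%:R :> R by apply: mulr_gt0.
have : (ss <= 2 * K.+1 * p)%N.
  apply: leq_trans ss_leT _; apply: leq_trans (nparams_const_widths_le L p_gt0 N_gt0) _.
  by rewrite N1E exp1n muln1 leq_mul2r leq_mul2l ltnS depth1 ?orbT.
rewrite -(ler_nat R) !natrM => ssp.
have : ln ss%:R <= ln (2 * K.+1%:R * p%:R) :> R by rewrite ler_ln ?posrE// mulr_gt0.
rewrite (lnM k0 pR) => lns.
apply: le_trans small_a; rewrite ln_cellE ler_peMr ?(ltW ssR)//.
move: ell_ge lns ln_ss_ge0; lra.
Qed.

(** After division by [ss] the claim reads 3/2 ln ss <= 2 v + ell. It combines ln ss <= ell - 2 (K +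
    2), from the smallness of ss / n, with half of ln ss <= ln T <= K + 2 + 3 v; the first constant
    absorbs the second. *)
Lemma complexity_le_rate : ss%:R * H <= 3 * (n%:R * rate n p L N ss).
Proof.
have e0 : 0 < e by rewrite -(pmulr_lgt0 _ nR); exact: lt_le_trans ss_le.
have : ln ss%:R <= ln (e * n%:R) by rewrite ler_ln ?posrE// mulr_gt0.
rewrite lnM ?posrE// -/ell => lns.
have lne : ln e <= - (2 * (K%:R + 2)) by rewrite -[leRHS]expRK ler_ln ?posrE ?expR_gt0.
have : ln ss%:R <= ln T%:R :> R.
  by rewrite ler_ln ?posrE ?ler_nat// ltr0n nparams_gt0.
rewrite rateE HE => lnsT.
have -> : 3 * (ss%:R * m) = ss%:R * (3 * m) by ring.
have ell0 : 0 <= ell by rewrite ln_ge0// ler1n.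
have K0 : 0 <= K%:R :> R by [].
rewrite ler_pM2l// /m; move: lns lne lnT_v lnsT v_ge0; lra.
Qed.

End rate_at_sparsity.

Lemma approx_error_witness (R : realType) (sigma : R -> R) (w : nat -> nat) (L : nat)
    (B : R) (f0 : (w 0).-tuple R -> R) (s : nat) (t : R) :
  0 < t -> approx_error sigma L B f0 s \is a fin_num ->
  exists theta : (nparams w L).-tuple R,
    [/\ (norm0 theta <= s)%N, bounded_params B theta &
      forall x, cube (w 0) x ->
        `|net sigma theta x - f0 x| <= Num.sqrt (fine (approx_error sigma L B f0 s) + t)].
Proof.
move=> t0 fin; have [_ [theta [th0 thB] <-]] := lb_ereal_inf_adherent t0 fin.
rewrite -/(approx_error _ _ _ _ _) -(fineK fin) -EFinD => sup_lt.
exists theta; split => // x xc.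
set S := sup_norm _ in sup_lt.
have xS : (`|net sigma theta x - f0 x|%:E <= S)%E by apply: ereal_sup_ubound; exists x.
have x2 : ((`|net sigma theta x - f0 x| ^+ 2)%:E <= S ^+ 2)%E.
  by rewrite EFin_expe lee_sqr ?lee_fin// (le_trans _ xS) ?lee_fin.
have := le_lt_trans x2 sup_lt; rewrite lte_fin => /ltW x2t.
by rewrite -[leLHS]ger0_norm// -sqrtr_sqr ler_wsqrtr.
Qed.

Lemma near_ln_ge (R : realType) (c : R) : \forall n \near \oo, c <= ln n%:R.
Proof.
have := nbhs_infty_ger (expR c); apply: filterS => n cn.
by rewrite -[leLHS]expRK ler_ln ?posrE ?expR_gt0// (lt_le_trans (expR_gt0 c)).
Qed.

Lemma inner_probability_cvg1 (R : realType) (d : nat -> measure_display)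
    (Omega : forall n, measurableType (d n)) (P : forall n, probability (Omega n) R)
    (E : forall n, set (Omega n)) (c : R) :
  (\forall n \near \oo, exists A : set (Omega n),
    [/\ measurable A, A `<=` E n & ((1 - c / n%:R)%:E <= P n A)%E]) ->
  with_probability_tending_to_one P E.
Proof.
move=> [n0 _ n0P].
have exA n : exists A : set (Omega n), [/\ measurable A, A `<=` E n &
    (n0 <= n)%N -> ((1 - c / n%:R)%:E <= P n A)%E].
  have [n0n|nn0] := leqP n0 n.
    by have [B [mB BE PB]] := n0P n n0n; exists B.
  (* Below [n0] the empty set is a valid inner approximation and does not affect the limit. *)
  by exists set0; split => // n0n; move: nn0; rewrite ltnNge n0n.
pose A n := projT1 (cid (exA n)).
have AP n : [/\ measurable (A n), A n `<=` E n &
    (n0 <= n)%N -> ((1 - c / n%:R)%:E <= P n (A n))%E] := projT2 (cid (exA n)).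
exists A; split; first by move=> n; have [] := AP n.
apply: (@squeeze_cvge _ _ _ _ (fun n : nat => (1 - c / n%:R)%:E) _ (fun=> 1%E)).
- exists n0 => // n n0n; have [mA _ PA] := AP n; apply/andP; split; first exact: PA.
  exact: probability_le1.
- apply: cvg_EFin; first by near=> n.
  rewrite -[X in _ --> X]subr0; apply: cvgB; first exact: cvg_cst.
  rewrite -(mulr0 c); apply: cvgM; first exact: cvg_cst.
  apply/gtr0_cvgV0; first by near=> n; rewrite ltr0n; near: n; exact: nbhs_infty_gt.
  exact: cvgr_idn.
- exact: cvg_cst.
Unshelve. all: by end_near. Qed.

(** * The risk bound at one sample size *)

Section risk_at_n.
Context (R : realType) (sigma : R -> R) (sigma_lip : 1.-lipschitz sigma).
Variables (p L N n K ss : nat).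
Hypotheses (p_gt0 : (0 < p)%N) (L_gt0 : (0 < L)%N) (N_gt0 : (0 < N)%N).
Hypothesis depth1 : N = 1%N -> (L <= K)%N.
Let w := const_widths p N.
Let T := nparams w L.
Context (s : R) (f0 : p.-tuple R -> R) d (Omega : measurableType d) (P : probability Omega R).
Variables (X : 'I_n -> {RV P >-> p.-tuple R}) (eps : 'I_n -> {RV P >-> R}).
Hypotheses (s_gt0 : 0 < s) (f0_meas : measurable_fun (cube p) f0).
Hypothesis model : sampling_model s X eps.
Variables (B c s0 kappa lambda : R).
Hypotheses (c_gt0 : 0 < c) (s0_gt0 : 0 < s0) (kappa_gt0 : 0 < kappa).
Let r := rate n p L N ss : R.
Let xi := approx_error sigma (w := w) L B f0 ss.
(** The growth bounds ask for a parameter bound of at least 1; a parameter bounded by [B] is also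
    bounded by [B1]. *)
Let B1 := Num.max B 1.
Let ell : R := ln n%:R.

(** The first entry feeds the comparison of [H] with the rate. The second makes the bias at most 1:
    the rate is at most twice this level, so (1 / c + 1) r <= 1. *)
Definition small_level : R :=
  Num.min (expR (- (2 * (K%:R + 2)))) ((1 / c + 1)^-1 / 2).

Definition risk_const : R :=
  rate_const sigma s s0 B1 kappa (K%:R + 3) (K%:R + 5) 3 (1 / c + 1).

Definition risk_tail_const : R :=
  tail_const sigma s s0 B1 kappa (K%:R + 3) (K%:R + 5) 3 (1 / c + 1).

Hypotheses (n_gt0 : (0 < n)%N) (T_ge2 : (2 <= T)%N) (ss_ge1 : (1 <= ss)%N) (ss_leT : (ss <= T)%N).
Hypotheses (lambda_gt0 : 0 < lambda).
Hypothesis lambdaE : - ln lambda = ln T%:R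
     + kappa * (L.+1%:R * ln N%:R + ln (Num.sqrt n%:R * p%:R)).
Hypotheses (ell_ge2 : 2 <= ell) (ell_geK : 2 * ln (2 * K.+1%:R) + 2 <= ell).
Hypotheses (ell_ge_tail : risk_tail_const <= ell) (n_geB : B1 <= n%:R).
Hypothesis small_a : ss%:R * ln (p%:R * Num.sqrt (n%:R / ss%:R)) <= small_level * n%:R.
Hypothesis small_b : L.+1%:R * ss%:R * ln N%:R <= small_level * n%:R.
Hypothesis balanced : c <= r / fine xi.

Let H : R := L.+1%:R * ln N%:R + ln (Num.sqrt n%:R * p%:R).
Let H_ge1 : 1 <= H. Proof. exact: complexity_ge1. Qed.
Let nR : 0 < n%:R :> R. Proof. by rewrite ltr0n. Qed.
Let c40 : 0 < 1 / c + 1. Proof. by rewrite addr_gt0// divr_gt0. Qed.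

Let level_exp : small_level <= expR (- (2 * (K%:R + 2))).
Proof. by rewrite ge_min lexx. Qed.

Let ssH_le : ss%:R * H <= 3 * (n%:R * r).
Proof. by apply: complexity_le_rate level_exp _ small_a small_b. Qed.

Lemma rate_gt0 : 0 < r.
Proof.
have ss1 : 1 <= ss%:R :> R by rewrite ler1n.
have : H <= ss%:R * H by rewrite ler_peMl// (le_trans ler01).
rewrite -(pmulr_rgt0 _ nR); move: ssH_le H_ge1; lra.
Qed.

Lemma fine_approx_error_gt0 : 0 < fine xi.
Proof.
have : 0 < r / fine xi by exact: lt_le_trans balanced.
by rewrite pmulr_rgt0 ?rate_gt0// invr_gt0.
Qed.

(** [fine] sends infinite values to 0, so a positive [fine xi] forces finiteness. *)
Lemma approx_error_fin_num : xi \is a fin_num.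
Proof. by move: fine_approx_error_gt0; case: xi => //=; rewrite ltxx. Qed.

Lemma risk_le_rate : exists A : set Omega, [/\ measurable A, ((1 - 5 / n%:R)%:E <= P A)%E &
    forall om, A om -> forall qhat,
      is_variational_posterior
        (posterior s (fun i => X i om) (fun i => f0 (X i om) + eps i om) sigma_lip
           (spike_slab_prior T lambda s0)) qhat ->
      (\int[qhat]_theta d2 s (net sigma theta) f0 <= (risk_const * (r * ell ^+ 2))%:E)%E].
Proof.
have r0 := rate_gt0.
(* The infimum is approached within [r], so V^2 = xi + r, and the balance condition bounds this by
   (1 / c + 1) r: the squared bias is of the order of the rate. *)
have [tstar [ths thB thV]] := approx_error_witness r0 approx_error_fin_num.
rewrite -/xi in thV; set V := Num.sqrt _ in thV.
have xi_le : fine xi <= r / c.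
  by rewrite ler_pdivlMr// mulrC -ler_pdivlMr// fine_approx_error_gt0.
have V2 : V ^+ 2 <= (1 / c + 1) * r.
  rewrite sqr_sqrtr; last by rewrite addr_ge0// ltW// fine_approx_error_gt0.
  have -> : (1 / c + 1) * r = r / c + r by ring.
  exact: lerD.
have V1 : V <= 1.
  rewrite -(@ler_pXn2r _ 2)// ?nnegrE ?sqrtr_ge0// expr1n; apply: le_trans V2 _.
  have r_small := rate_le_small p_gt0 n_gt0 ss_ge1 small_a small_b.
  have : small_level <= (1 / c + 1)^-1 / 2 by rewrite ge_min lexx orbT.
  rewrite ler_pdivlMr// mulrC => /(le_trans r_small) sl.
  have := ler_wpM2l (ltW c40) sl; rewrite mulfV ?gt_eqF//.
have thB1 : bounded_params B1 tstar.
  by move=> i; apply: le_trans (thB i) _; rewrite le_max lexx.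
have B1_ge1 : 1 <= B1 by rewrite le_max lexx orbT.
have w_gt0 k : (0 < w k)%N by case: k.
have kH : 0 < kappa * H by rewrite mulr_gt0// (lt_le_trans ltr01).
have K0 : 0 <= K%:R :> R by [].
have l01 : 0 < lambda < 1.
  rewrite lambda_gt0 -(lnK lambda_gt0) -expR0 ltr_expR.
  have : 0 <= ln T%:R :> R by rewrite ln_ge0// ler1n ltnW.
  by move: lambdaE kH; rewrite -/H; lra.
have [A [mA PA AP]] := finite_sample_risk sigma_lip w_gt0 model s_gt0 n_gt0 f0_meas
  l01 s0_gt0 B1_ge1 (sqrtr_ge0 _) V1 thB1 thV (ss * (Num.truncn ell).+1) kH n_geB.
exists A; split => // om Aom qhat qhatP; apply: le_trans (AP om Aom qhat qhatP) _.
rewrite lee_fin; apply: (@risk_rate_le _ sigma s s0 B1 kappa (K%:R + 3) (K%:R + 5) 3 (1 / c + 1)) => //.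
- exact: ltW.
- by apply: le_trans ell_ge2; rewrite ler1n.
- exact: depth_le_complexity.
- exact: ln_nparams_le_complexity.
- exact: rate_le_complexity.
Qed.

End risk_at_n.

Theorem theorem4p1 (R : realType)
  (p L N : nat -> nat)
  (p_gt0 : forall n, (0 < p n)%N)
  (L_gt0 : forall n, (0 < L n)%N)
  (N_gt0 : forall n, (0 < N n)%N)
  (width1_depth : exists K : nat, forall n, N n = 1%N -> (L n <= K)%N)
  (w := fun n => const_widths (p n) (N n))
  (T := fun n => nparams (w n) (L n))
  (T_infty : T @ \oo --> \oo)
  (sigma : R -> R) (sigma_lip : 1.-lipschitz sigma)
  (s_eps : R) (s_eps_gt0 : 0 < s_eps)
  (f0 : forall n, (p n).-tuple R -> R)
  (f0_meas : forall n, measurable_fun (cube (p n)) (f0 n))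
  (d : nat -> measure_display) (Omega : forall n, measurableType (d n))
  (P : forall n, probability (Omega n) R)
  (X : forall n, 'I_n -> {RV (P n) >-> (p n).-tuple R})
  (eps : forall n, 'I_n -> {RV (P n) >-> R})
  (model : forall n, sampling_model s_eps (X n) (eps n))
  (Y := fun n (i : 'I_n) (om : Omega n) => f0 n (X n i om) + eps n i om)
  (B : R) (B_gt0 : 0 < B)
  (r := fun n => rate n (p n) (L n) (N n))
  (xi := fun n => approx_error sigma (w := w n) (L n) B (f0 n))
  (sstar : nat -> nat)
  (sstarP : forall n, is_optimal_sparsity (T n) (r n) (xi n) (sstar n))
  (rstar := fun n => r n (sstar n))
  (xistar := fun n => xi n (sstar n))
  (small : (fun n => Num.max
      ((sstar n)%:R * ln ((p n)%:R * Num.sqrt (n%:R / (sstar n)%:R)))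
      ((L n).+1%:R * (sstar n)%:R * ln (N n)%:R) : R) =o_\oo
    (fun n => n%:R : R))
  (balanced : asymp rstar (fun n => fine (xistar n)))
  (s0 : R) (s0_gt0 : 0 < s0)
  (kappa : R) (kappa_gt0 : 0 < kappa)
  (lambda : nat -> R) (lambda_gt0 : forall n, 0 < lambda n)
  (lambdaE : forall n, - ln (lambda n) = ln (T n)%:R
     + kappa * ((L n).+1%:R * ln (N n)%:R + ln (Num.sqrt n%:R * (p n)%:R)))
  (post := fun n (om : Omega n) =>
     posterior s_eps (fun i => X n i om) (fun i => Y n i om) sigma_lip
       (spike_slab_prior (T n) (lambda n) s0))
  (delta : R) (delta_gt1 : 1 < delta)
  (epsstar := fun n => Num.sqrt (rstar n) * (ln n%:R `^ delta)) :
  exists2 C : R, 0 < C &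
    forall C' : nat -> R, diverging C' ->
    with_probability_tending_to_one P (fun n => [set om |
      forall qhat, is_variational_posterior (post n om) qhat ->
      (\int[qhat]_theta d2 s_eps (net sigma theta) (f0 n)
        <= (C * epsstar n ^+ 2)%:E
           + (C' n)%:E * ((rstar n)%:E + xistar n))%E]).
Proof.
have [K depth1] := width1_depth.
have [c [c_max [c_gt0 bal]]] := balanced.
have e_gt0 : 0 < small_level K c.
  by rewrite lt_min expR_gt0 divr_gt0// invr_gt0 addr_gt0// divr_gt0.
have /eqoP /(_ _ e_gt0) small_ev := small.
pose C0 := risk_const sigma K s_eps B c s0 kappa.
(* The maximum with 1 makes the constant positive without inspecting the sign of [C0]. *)
exists (Num.max C0 1) => [|C' [C'_gt0 _]]; first by rewrite lt_max ltr01 orbT.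
apply: (@inner_probability_cvg1 _ _ _ _ _ 5); near=> n.
have n_gt0 : (0 < n)%N by near: n; exact: nbhs_infty_gt.
have T_ge2 : (2 <= T n)%N by near: n; exact: T_infty _ (nbhs_infty_ge 2).
have /andP[ss_ge1 ss_leT] := (sstarP n).1.
have ell_ge2 : 2 <= ln n%:R :> R by near: n; exact: near_ln_ge.
have : Num.max
    ((sstar n)%:R * ln ((p n)%:R * Num.sqrt (n%:R / (sstar n)%:R)))
    ((L n).+1%:R * (sstar n)%:R * ln (N n)%:R) <= small_level K c * n%:R.
  apply: le_trans (ler_norm _) _; rewrite -[X in _ <= _ * X]ger0_norm//.
  by near: n; exact: small_ev.
rewrite ge_max => /andP[small_a small_b].
have bal_n : c <= rstar n / fine (xistar n).
  by near: n; apply: filterS bal => n /andP[].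
have ell_geK : 2 * ln (2 * K.+1%:R) + 2 <= ln n%:R :> R by near: n; exact: near_ln_ge.
have ell_ge_tail : risk_tail_const sigma K s_eps B c s0 kappa <= ln n%:R.
  by near: n; exact: near_ln_ge.
have n_geB : Num.max B 1 <= n%:R by near: n; exact: nbhs_infty_ger.
have r_gt0 : 0 < rstar n.
  exact: (rate_gt0 (p_gt0 n) (L_gt0 n) (N_gt0 n) (@depth1 n) n_gt0 ss_ge1 ss_leT ell_ge2
    ell_geK small_a small_b).
have xi_gt0 : 0 < fine (xistar n).
  exact: (fine_approx_error_gt0 (p_gt0 n) (L_gt0 n) (N_gt0 n) (@depth1 n) c_gt0 n_gt0 ss_ge1
    ss_leT ell_ge2 ell_geK small_a small_b bal_n).
have xi_fin : xistar n \is a fin_num.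
  exact: (approx_error_fin_num (p_gt0 n) (L_gt0 n) (N_gt0 n) (@depth1 n) c_gt0 n_gt0 ss_ge1
    ss_leT ell_ge2 ell_geK small_a small_b bal_n).
have [A [mA PA AP]] := risk_le_rate sigma_lip (p_gt0 n) (L_gt0 n) (N_gt0 n) (@depth1 n)
  s_eps_gt0 (f0_meas n) (model n) c_gt0 s0_gt0 kappa_gt0 n_gt0 T_ge2 ss_ge1 ss_leT
  (lambda_gt0 n) (lambdaE n) ell_ge2 ell_geK ell_ge_tail n_geB small_a small_b bal_n.
exists A; split => // om Aom qhat /(AP om Aom) risk_le; apply: le_trans risk_le _.
apply: (@le_trans _ _ (Num.max C0 1 * epsstar n ^+ 2)%:E); last first.
  apply: leeDl; apply: mule_ge0; first by rewrite lee_fin ltW.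
  apply: adde_ge0; first by rewrite lee_fin ltW.
  by rewrite -(fineK xi_fin) lee_fin ltW.
rewrite lee_fin -/(rstar n) -/C0.
have re_ge0 : 0 <= rstar n * ln n%:R ^+ 2 by apply: mulr_ge0; [exact: ltW|exact: sqr_ge0].
apply: (@le_trans _ _ (Num.max C0 1 * (rstar n * ln n%:R ^+ 2))).
  by apply: ler_wpM2r => //; rewrite le_max lexx.
apply: ler_wpM2l; first by rewrite le_max ler01 orbT.
(* What remains is ln(n)^2 <= (ln(n)^delta)^2, true because delta > 1 and ln n >= 1. *)
rewrite /epsstar exprMn sqr_sqrtr ?(ltW r_gt0)//; apply: ler_wpM2l; first exact: ltW.
have ell1 : 1 <= ln n%:R :> R by apply: le_trans ell_ge2; rewrite ler1n.
rewrite lerXn2r ?nnegrE ?powR_ge0// ?(le_trans ler01)//.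
by apply: le1r_powR => //; exact: ltW.
Unshelve. all: by end_near. Qed.
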